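(* Let $1<\alpha\le2$, $a>0$ and $c\le1$. There exists a constant $C>0$, independent of the dimension $n$, such that the following holds for every $n\ge1$. Set $R_a=(an)^{1/\alpha}$ and let $\mu$ be a probability measure on $\mathbb R^n$ of the form $d\mu=\frac1Ze^{-V}dx$, with $Z$ a normalization constant and $V:\mathbb R^n\to\mathbb R$ smooth satisfying $$\mathrm{Hess}\,V(x)\ge c(\alpha-1)\,(an)^{1-\frac2\alpha}\ \text{ if }|x|\le R_a,\qquad V(x)=\frac{|x|^\alpha}{\alpha}\ \text{ if }|x|\ge R_a.$$ Then $$\lambda_1(\mu)\ge C\,\min\Big(\frac1{4a},\frac{\alpha-1}2,c(\alpha-1)\Big)(an)^{1-\frac2\alpha}\quad\text{if }a\ge1,$$ $$\lambda_1(\mu)\ge C\,\min\Big(\frac14,\frac{\alpha-1}2,\,c\,a^{1-\frac2\alpha}(\alpha-1)\Big)n^{1-\frac2\alpha}\quad\text{if }0<a<1.$$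
   Context: $|x|$ is the Euclidean norm on $\mathbb R^n$. $\mathrm{Hess}\,V(x)\ge k$ means $\mathrm{Hess}\,V(x)\ge kI_n$ in the sense of quadratic forms. $\Delta_\mu$ is the non-negative self-adjoint operator on $L^2(\mathbb R^n,\mu)$ associated with the form $\int\nabla u\cdot\nabla v\,d\mu$ on $H^1(\mathbb R^n,\mu)$, and $\lambda_1(\mu)=\inf[\sigma(\Delta_\mu)\setminus\{0\}]$ is its spectral gap; equivalently, $\lambda_1(\mu)$ is the largest $\lambda\ge0$ such that $\lambda\int|u-\int u\,d\mu|^2d\mu\le\int|\nabla u|^2d\mu$ for all $u\in H^1(\mathbb R^n,\mu)$. *)

(* Defs.v *)
From HB Require Import structures.
From mathcomp Require Import all_boot all_order all_algebra.
From mathcomp Require Import all_classical all_reals all_analysis.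
Set Implicit Arguments.
Unset Strict Implicit.
Unset Printing Implicit Defensive.
Import Order.TTheory GRing.Theory Num.Theory.
Import numFieldNormedType.Exports.
Local Open Scope classical_set_scope.
Local Open Scope ring_scope.

(* R^n is the type 'rV[R]_n. Its sigma-algebra is generated by the coordinate
   functions, as for n.-tuple T in the library; for T := R this is the Borel
   sigma-algebra of R^n. *)
Definition measure_rV_display : measure_display -> measure_display.
Proof. exact. Qed.

Section measurable_rV.
Context {d} {T : measurableType d}.
Variable n : nat.

Let coors : 'I_n -> 'rV[T]_n -> T := fun i x => x ord0 i.

Let rV_set0 : g_sigma_preimage coors set0.
Proof. exact: sigma_algebra0. Qed.

Let rV_setC A : g_sigma_preimage coors A -> g_sigma_preimage coors (~` A).
Proof. exact: sigma_algebraC. Qed.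

Let rV_bigcup (F : _^nat) : (forall i, g_sigma_preimage coors (F i)) ->
  g_sigma_preimage coors (\bigcup_i (F i)).
Proof. exact: sigma_algebra_bigcup. Qed.

HB.instance Definition _ := @isMeasurable.Build (measure_rV_display d)
  'rV[T]_n (g_sigma_preimage coors) rV_set0 rV_setC rV_bigcup.

Lemma measurable_coord (i : 'I_n) :
  measurable_fun [set: 'rV[T]_n] (fun x : 'rV[T]_n => x ord0 i).
Proof.
move=> _ A mA; rewrite setTI; apply: sub_sigma_algebra.
by rewrite -bigcup_seq; exists i => /=; [rewrite mem_index_enum|exists A => //; rewrite setTI].
Qed.

Lemma measurable_fun_coordP d1 (T1 : measurableType d1) (f : T1 -> 'rV[T]_n) :
  (forall i, measurable_fun [set: T1] (fun x => f x ord0 i)) ->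
  measurable_fun [set: T1] f.
Proof.
move=> mf.
apply: (measurability (\big[setU/set0]_(i < n) preimage_set_system setT (coors i) measurable)).
  by [].
move=> _ [C + <-]; rewrite -bigcup_seq => -[i _ [A mA <-]].
have := mf i measurableT A mA; rewrite !setTI.
by [].
Qed.

End measurable_rV.

Section lebesgue_rV.
Context {R : realType}.

Definition rV_cons n (p : measurableTypeR R * 'rV[R]_n) : 'rV[R]_n.+1 :=
  \row_i oapp (p.2 ord0) p.1 (unlift ord0 i).

Lemma measurable_rV_cons n : measurable_fun [set: measurableTypeR R * 'rV[R]_n] (@rV_cons n).
Proof.
apply: measurable_fun_coordP => i.
case: (unliftP ord0 i) => [j ->|->].
  rewrite (_ : (fun x => _) = (fun y : 'rV[R]_n => y ord0 j) \o snd); last first.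
    by apply/funext => x /=; rewrite mxE liftK.
  by apply: measurableT_comp; [exact: measurable_coord|exact: measurable_snd].
rewrite (_ : (fun x => _) = fst) ?measurable_fst//.
by apply/funext => x /=; rewrite mxE unlift_none.
Qed.


Section step.
Variables (n : nat) (m : {sigma_finite_measure set 'rV[R]_n -> \bar R}).

Definition lebesgue_rV_step : set 'rV[R]_n.+1 -> \bar R :=
  pushforward (@lebesgue_measure R \x m)%E (@rV_cons n).

Let step0 : lebesgue_rV_step set0 = 0%E.
Proof. by rewrite /lebesgue_rV_step /pushforward preimage_set0 measure0. Qed.

Let step_ge0 A : (0 <= lebesgue_rV_step A)%E.
Proof. by rewrite /lebesgue_rV_step /pushforward; exact: measure_ge0. Qed.

Let step_sigma_additive : semi_sigma_additive lebesgue_rV_step.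
Proof.
have mf A : measurable A -> measurable (@rV_cons n @^-1` A).
  by move=> mA; rewrite -[X in measurable X]setTI; exact: measurable_rV_cons.
move=> F mF tF mUF; rewrite /lebesgue_rV_step /pushforward preimage_bigcup.
apply: measure_semi_sigma_additive.
- by move=> k; apply: mf; apply: mF.
- apply/trivIsetP => /= i j _ _ ij; rewrite -preimage_setI.
  by move/trivIsetP : tF => /(_ _ _ _ _ ij) ->//; rewrite preimage_set0.
- by rewrite -preimage_bigcup; exact: mf.
Qed.

HB.instance Definition _ := isMeasure.Build _ _ _ lebesgue_rV_step
  step0 step_ge0 step_sigma_additive.

Let rV_uncons (x : 'rV[R]_n.+1) : measurableTypeR R * 'rV[R]_n :=
  (x ord0 ord0, \row_j x ord0 (lift ord0 j)).

Let rV_consK : cancel (@rV_cons n) rV_uncons.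
Proof.
move=> [a y]; rewrite /rV_uncons !mxE unlift_none; congr pair.
by apply/rowP => j; rewrite !mxE liftK.
Qed.

Let measurable_rV_uncons : measurable_fun [set: 'rV[R]_n.+1] rV_uncons.
Proof.
apply/measurable_fun_pairP; split; first exact: measurable_coord.
apply: measurable_fun_coordP => j.
rewrite (_ : (fun x => _) = fun x : 'rV[R]_n.+1 => x ord0 (lift ord0 j)).
  exact: measurable_coord.
by apply/funext => x; rewrite /= mxE.
Qed.

Let step_sigma_finite : sigma_finite setT lebesgue_rV_step.
Proof.
have /sigma_finiteP[F [TF ndF Foo]] := sigma_finiteT (@lebesgue_measure R).
have /sigma_finiteP[G [TG ndG Goo]] := sigma_finiteT m.
exists (fun k => rV_uncons @^-1` (F k `*` G k)).
  rewrite -preimage_bigcup -[LHS](preimage_setT rV_uncons); congr (_ @^-1` _).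
  apply/seteqP; split => // -[x y] _.
  have [i _ Fx] : (\bigcup_k F k) x by rewrite -TF.
  have [j _ Gy] : (\bigcup_k G k) y by rewrite -TG.
  exists (maxn i j) => //; split.
  - by move: x Fx; exact/subsetPset/ndF/leq_maxl.
  - by move: y Gy; exact/subsetPset/ndG/leq_maxr.
move=> k; have [mF Fk] := Foo k; have [mG Gk] := Goo k; split.
  rewrite -[X in measurable X]setTI; apply: measurable_rV_uncons => //.
  exact: measurableX.
rewrite /lebesgue_rV_step /pushforward -comp_preimage.
rewrite (_ : rV_uncons \o _ = id) ?preimage_id; last exact/funext/rV_consK.
by rewrite product_measure1E// lte_mul_pinfty// ge0_fin_numE.
Qed.

HB.instance Definition _ := @Measure_isSigmaFinite.Build _ _ _ lebesgue_rV_step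
  step_sigma_finite.

End step.

Fixpoint lebesgue_rV n : {sigma_finite_measure set 'rV[R]_n -> \bar R} :=
  match n with
  | 0 => dirac (0 : 'rV[R]_0)
  | n'.+1 => lebesgue_rV_step (lebesgue_rV n')
  end.

Lemma lebesgue_rV_box n (A : 'I_n -> set R) : (forall i, measurable (A i)) ->
  lebesgue_rV n [set x | forall i, A i (x ord0 i)] =
  (\prod_(i < n) lebesgue_measure (A i))%E.
Proof.
elim: n A => [|n IH] A mA.
  rewrite big_ord0 /= diracE mem_set//=.
  by case.
rewrite big_ord_recl -IH; last by move=> i; exact: mA.
have mB : measurable [set y : 'rV[R]_n | forall i, A (lift ord0 i) (y ord0 i)].
  rewrite (_ : [set y | _] = \bigcap_(i in [set: 'I_n])
     ((fun y : 'rV[R]_n => y ord0 i) @^-1` A (lift ord0 i))); last first.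
    by apply/seteqP; split => y h i; [move=> _; exact: (h i)|exact: (h i I)].
  apply: fin_bigcap_measurable => // i _.
  by rewrite -[X in measurable X]setTI; exact: measurable_coord.
have <- := product_measure1E (@lebesgue_measure R) (lebesgue_rV n) (mA ord0) mB.
rewrite [LHS]/= /lebesgue_rV_step /pushforward; congr product_measure1.
apply/seteqP; split => -[a y] /=.
  move=> h; split; first by move: (h ord0); rewrite mxE unlift_none.
  by move=> i; move: (h (lift ord0 i)); rewrite mxE liftK.
move=> [ha hy] i; rewrite mxE; case: (unliftP ord0 i) => [j ->|->] //=.
Qed.

End lebesgue_rV.

Section calculus.
Context {R : realType} {n : nat}.
Implicit Types (x y v : 'rV[R]_n) (f V : 'rV[R]_n -> R).

Definition dot x y : R := \sum_i x ord0 i * y ord0 i.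

(* Euclidean norm; the library's `|x| on 'rV[R]_n is the sup norm. *)
Definition enorm x : R := Num.sqrt (dot x x).

Definition partial (i : 'I_n) f : 'rV[R]_n -> R := 'D_(delta_mx ord0 i) f.

(* C^oo: all the iterated partial derivatives are differentiable everywhere. *)
Definition smooth f : Prop :=
  forall (s : seq 'I_n) x, differentiable (foldr partial f s) x.

Definition hessian V x : 'M[R]_n := \matrix_(i, j) partial i (partial j V) x.

(* Hess V(x) >= k I_n in the sense of quadratic forms. *)
Definition hess_ge V x (k : R) : Prop :=
  forall v, k * dot v v <= (v *m hessian V x *m v^T) ord0 ord0.

Definition test_function f : Prop :=
  smooth f /\ exists r : R, forall x, r <= enorm x -> f x = 0.

End calculus.

Section sobolev.
Context {R : realType} {n : nat}.
Variable mu : {measure set 'rV[R]_n -> \bar R}.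
Implicit Types (u v f w : 'rV[R]_n -> R) (g h : 'rV[R]_n -> 'rV[R]_n).

(* u is in H^1(R^n, mu) and has weak gradient g. The distributional identity
   is with respect to Lebesgue measure; its integrals converge as soon as mu
   has a continuous positive density, since then functions of L^2(mu) are
   locally integrable. *)
Definition H1 u g : Prop :=
  [/\ u \in Lfun mu 2%:E,
      (forall i, (fun x => g x ord0 i) \in Lfun mu 2%:E) &
      forall (phi : 'rV[R]_n -> R) (i : 'I_n), test_function phi ->
        \int[lebesgue_rV n]_x (u x * partial i phi x) =
        - \int[lebesgue_rV n]_x (g x ord0 i * phi x)].

(* The graph of the operator associated with the form \int grad u . grad v dmu
   on H^1(mu): u is in the domain and Delta_mu u = w (mu-almost everywhere). *)
Definition Delta u w : Prop :=
  w \in Lfun mu 2%:E /\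
  exists2 g, H1 u g & forall v h, H1 v h ->
    \int[mu]_x dot (g x) (h x) = \int[mu]_x (w x * v x).

(* Delta_mu - lam is a bijection from its domain onto L^2(mu), with bounded
   inverse. *)
Definition resolvent_set : set R := [set lam |
  (forall f, f \in Lfun mu 2%:E ->
     exists u w, Delta u w /\ forall x, w x - lam * u x = f x) /\
  (exists M : R, forall u w, Delta u w ->
     ('N[mu]_2%:E[EFin \o u] <=
      M%:E * 'N[mu]_2%:E[EFin \o (fun x => w x - lam * u x)%R])%E)].

(* Delta_mu is self-adjoint, hence its spectrum is a set of real numbers. *)
Definition spectrum : set R := ~` resolvent_set.

(* The infimum is taken in \bar R, so that inf set0 = +oo. *)
Definition lambda1 : \bar R := ereal_inf [set lam%:E | lam in spectrum `\ 0].

End sobolev.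

(* dmu = Z^-1 e^{-V} dx *)
Definition gibbs_measure {R : realType} {n : nat} (V : 'rV[R]_n -> R) (Z : R)
    (mu : {measure set 'rV[R]_n -> \bar R}) : Prop :=
  0 < Z /\ forall A : set 'rV[R]_n, measurable A ->
    mu A = (\int[lebesgue_rV n]_(x in A) (Z^-1 * expR (- V x))%:E)%E.

(* Main.v *)
Require Import Defs.
From HB Require Import structures.
From mathcomp Require Import all_boot all_order all_algebra.
From mathcomp Require Import all_classical all_reals all_analysis.
From mathcomp Require Import measurable_realfun ring lra.

(** The spectral gap is the best constant in a Poincare inequality, and the
    potential V is of two kinds. On a ball of radius of order (a n)^(1/alpha) it
    is uniformly convex, and outside it is |x|^alpha / alpha, which is so steep
    that the measure cannot hide mass there. The proof glues the two regimes.

    In the ball, Hess V >= k gives k Var <= energy ([poincare_strongly_convex]).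
    This is the Brascamp-Lieb inequality for constant k, obtained by linearising
    the Prekopa-Leindler inequality ([prekopa_leindler]) at e^{su} and e^{-su}.

    Outside, the divergence theorem for the field g^2 e^{-V} x / sqrt(P + |x|^2)
    gives S^2 int g^2 e^{-V} <= 64 int |grad g|^2 e^{-V} for g vanishing where
    |x|^2 < P ([tail_inequality]): x . grad V = |x|^alpha beats the divergence n
    of x as soon as |x|^alpha >= 2 n.

    Two cutoffs at the scale sqrt P split a function into an inner and an outer
    part. Each gradient of a cutoff gives an error supported in the other region
    and small when P is a large multiple of (a n)^(2/alpha), so the errors are
    absorbed ([compactly_supported_poincare]); what remains is the square of a
    weighted mean of the function, which a constant shift removes. The constants
    k and S^2 are both multiples of (a n)^(1 - 2/alpha), with factors that depend
    on alpha, a and c only ([lambda1_lower]).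

    To pass from functions of compact support to H^1(mu), functions are truncated
    and mollified ([H1_dense]); this rests on the continuity of translations in
    L^2 and on the fact that the density of mu is bounded above and below on
    cubes.

    Finally, for lam below the Poincare constant and different from 0 the form
    int grad u . grad v - lam int u v becomes coercive once a multiple of the
    product of the means is added. The completeness of H^1(mu) and the Riesz
    theorem ([riesz_representation]) then invert Delta - lam, so that lam lies in
    the resolvent set ([coercive_resolvent], [poincare_lambda1]). For c <= 0 the
    claim is that the spectrum is nonnegative, which is the case lam < 0. *)

Set Implicit Arguments.
Unset Strict Implicit.
Unset Printing Implicit Defensive.
Import Order.TTheory GRing.Theory Num.Theory.
Import numFieldNormedType.Exports.
Local Open Scope classical_set_scope.
Local Open Scope ring_scope.

(** * Change of measure and translation invariance *)

Section change_of_measure.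
Context d1 d2 (T1 : measurableType d1) (T2 : measurableType d2) (R : realType).
Local Open Scope ereal_scope.
Import HBNNSimple.

Lemma ge0_integral_image (m1 : {measure set T1 -> \bar R})
    (m2 : {measure set T2 -> \bar R}) (phi : T1 -> T2) (f : T2 -> \bar R) :
  measurable_fun setT phi ->
  (forall A, measurable A -> m2 A = m1 (phi @^-1` A)) ->
  measurable_fun setT f -> (forall y, 0 <= f y) ->
  \int[m2]_y f y = \int[m1]_x f (phi x).
Proof.
move=> mphi m12 mf f0.
pose phiM : {mfun T1 >-> T2} := HB.pack phi (isMeasurableFun.Build _ _ _ _ _ mphi).
rewrite (eq_measure_integral (pushforward m1 phiM)); last by move=> A mA _; exact: m12.
by rewrite ge0_integral_pushforward// preimage_setT.
Qed.

(** Both sides are continuous along an increasing approximation of f by simple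
    functions, and for indicators this is the definition of the density. *)
Lemma ge0_integral_density (m mu : {measure set T1 -> \bar R}) (p : T1 -> R)
    (f : T1 -> \bar R) :
  measurable_fun setT p -> (forall x, (0 <= p x)%R) ->
  (forall A, measurable A -> mu A = \int[m]_(x in A) (p x)%:E) ->
  measurable_fun setT f -> (forall x, 0 <= f x) ->
  \int[mu]_x f x = \int[m]_x (f x * (p x)%:E).
Proof.
move=> mp p0 muE mf f0.
have mpE : measurable_fun setT (EFin \o p) by exact/measurable_EFinP.
pose h := nnsfun_approx measurableT mf.
have cvgh x : (EFin \o h n) x @[n --> \oo] --> f x.
  by apply: cvg_nnsfun_approx => //= y _; exact: f0.
have -> : \int[mu]_x f x = limn (fun n => \int[mu]_x (EFin \o h n) x).
  rewrite -monotone_convergence//.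
  - by apply: eq_integral => x _; apply/esym/cvg_lim => //; exact: cvgh.
  - by move=> n; exact/measurable_EFinP/measurable_funP.
  - by move=> n x _; rewrite lee_fin.
  - by move=> x _ a b ab; rewrite lee_fin; exact/lefP/nd_nnsfun_approx.
have -> : \int[m]_x (f x * (p x)%:E) =
    limn (fun n => \int[m]_x ((EFin \o h n) x * (p x)%:E)).
  rewrite -monotone_convergence//.
  - apply: eq_integral => x _; apply/esym/cvg_lim => //.
    by apply: cvgeZr => //; exact: cvgh.
  - by move=> n; apply: emeasurable_funM => //; exact/measurable_EFinP/measurable_funP.
  - by move=> n x _; rewrite mule_ge0// lee_fin.
  - move=> x _ a b ab; rewrite lee_wpmul2r ?lee_fin//.
    exact/lefP/nd_nnsfun_approx.
congr (limn _); apply/funext => n.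
transitivity (\int[mu]_x (\sum_(y \in range (h n))
    (y * \1_(h n @^-1` [set y]) x)%:E)).
  by apply: eq_integral => t tE; rewrite /= fimfunE -fsumEFin.
have indich r : measurable_fun setT (fun x => (r * \1_(h n @^-1` [set r]) x)%:E).
  by apply/measurable_EFinP; exact: measurable_funM.
rewrite ge0_integral_fsum//; last by move=> r x _; exact: nnfun_muleindic_ge0.
transitivity (\int[m]_x (\sum_(y \in range (h n))
    ((y * \1_(h n @^-1` [set y]) x)%:E * (p x)%:E))); last first.
  apply: eq_integral => x _; rewrite -ge0_mule_fsuml => [|y]; last exact: nnfun_muleindic_ge0.
  by rewrite /= [in RHS]fimfunE -fsumEFin.
rewrite ge0_integral_fsum//; last 2 first.
  by move=> r; apply: emeasurable_funM.
  by move=> r x _; rewrite mule_ge0 ?nnfun_muleindic_ge0 ?lee_fin.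
apply: eq_fsbigr => r _.
rewrite integralZl_indic_nnsfun// integral_indic// setIT muE//.
have [r0|r0] := leP 0%R r; last first.
  rewrite preimage_nnfun0// integral_set0 mule0.
  by rewrite integral0_eq// => x _; rewrite indic0 mulr0 mul0e.
rewrite integral_mkcond -ge0_integralZl//; last 2 first.
  by apply/(measurable_restrictT _ _).1 => //; exact: measurable_funTS.
  by move=> x _; apply: erestrict_ge0 => y _; rewrite lee_fin.
apply: eq_integral => x _; rewrite patchE indicE; case: ifPn => _.
  by rewrite mulr1.
by rewrite mulr0 mule0 mul0e.
Qed.

End change_of_measure.

Section measure_rV.
Context {R : realType}.
Local Open Scope ereal_scope.
Local Notation Leb := (@lebesgue_measure R).

(** The right-hand side is a measure with the right value on intervals. *)
Lemma lebesgue_affine_preimage (a b : R) (A : set (measurableTypeR R)) :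
  (0 < a)%R -> measurable A ->
  Leb A = a%:E * Leb ((fun x => a * x + b)%R @^-1` A).
Proof.
move=> a0 mA.
pose phi (x : measurableTypeR R) : measurableTypeR R := (a * x + b)%R.
have mphi : measurable_fun [set: measurableTypeR R] phi.
  by apply: measurable_funD => //; exact: measurable_funM.
pose phiM : {mfun measurableTypeR R >-> measurableTypeR R} :=
  HB.pack phi
    (isMeasurableFun.Build _ _ _ _ _ mphi).
pose nu : {measure set (measurableTypeR R) -> \bar R} := mscale (NngNum (ltW a0)) (pushforward Leb phiM).
rewrite (@lebesgue_measure_unique _ (nu mphi))//.
move=> _ [[x y] _ <-]; transitivity (a%:E * Leb (phi @^-1` `]x, y])); last by [].
rewrite (_ : _ @^-1` _ = `]((x - b) / a)%R, ((y - b) / a)%R]%classic); last first.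
  apply/seteqP; split => z /=; rewrite !in_itv/=.
    by rewrite ltr_pdivrMr// ler_pdivlMr// ltrBlDr lerBrDr mulrC.
  by rewrite ltr_pdivrMr// ler_pdivlMr// ltrBlDr lerBrDr mulrC.
rewrite !lebesgue_measure_itv/= !lte_fin ltr_pM2r ?invr_gt0// ltrBlDr subrK.
case: ifPn => _; last by rewrite mule0.
by rewrite -!EFinB -EFinM; congr EFin; field; rewrite gt_eqF.
Qed.

Lemma ge0_integral_translation1 (b : R) (f : R -> \bar R) :
  measurable_fun setT f -> (forall x, 0 <= f x) ->
  \int[Leb]_x f (x + b)%R = \int[Leb]_x f x.
Proof.
move=> mf f0; apply/esym/(@ge0_integral_image _ _ _ _ _ Leb Leb) => //.
- exact: measurable_funD.
- move=> A mA.
  apply: (etrans (lebesgue_affine_preimage b ltr01 mA)); rewrite mul1e.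
  by congr (Leb _); apply/seteqP; split => x /=; rewrite mul1r.
Qed.

Lemma measurable_rV_cons_section n (t : R) :
  measurable_fun setT (fun y : 'rV[R]_n => rV_cons (t, y)).
Proof.
apply: (@measurableT_comp _ _ _ _ _ _ (@rV_cons R n)); first exact: measurable_rV_cons.
exact: measurable_pair1.
Qed.

Lemma ge0_integral_rVS n (f : 'rV[R]_n.+1 -> \bar R) :
  measurable_fun setT f -> (forall x, 0 <= f x) ->
  \int[lebesgue_rV n.+1]_x f x =
  \int[Leb]_t \int[lebesgue_rV n]_y f (rV_cons (t, y)).
Proof.
move=> mf f0.
rewrite (@ge0_integral_image _ _ _ _ _ (Leb \x lebesgue_rV n)%E _ (@rV_cons R n))//;
  last exact: measurable_rV_cons.
rewrite fubini_tonelli1//.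
by apply: measurableT_comp => //; exact: measurable_rV_cons.
Qed.

Lemma measurable_translate n (h : 'rV[R]_n) :
  measurable_fun setT (fun x : 'rV[R]_n => (x + h)%R).
Proof.
apply: measurable_fun_coordP => i.
rewrite (_ : (fun x => _) = (fun x : 'rV[R]_n => x ord0 i + h ord0 i)%R); last first.
  by apply/funext => x; rewrite mxE.
by apply: measurable_funD => //; exact: measurable_coord.
Qed.

Lemma ge0_integral_translation n (h : 'rV[R]_n) (f : 'rV[R]_n -> \bar R) :
  measurable_fun setT f -> (forall x, 0 <= f x) ->
  \int[lebesgue_rV n]_x f (x + h)%R = \int[lebesgue_rV n]_x f x.
Proof.
elim: n h f => [|n IH] h f mf f0.
  by apply: eq_integral => x _; congr f; apply/rowP => -[].
rewrite !ge0_integral_rVS//; last first.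
  by apply: measurableT_comp => //; exact: measurable_translate.
pose h' := (\row_j h ord0 (lift ord0 j))%R : 'rV[R]_n.
have consD (t : R) (y : 'rV[R]_n) :
    (rV_cons (t, y) + h = rV_cons (t + h ord0 ord0, y + h'))%R.
  apply/rowP => i; rewrite !mxE.
  by case: (unliftP ord0 i) => [j ->|->]//=; rewrite !mxE.
rewrite -(@ge0_integral_translation1 (h ord0 ord0)
  (fun t => \int[lebesgue_rV n]_y f (rV_cons (t, y)))).
- apply: eq_integral => t _.
  rewrite -(IH h' (fun y => f (rV_cons (t + h ord0 ord0, y))%R)).
  + by apply: eq_integral => y _; rewrite consD.
  + apply: measurableT_comp => //; exact: measurable_rV_cons_section.
  + by [].
- apply: (@measurable_fun_fubini_tonelli_F _ _ (measurableTypeR R) 'rV[R]_n R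
    (lebesgue_rV n) (fun p => f (rV_cons p))) => //.
  by apply: measurableT_comp => //; exact: measurable_rV_cons.
- by move=> t; exact: integral_ge0.
Qed.

End measure_rV.

(** * The Prekopa-Leindler inequality on the line *)

Section prekopa_leindler_line.
Context {R : realType}.
Local Notation Leb := (@lebesgue_measure R).
Implicit Types (f g h : R -> R) (A B C : set R).

(** If a is close to sup A and b to inf B, then C contains the nearly disjoint
    halved copies (A + b) / 2 and (a + B) / 2, which lie on either side of
    (a + b) / 2. *)
Lemma brunn_minkowski_line A B C (r : R) :
  measurable A -> measurable B -> measurable C ->
  A !=set0 -> B !=set0 ->
  (forall x, A x -> `|x| <= r) -> (forall x, B x -> `|x| <= r) ->
  (forall x y, A x -> B y -> C ((x + y) / 2)) ->
  (Leb A + Leb B <= 2%:E * Leb C)%E.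
Proof.
move=> mA mB mC A0 B0 Ar Br ABC.
apply/lee_addgt0Pr => e e0.
have e20 : 0 < e / 2 by rewrite divr_gt0.
have hA : has_sup A.
  by split => //; exists r => x /Ar; exact: le_trans (ler_norm _).
have hB : has_inf B.
  split => //; exists (- r) => x /Br; rewrite ler_norml => /andP[]//.
have [a Aa aA] := sup_adherent e20 hA.
have [b Bb bB] := inf_adherent e20 hB.
pose A' := A `&` `]-oo, a].
pose B' := B `&` `]b, +oo[.
have mA' : measurable A' by exact: measurableI.
have mB' : measurable B' by exact: measurableI.
have I1 : Leb `]a, a + e / 2] = (e / 2)%:E.
  by rewrite lebesgue_measure_itv/= lte_fin ltrDl e20 -EFinB addrAC subrr add0r.
have I2 : Leb `[b - e / 2, b] = (e / 2)%:E.
  rewrite lebesgue_measure_itv/= lte_fin ltrBlDr ltrDl e20 -EFinB.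
  by rewrite opprB addrC subrK.
have lA : (Leb A <= Leb A' + (e / 2)%:E)%E.
  apply: (@le_trans _ _ (Leb (A' `|` `]a, a + e / 2]))).
    apply: le_measure; rewrite ?inE//; first exact: measurableU.
    move=> x Ax; rewrite /A' /= !in_itv/=.
    have [xa|ax] := leP x a; [by left|right].
    by rewrite /= (le_trans (ub_le_sup _ Ax) (ltW _))//; [case: hA|lra].
  rewrite -I1; exact: measureU2.
have lB : (Leb B <= Leb B' + (e / 2)%:E)%E.
  apply: (@le_trans _ _ (Leb (B' `|` `[b - e / 2, b]))).
    apply: le_measure; rewrite ?inE//; first exact: measurableU.
    move=> x Bx; rewrite /B' /= !in_itv/= andbT.
    have [xb|bx] := leP x b; [right|by left].
    by rewrite /= andbT (le_trans (ltW _) (ge_inf _ Bx))//; [lra|case: hB].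
  rewrite -I2; exact: measureU2.
have two : (0 : R) < 2 by [].
have EA := lebesgue_affine_preimage (- b) two mA'.
have EB := lebesgue_affine_preimage (- a) two mB'.
set A2 := _ @^-1` A' in EA; set B2 := _ @^-1` B' in EB.
have maff c : measurable_fun [set: R] (fun x : R => 2 * x + c).
  by apply: measurable_funD => //; exact: measurable_funM.
have mA2 : measurable A2 by rewrite -[A2]setTI; exact: maff.
have mB2 : measurable B2 by rewrite -[B2]setTI; exact: maff.
have : (Leb A2 + Leb B2 <= Leb C)%E.
  rewrite -measureU//; last first.
    apply/seteqP; split => // x [[_ /=]]; rewrite in_itv/= => h1 [_ /=].
    by rewrite in_itv/= andbT => h2; exfalso; lra.
  apply: le_measure; rewrite ?inE//; first exact: measurableU.
  move=> x [[Ax _]|[Bx _]].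
    by rewrite (_ : x = ((2 * x + - b) + b) / 2); [exact: ABC|lra].
  by rewrite (_ : x = (a + (2 * x + - a)) / 2); [exact: ABC|lra].
move=> h.
apply: (@le_trans _ _ ((Leb A' + (e / 2)%:E) + (Leb B' + (e / 2)%:E))%E).
  exact: leeD.
rewrite addeACA -EFinD -splitr EA EB leeD2r//.
apply: (@le_trans _ _ (2%:E * (Leb A2 + Leb B2))%E).
  by rewrite ge0_muleDr ?measure_ge0.
by rewrite lee_wpmul2l.
Qed.

(** The point (x, t) lies under the graph of f. Tonelli's theorem for this
    indicator is the layer cake formula. *)
Let under_graph f (t x : R) : R := \1_[set p : R * R | 0 <= p.2 < f p.1] (x, t).

Let measurable_under_graph f : measurable_fun setT f ->
  measurable_fun [set: measurableTypeR R * measurableTypeR R]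
    (fun p => (under_graph f p.2 p.1)%:E).
Proof.
move=> mf; apply/measurable_EFinP.
rewrite (_ : (fun p => _) = \1_[set p : R * R | 0 <= p.2 < f p.1]); last first.
  by apply/funext => -[].
apply: measurable_indic.
pose f1 (p : measurableTypeR R * measurableTypeR R) : bool := (0 <= p.2).
pose f2 (p : measurableTypeR R * measurableTypeR R) : bool := (p.2 < f p.1).
rewrite [X in measurable X](_ : _ = f1 @^-1` [set true] `&` f2 @^-1` [set true]); last first.
  by apply/seteqP; split => p /= => [/andP[]|[? ?]]//; apply/andP.
apply: measurableI.
- have : measurable_fun setT f1 by apply: measurable_fun_ler.
  by move=> /(_ measurableT [set true]); rewrite setTI; exact.
- have : measurable_fun setT f2.
    by apply: measurable_fun_ltr => //; exact: measurableT_comp.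
  by move=> /(_ measurableT [set true]); rewrite setTI; exact.
Qed.

Let measurable_superlevel f t : measurable_fun setT f ->
  measurable [set x | t < f x].
Proof.
move=> mf.
have -> : [set x | t < f x] = f @^-1` `]t, +oo[.
  by apply/seteqP; split => x /=; rewrite in_itv/= andbT.
by rewrite -[X in measurable X]setTI; exact: mf.
Qed.

Let level_measure f t : measurable_fun setT f ->
  (\int[Leb]_x (under_graph f t x)%:E)%E =
  if 0 <= t then Leb [set x | t < f x] else 0%E.
Proof.
move=> mf; case: ifPn => t0; last first.
  by apply: integral0_eq => x _; rewrite /under_graph indicE memNset//= (negbTE t0).
transitivity (\int[Leb]_x (\1_[set x | t < f x] x)%:E)%E.
  apply: eq_integral => x _; congr EFin; rewrite /under_graph !indicE.
  by congr (nat_of_bool _)%:R; apply/idP/idP; rewrite !inE/= t0.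
by rewrite integral_indic ?setIT//; exact: measurable_superlevel.
Qed.

Let layer_cake f : measurable_fun setT f -> (forall x, 0 <= f x) ->
  (\int[Leb]_x (f x)%:E = \int[Leb]_t \int[Leb]_x (under_graph f t x)%:E)%E.
Proof.
move=> mf f0.
have := @fubini_tonelli _ _ (measurableTypeR R) (measurableTypeR R) R Leb Leb _
  (measurable_under_graph mf).
rewrite /= => <-; last by move=> x; rewrite lee_fin.
apply: eq_integral => x _.
transitivity (\int[Leb]_t (\1_`[0, f x[ t)%:E)%E.
  rewrite integral_indic//= setIT lebesgue_measure_itv/= lte_fin.
  have := f0 x; rewrite le_eqVlt => /predU1P[<-|->]; first by rewrite ltxx.
  by rewrite EFinN sube0.
by apply: eq_integral => t _; congr EFin; rewrite /under_graph !indicE.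
Qed.

Let measurable_level f : measurable_fun setT f ->
  measurable_fun setT (fun t => \int[Leb]_x (under_graph f t x)%:E)%E.
Proof.
move=> mf.
apply: (@measurable_fun_fubini_tonelli_G _ _ (measurableTypeR R) (measurableTypeR R) R
  Leb (fun p => (under_graph f p.2 p.1)%:E)); last by move=> p; rewrite lee_fin.
exact: measurable_under_graph.
Qed.

(** When f and g have supremum 1, all their level sets below 1 are nonempty, so
    the one-dimensional Brunn-Minkowski inequality applies at every level: the
    level sets of h at height t contain the midpoints of those of f and g. *)
Lemma prekopa_leindler_line_normalized f g h (r : R) :
  measurable_fun setT f -> measurable_fun setT g -> measurable_fun setT h ->
  (forall x, 0 <= f x <= 1) -> (forall x, 0 <= g x <= 1) -> (forall x, 0 <= h x) ->
  (forall x, r < `|x| -> f x = 0) -> (forall x, r < `|x| -> g x = 0) ->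
  (forall t, t < 1 -> exists x, t < f x) -> (forall t, t < 1 -> exists x, t < g x) ->
  (forall x y, f x * g y <= h ((x + y) / 2) ^+ 2) ->
  (\int[Leb]_x (f x)%:E + \int[Leb]_x (g x)%:E <= 2%:E * \int[Leb]_x (h x)%:E)%E.
Proof.
move=> mf mg mh f01 g01 h0 fr gr f1 g1 fgh.
rewrite !layer_cake//; [|by move=> x; case/andP: (g01 x)|by move=> x; case/andP: (f01 x)].
have level0 k t : (0 <= \int[Leb]_x (under_graph k t x)%:E)%E.
  by apply: integral_ge0 => x _; rewrite lee_fin.
rewrite -ge0_integralD//; [|exact: measurable_level|exact: measurable_level].
rewrite -ge0_integralZl//; last exact: measurable_level.
apply: ge0_le_integral => //.
- by move=> t _; rewrite adde_ge0.
- by apply: emeasurable_funD; exact: measurable_level.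
- by apply: emeasurable_funM => //; exact: measurable_level.
move=> t _; rewrite !level_measure//.
have [t0|t0] := leP 0 t; last by rewrite mule0 adde0.
have [t1|t1] := ltP t 1; last first.
  rewrite (_ : [set x | t < f x] = set0); last first.
    by apply/seteqP; split => // x /=; have /andP[_ ?] := f01 x; lra.
  rewrite (_ : [set x | t < g x] = set0); last first.
    by apply/seteqP; split => // x /=; have /andP[_ ?] := g01 x; lra.
  by rewrite measure0 adde0 mule_ge0// lee_fin.
apply: (@brunn_minkowski_line _ _ _ r); [exact: measurable_superlevel..| | | | |].
- by have [x ?] := f1 _ t1; exists x.
- by have [x ?] := g1 _ t1; exists x.
- by move=> x /= tf; rewrite leNgt; apply/negP => /fr fx; lra.
- by move=> x /= tf; rewrite leNgt; apply/negP => /gr fx; lra.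
- move=> x y /= tf tg; rewrite -(@ltr_pXn2r _ 2)// ?nnegrE//.
  apply: lt_le_trans (fgh x y); rewrite expr2 ltr_pM//.
Qed.

Definition bounded_support1 f := measurable_fun setT f /\
  exists M r : R, (forall x, `|f x| <= M) /\ (forall x, r < `|x| -> f x = 0).

Lemma integrable_bounded_support1 f : bounded_support1 f ->
  Leb.-integrable setT (EFin \o f).
Proof.
move=> [mf [M [r [fM fr]]]].
apply: (@le_integrable _ _ _ Leb setT measurableT _
  (fun x : R => (M * \1_(`[- r, r]%classic : set R) x)%:E)).
- exact/measurable_EFinP.
- move=> x _ /=; rewrite lee_fin indicE.
  have M0 : 0 <= M by exact: le_trans (fM x).
  have [xr|xr] := leP `|x| r.
    by rewrite mem_set/= ?mulr1 ?(ger0_norm M0)// in_itv/= -ler_norml.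
  by rewrite fr// normr0.
- under eq_fun do rewrite EFinM.
  by apply: integrableZl => //; exact: integrable_indic_itv.
Qed.

(** Dividing f, g and h by sup f, sup g and the geometric mean of the two
    preserves the hypothesis; the arithmetic-geometric mean inequality then
    turns the bound on the sum into a bound on the product. *)
Lemma prekopa_leindler_line f g h :
  bounded_support1 f -> bounded_support1 g -> bounded_support1 h ->
  (forall x, 0 <= f x) -> (forall x, 0 <= g x) -> (forall x, 0 <= h x) ->
  (forall x y, f x * g y <= h ((x + y) / 2) ^+ 2) ->
  (\int[Leb]_x f x) * (\int[Leb]_x g x) <= (\int[Leb]_x h x) ^+ 2.
Proof.
move=> Bf Bg Bh f0 g0 h0 fgh.
have [f00|/existsNP[xf /eqP fx]] := pselect (forall x, f x = 0).
  rewrite (_ : \int[Leb]_x f x = 0) ?mul0r ?sqr_ge0//.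
  by rewrite /Rintegral integral0_eq// => x _; rewrite f00.
have [g00|/existsNP[xg /eqP gx]] := pselect (forall x, g x = 0).
  rewrite (_ : \int[Leb]_x g x = 0) ?mulr0 ?sqr_ge0//.
  by rewrite /Rintegral integral0_eq// => x _; rewrite g00.
have sup_facts k xk : bounded_support1 k -> (forall x, 0 <= k x) -> k xk != 0 ->
    [/\ 0 < sup (range k), (forall x, k x <= sup (range k)) &
       forall t, t < sup (range k) -> exists x, t < k x].
  move=> [_ [M [_ [kM _]]]] k0 kx.
  have hk : has_sup (range k).
    split; first by exists (k xk), xk.
    by exists M => _ [x _ <-]; exact: le_trans (ler_norm _) (kM x).
  have kle x : k x <= sup (range k) by apply: ub_le_sup; [case: hk|exists x].
  split => //; first by apply: lt_le_trans (kle xk); rewrite lt_def kx k0.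
  move=> t tk; have kt : 0 < sup (range k) - t by rewrite subr_gt0.
  have [_ [x _ <-]] := sup_adherent kt hk.
  by rewrite subKr => ?; exists x.
have [a0 fa fta] := sup_facts f xf Bf f0 fx.
have [b0 gb gtb] := sup_facts g xg Bg g0 gx.
set a := sup (range f) in a0 fa fta; set b := sup (range g) in b0 gb gtb.
have [mf [Mf [rf [_ frf]]]] := Bf.
have [mg [Mg [rg [_ grg]]]] := Bg.
have [mh _] := Bh.
pose s := Num.sqrt (a * b).
have s0 : 0 < s by rewrite sqrtr_gt0 mulr_gt0.
have s2 : s ^+ 2 = a * b by rewrite sqr_sqrtr// ltW// mulr_gt0.
have := @prekopa_leindler_line_normalized (fun x => a^-1 * f x)
  (fun x => b^-1 * g x) (fun x => s^-1 * h x) (Num.max rf rg).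
have iF := integrable_bounded_support1 Bf.
have iG := integrable_bounded_support1 Bg.
have iH := integrable_bounded_support1 Bh.
have EZ k c : Leb.-integrable setT (EFin \o k) ->
    (\int[Leb]_x (c * k x)%:E = (c * \int[Leb]_x k x)%:E)%E.
  move=> ik; rewrite EFinM /Rintegral fineK; last exact: integrable_fin_num.
  by rewrite -integralZl//.
rewrite !EZ// -EFinD -EFinM lee_fin => H.
set F := Rintegral _ _ _ in H *; set G := Rintegral _ _ _ in H *.
set K := Rintegral _ _ _ in H *.
have F0 : 0 <= F by apply: Rintegral_ge0.
have G0 : 0 <= G by apply: Rintegral_ge0.
have {}H : a^-1 * F + b^-1 * G <= 2 * (s^-1 * K).
  apply: H.
  - by apply: measurable_funM.
  - by apply: measurable_funM.
  - by apply: measurable_funM.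
  - by move=> x; rewrite mulr_ge0 ?invr_ge0 ?(ltW a0)//= mulrC ler_pdivrMr// mul1r.
  - by move=> x; rewrite mulr_ge0 ?invr_ge0 ?(ltW b0)//= mulrC ler_pdivrMr// mul1r.
  - by move=> x; rewrite mulr_ge0 ?invr_ge0 ?(ltW s0).
  - by move=> x xr; rewrite frf ?mulr0//; apply: le_lt_trans xr; rewrite le_max lexx.
  - by move=> x xr; rewrite grg ?mulr0//; apply: le_lt_trans xr; rewrite le_max lexx orbT.
  - move=> t t1; have [|x tx] := fta (t * a); first by rewrite gtr_pMl.
    by exists x; rewrite mulrC ltr_pdivlMr.
  - move=> t t1; have [|x tx] := gtb (t * b); first by rewrite gtr_pMl.
    by exists x; rewrite mulrC ltr_pdivlMr.
  - move=> x y; rewrite exprMn exprVn s2 invfM mulrACA ler_wpM2l//.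
    by rewrite mulr_ge0// invr_ge0 ltW.
have K0 : 0 <= K by apply: Rintegral_ge0.
rewrite -(@ler_pM2l _ (a^-1 * b^-1)) ?mulr_gt0 ?invr_gt0//.
rewrite mulrACA -invfM -s2 -exprVn -exprMn.
apply: (@le_trans _ _ (((a^-1 * F + b^-1 * G) / 2) ^+ 2)).
  by rewrite -subr_ge0; set X := _ * F; set Y := _ * G;
     rewrite (_ : _ - _ = ((X - Y) / 2) ^+ 2) ?sqr_ge0//; field.
rewrite ler_sqr ?nnegrE ?divr_ge0 ?addr_ge0 ?mulr_ge0 ?invr_ge0 ?(ltW a0) ?(ltW b0) ?(ltW s0)//.
by rewrite ler_pdivrMr// [leRHS]mulrC.
Qed.

End prekopa_leindler_line.

(** * The Prekopa-Leindler inequality on R^n *)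

Section bounded_support.
Context {R : realType}.
Local Notation Leb := (@lebesgue_measure R).

Definition cube n (r : R) : set 'rV[R]_n :=
  [set x | forall i, x ord0 i \in `[- r, r]].

Definition bounded_support n (f : 'rV[R]_n -> R) := measurable_fun setT f /\
  exists M r : R, (forall x, `|f x| <= M) /\
    (forall (x : 'rV[R]_n) i, r < `|x ord0 i| -> f x = 0).

Lemma measurable_cube n r : measurable (@cube n r).
Proof.
rewrite (_ : @cube n r = \bigcap_(i in [set: 'I_n])
     ((fun y : 'rV[R]_n => y ord0 i) @^-1` `[- r, r])); last first.
  by apply/seteqP; split => y h i; [move=> _; exact: (h i)|exact: (h i I)].
apply: fin_bigcap_measurable => // i _.
by rewrite -[X in measurable X]setTI; exact: measurable_coord.
Qed.

Lemma lebesgue_rV_cube n r : 0 <= r ->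
  lebesgue_rV n (@cube n r) = ((r + r) ^+ n)%:E.
Proof.
move=> r0; transitivity (\prod_(i < n) Leb `[(- r)%R, r])%E.
  by rewrite -lebesgue_rV_box.
rewrite lebesgue_measure_itv/= lte_fin.
have -> : (if - r < r then (r%:E - (- r)%:E)%E else 0%E) = (r + r)%:E.
  move: r0; rewrite le_eqVlt => /predU1P[<-|r0]; first by rewrite oppr0 ltxx addr0.
  by rewrite gtrN// -EFinB opprK.
by rewrite prodEFin big_const card_ord iter_mulr_1.
Qed.

Lemma integrable_cube n r : 0 <= r ->
  (lebesgue_rV n).-integrable setT (EFin \o \1_(@cube n r)).
Proof.
move=> r0; have mc := @measurable_cube n r.
apply/integrableP; split; first exact/measurable_EFinP.
rewrite (eq_integral (fun x => (\1_(@cube n r) x)%:E)); last first.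
  by move=> t _; rewrite gee0_abs// lee_fin.
by rewrite integral_indic//= setIT lebesgue_rV_cube// ltry.
Qed.

Section one_function.
Variables (n : nat) (f : 'rV[R]_n -> R) (M r : R).
Hypotheses (mf : measurable_fun setT f) (r0 : 0 <= r).
Hypotheses (fM : forall x, `|f x| <= M) (fr : forall (x : 'rV[R]_n) i, r < `|x ord0 i| -> f x = 0).

Lemma le_cube_indicator x : `|f x| <= M * \1_(@cube n r) x.
Proof.
have M0 : 0 <= M by exact: le_trans (fM x).
rewrite indicE; case: (boolP (x \in @cube n r)) => [_|]; first by rewrite mulr1.
rewrite notin_setE => /existsNP[i /negP xi].
by rewrite (@fr x i) ?normr0 ?mulr0// ltNge ler_norml; move: xi; rewrite in_itv.
Qed.

Lemma integrable_cube_indicator :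
  (lebesgue_rV n).-integrable setT (fun x => (M * \1_(@cube n r) x)%:E).
Proof.
under eq_fun do rewrite EFinM.
by apply: integrableZl => //; exact: integrable_cube.
Qed.

Lemma integrable_on_cube : (lebesgue_rV n).-integrable setT (EFin \o f).
Proof.
apply: (@le_integrable _ _ _ _ setT measurableT _ _ _ _ integrable_cube_indicator).
- exact/measurable_EFinP.
- move=> x _ /=; rewrite lee_fin [leRHS]ger0_norm; first exact: le_cube_indicator.
  by apply: le_trans (le_cube_indicator x).
Qed.

Lemma norm_Rintegral_le_cube : `|\int[lebesgue_rV n]_x f x| <= M * (r + r) ^+ n.
Proof.
apply: (le_trans (le_normr_Rintegral _ integrable_on_cube)) => //.
have -> : M * (r + r) ^+ n = \int[lebesgue_rV n]_x (M * \1_(@cube n r) x).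
  rewrite RintegralZl//; last exact: integrable_cube.
  rewrite /Rintegral integral_indic//=; last exact: measurable_cube.
  by rewrite setIT lebesgue_rV_cube.
apply: le_Rintegral => //; last by move=> x _; exact: le_cube_indicator.
- by apply: integrable_norm; exact: integrable_on_cube.
- exact: integrable_cube_indicator.
Qed.

End one_function.

Lemma bounded_supportP n (f : 'rV[R]_n -> R) : bounded_support f ->
  measurable_fun setT f /\ exists M r : R, [/\ 0 <= M, 0 <= r, (forall x, `|f x| <= M) &
    (forall (x : 'rV[R]_n) i, r < `|x ord0 i| -> f x = 0)].
Proof.
move=> [mf [M [r [fM fr]]]]; split => //; exists M, (Num.max r 0); split => //.
- exact: le_trans (fM 0).
- by rewrite le_max lexx orbT.
- by move=> x i xi; apply: (fr x i); apply: le_lt_trans xi; rewrite le_max lexx.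
Qed.

Lemma integrable_bounded_support n (f : 'rV[R]_n -> R) : bounded_support f ->
  (lebesgue_rV n).-integrable setT (EFin \o f).
Proof.
by move=> /bounded_supportP[mf [M [r [M0 r0 fM fr]]]]; exact: (integrable_on_cube mf r0 fM fr).
Qed.

Lemma bounded_support_section n (f : 'rV[R]_n.+1 -> R) t : bounded_support f ->
  bounded_support (fun y => f (rV_cons (t, y))).
Proof.
move=> [mf [M [r [fM fr]]]]; split.
  by apply: measurableT_comp => //; exact: measurable_rV_cons_section.
exists M, r; split => // x i xi; apply: (fr _ (lift ord0 i)).
by rewrite mxE liftK.
Qed.

Lemma Rintegral_rVS n (f : 'rV[R]_n.+1 -> R) : bounded_support f ->
  (forall x, 0 <= f x) ->
  bounded_support1 (fun t => \int[lebesgue_rV n]_y f (rV_cons (t, y))) /\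
  \int[lebesgue_rV n.+1]_x f x =
    \int[Leb]_t \int[lebesgue_rV n]_y f (rV_cons (t, y)).
Proof.
move=> bf f0; have [mf [M [r [M0 r0 fM fr]]]] := bounded_supportP bf.
have E t : (\int[lebesgue_rV n]_y (f (rV_cons (t, y)))%:E =
    (\int[lebesgue_rV n]_y f (rV_cons (t, y)))%:E)%E.
  rewrite /Rintegral fineK//; apply: integrable_fin_num => //.
  by have := integrable_bounded_support (bounded_support_section t bf).
split; last first.
  congr fine; rewrite ge0_integral_rVS//; last exact/measurable_EFinP.
  by apply: eq_integral => t _; rewrite E.
split.
  have : measurable_fun setT (fun t => \int[lebesgue_rV n]_y (f (rV_cons (t, y)))%:E)%E.
    apply: (@measurable_fun_fubini_tonelli_F _ _ (measurableTypeR R) 'rV[R]_n R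
      (lebesgue_rV n) (fun p => (f (rV_cons p))%:E)).
      apply/measurable_EFinP; apply: measurableT_comp => //; exact: measurable_rV_cons.
    by move=> p; rewrite lee_fin.
  by under eq_fun do rewrite E; move/measurable_EFinP.
exists (M * (r + r) ^+ n), r; split => [t|t rt].
  apply: norm_Rintegral_le_cube => //; first by case: (bounded_support_section t bf).
  by move=> x i xi; apply: (fr _ (lift ord0 i)); rewrite mxE liftK.
rewrite /Rintegral integral0_eq// => y _.
by rewrite (fr _ ord0)// mxE unlift_none.
Qed.

(** Induction on the dimension: by the case of dimension n the partial integrals
    over the last n coordinates satisfy the hypothesis on the line. *)
Lemma prekopa_leindler n (f g h : 'rV[R]_n -> R) :
  bounded_support f -> bounded_support g -> bounded_support h ->
  (forall x, 0 <= f x) -> (forall x, 0 <= g x) -> (forall x, 0 <= h x) ->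
  (forall x y, f x * g y <= h (2^-1 *: (x + y)) ^+ 2) ->
  (\int[lebesgue_rV n]_x f x) * (\int[lebesgue_rV n]_x g x) <=
    (\int[lebesgue_rV n]_x h x) ^+ 2.
Proof.
elim: n f g h => [|n IH] f g h bf bg bh f0 g0 h0 fgh.
  have E (k : 'rV[R]_0 -> R) : measurable_fun setT k -> (forall x, 0 <= k x) ->
      \int[lebesgue_rV 0]_x k x = k 0.
    move=> mk k0; rewrite /Rintegral integral_dirac//; last exact/measurable_EFinP.
    by rewrite diracT mul1e.
  rewrite !E//; [|by case: bh|by case: bg|by case: bf].
  by apply: le_trans (fgh 0 0) _; rewrite addr0 scaler0.
have [bF ->] := Rintegral_rVS bf f0.
have [bG ->] := Rintegral_rVS bg g0.
have [bH ->] := Rintegral_rVS bh h0.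
apply: prekopa_leindler_line => //.
- by move=> t; apply: Rintegral_ge0.
- by move=> t; apply: Rintegral_ge0.
- by move=> t; apply: Rintegral_ge0.
move=> t s; apply: IH => //; try exact: bounded_support_section.
move=> x y; apply: le_trans (fgh _ _) _.
rewrite (_ : 2^-1 *: _ = rV_cons ((t + s) / 2, 2^-1 *: (x + y)))//.
apply/rowP => i; rewrite !mxE; case: (unliftP ord0 i) => [j _|_]/=.
  by rewrite !mxE.
by rewrite mulrC.
Qed.

End bounded_support.

(** * The scalar product; measurability of continuous functions *)

Section dot_product.
Context {R : realType} {n : nat}.
Implicit Types x y z : 'rV[R]_n.

Lemma dotC x y : dot x y = dot y x.
Proof. by apply: eq_bigr => i _; rewrite mulrC. Qed.

Lemma dotDl x y z : dot (x + y) z = dot x z + dot y z.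
Proof. by rewrite -big_split; apply: eq_bigr => i _; rewrite mxE mulrDl. Qed.

Lemma dotDr x y z : dot z (x + y) = dot z x + dot z y.
Proof. by rewrite dotC dotDl !(dotC z). Qed.

Lemma dotZl a x y : dot (a *: x) y = a * dot x y.
Proof. by rewrite mulr_sumr; apply: eq_bigr => i _; rewrite mxE mulrA. Qed.

Lemma dotZr a x y : dot x (a *: y) = a * dot x y.
Proof. by rewrite dotC dotZl dotC. Qed.

Lemma dotNl x y : dot (- x) y = - dot x y.
Proof. by rewrite -scaleN1r dotZl mulN1r. Qed.

Lemma dotNr x y : dot x (- y) = - dot x y.
Proof. by rewrite dotC dotNl dotC. Qed.

Lemma dot0l x : dot 0 x = 0.
Proof. by rewrite -(scale0r 0) dotZl mul0r. Qed.

Lemma dot0r x : dot x 0 = 0. Proof. by rewrite dotC dot0l. Qed.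

Lemma dot_ge0 x : 0 <= dot x x.
Proof. by apply: sumr_ge0 => i _; rewrite -expr2 sqr_ge0. Qed.

Lemma sqr_coord_le_dot x i : x ord0 i ^+ 2 <= dot x x.
Proof.
rewrite /dot (bigD1 i)//= -expr2 lerDl.
by apply: sumr_ge0 => j _; rewrite -expr2 sqr_ge0.
Qed.

Lemma enorm_ge0 x : 0 <= enorm x. Proof. exact: sqrtr_ge0. Qed.

Lemma sqr_enorm x : enorm x ^+ 2 = dot x x.
Proof. by rewrite sqr_sqrtr ?dot_ge0. Qed.

Lemma coord_le_enorm x i : `|x ord0 i| <= enorm x.
Proof.
rewrite -(@ler_pXn2r _ 2)// ?nnegrE ?enorm_ge0// sqr_enorm.
by rewrite real_normK ?num_real// sqr_coord_le_dot.
Qed.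

Lemma sqr_dot_le x y : dot x y ^+ 2 <= dot x x * dot y y.
Proof.
have := dot_ge0 y; rewrite le_eqVlt => /predU1P[y0|y0].
  rewrite -y0 mulr0 (_ : dot x y = 0) ?expr0n//.
  apply: big1 => i _; have := sqr_coord_le_dot y i.
  rewrite -y0 => h; have /eqP : y ord0 i ^+ 2 == 0 by rewrite eq_le h sqr_ge0.
  by move/eqP; rewrite sqrf_eq0 => /eqP ->; rewrite mulr0.
have := dot_ge0 (dot y y *: x - dot x y *: y).
rewrite dotDl !dotDr !dotNl !dotNr !dotZl !dotZr (dotC y x) opprK.
set a := dot x x; set b := dot y y in y0 *; set c := dot x y => h.
rewrite -subr_ge0 -(pmulr_lge0 _ y0).
by move: h; rewrite (_ : _ + _ = (a * b - c ^+ 2) * b)//; ring.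
Qed.

End dot_product.

Section measurable_continuous.
Context {R : realType} {n : nat}.

Let grid (k : nat) (x : 'rV[R]_n) : {ffun 'I_n -> int} :=
  [ffun i => Num.floor (k.+1%:R * x ord0 i)].
Let point (k : nat) (z : {ffun 'I_n -> int}) : 'rV[R]_n :=
  \row_i ((z i)%:~R / k.+1%:R).

(** A continuous function is the limit of its samplings on finer and finer
    grids, and these have countably many values. *)
Lemma measurable_continuous_rV (f : 'rV[R]_n -> R) :
  continuous f -> measurable_fun setT f.
Proof.
move=> cf.
apply: (@measurable_fun_cvg _ _ _ _ (fun k x => f (point k (grid k x)))) => //.
- move=> k _ A mA; rewrite setTI.
  rewrite (_ : _ @^-1` _ = \bigcup_z
     [set x | A (f (point k z)) /\ grid k x = z]); last first.
    apply/seteqP; split => [x /= Ax|x /= [z _ [Az gz]]]; last by rewrite gz.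
    by exists (grid k x).
  apply: countable_bigcupT_measurable => [|z]; first exact: countableP.
  have [Az|nAz] := pselect (A (f (point k z))); last first.
    by rewrite (_ : [set x | _] = set0)//; apply/seteqP; split => // x [].
  rewrite (_ : [set x | _] = [set x | grid k x = z]); last first.
    by apply/seteqP; split => [x []|x].
  rewrite (_ : [set x | _] = \bigcap_(i in [set: 'I_n])
     ((fun y : 'rV[R]_n => Num.floor (k.+1%:R * y ord0 i)) @^-1` [set z i])); last first.
    apply/seteqP; split => x /= h.
      by move=> i _ /=; rewrite -h ffunE.
    by apply/ffunP => i; rewrite ffunE; exact: h.
  apply: fin_bigcap_measurable => // i _.
  rewrite (_ : _ @^-1` _ = (fun y : 'rV[R]_n => k.+1%:R * y ord0 i) @^-1`
     `[(z i)%:~R, (z i + 1)%:~R[); last first.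
    apply/seteqP; split => x /=; rewrite in_itv/=.
      by move=> <-; rewrite ge_floor floorD1_gt ?num_real.
    by move=> h; apply/eqP; rewrite floor_eq.
  rewrite -[X in measurable X]setTI.
  have mk : measurable_fun setT (fun y : 'rV[R]_n => k.+1%:R * y ord0 i).
    by apply: measurable_funM => //; exact: measurable_coord.
  exact: mk.
- move=> x _; apply: (@cvg_comp _ _ _ (fun k => point k (grid k x)) f _ (nbhs x)); last exact: cf.
  apply/cvg_ballP => e e0; near=> k; split => // i j.
  rewrite (ord1 i) !mxE ffunE /ball/=.
  have k0 : 0 < k.+1%:R :> R by [].
  set y := x ord0 j; rewrite ger0_norm; last first.
    by rewrite subr_ge0 ler_pdivrMr// [leRHS]mulrC ge_floor.
  apply: (@lt_trans _ _ (k.+1%:R^-1)).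
    rewrite -(ltr_pM2l k0) mulrBr divff ?gt_eqF// mulrCA divff ?gt_eqF// mulr1.
    by rewrite ltrBlDr addrC -intrD1 floorD1_gt.
  by near: k; apply: near_infty_natSinv_lt (PosNum e0).
Unshelve. all: by end_near. Qed.

End measurable_continuous.

(** * C^{1,1} functions and weighted integrals *)

Section bounded_measurable.
Context d (T : measurableType d) {R : realType}.
Implicit Types b c : T -> R.

Definition bounded_measurable b :=
  measurable_fun setT b /\ exists M : R, forall x, `|b x| <= M.

Lemma bounded_measurable_cst r : bounded_measurable (fun=> r).
Proof. by split; [exact: measurable_cst|exists `|r|]. Qed.

Lemma bounded_measurableD b c : bounded_measurable b -> bounded_measurable c ->
  bounded_measurable (fun x => b x + c x).
Proof.
move=> [mb [M bM]] [mc [N cN]]; split; first exact: measurable_funD.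
by exists (M + N) => x; rewrite (le_trans (ler_normD _ _))// lerD.
Qed.

Lemma bounded_measurableM b c : bounded_measurable b -> bounded_measurable c ->
  bounded_measurable (fun x => b x * c x).
Proof.
move=> [mb [M bM]] [mc [N cN]]; split; first exact: measurable_funM.
by exists (M * N) => x; rewrite normrM ler_pM.
Qed.

Lemma bounded_measurableZ r b : bounded_measurable b ->
  bounded_measurable (fun x => r * b x).
Proof. by move=> hb; apply: bounded_measurableM => //; exact: bounded_measurable_cst. Qed.

Lemma bounded_measurableX b k : bounded_measurable b ->
  bounded_measurable (fun x => b x ^+ k).
Proof.
move=> hb; elim: k => [|k IH].
  by under eq_fun do rewrite expr0; exact: bounded_measurable_cst.
by under eq_fun do rewrite exprS; exact: bounded_measurableM.
Qed.

Lemma bounded_measurable_sum (I : Type) (s : seq I) (F : I -> T -> R) :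
  (forall i, bounded_measurable (F i)) ->
  bounded_measurable (fun x => \sum_(i <- s) F i x).
Proof.
move=> hF; elim: s => [|i s IH].
  by under eq_fun do rewrite big_nil; exact: bounded_measurable_cst.
by under eq_fun do rewrite big_cons; exact: bounded_measurableD.
Qed.

End bounded_measurable.

Section C11.
Context {R : realType} {n : nat}.
Implicit Types (u : 'rV[R]_n -> R) (G : 'rV[R]_n -> 'rV[R]_n).

(** C^{1,1} regularity as a first-order expansion with a uniform quadratic error.
    In this form it passes to products and to convolutions, without pointwise
    derivatives. *)
Definition C11 u G :=
  [/\ measurable_fun setT u, (forall i, measurable_fun setT (fun x => G x ord0 i)) &
   exists2 C : R, 0 <= C & forall x,
    [/\ `|u x| <= C, dot (G x) (G x) <= C &
        forall h, `|u (x + h) - u x - dot (G x) h| <= C * dot h h]].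

Lemma C11_bounded_fun u G : C11 u G -> bounded_measurable u.
Proof. by move=> [mu _ [C _ H]]; split => //; exists C => x; case: (H x). Qed.

Lemma C11_bounded_coord u G i : C11 u G -> bounded_measurable (fun x => G x ord0 i).
Proof.
move=> [_ mG [C C0 H]]; split => //; exists (Num.sqrt C) => x.
have [_ GC _] := H x.
by apply: le_trans (coord_le_enorm _ _) _; rewrite ler_wsqrtr.
Qed.

Lemma C11_bounded_dot u G : C11 u G -> bounded_measurable (fun x => dot (G x) (G x)).
Proof.
move=> uG; apply: bounded_measurable_sum => i.
by apply: bounded_measurableM; exact: C11_bounded_coord uG.
Qed.

End C11.

Section weighted_integral.
Context {R : realType} {n : nat}.
Variables (W : 'rV[R]_n -> R).
Hypotheses (bW : bounded_support W) (W0 : forall x, 0 <= W x).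
Implicit Types b c : 'rV[R]_n -> R.
Local Notation I b := (\int[lebesgue_rV n]_x (b x * W x)).

Lemma bounded_support_mul b : bounded_measurable b ->
  bounded_support (fun x => b x * W x).
Proof.
move=> [mb [N bN]]; have [mW [M [r [WM Wr]]]] := bW; split.
  exact: measurable_funM.
exists (N * M), r; split => [x|x i xi]; first by rewrite normrM ler_pM.
by rewrite (Wr _ i)// mulr0.
Qed.

Lemma integrable_weighted b : bounded_measurable b ->
  (lebesgue_rV n).-integrable setT (fun x => (b x * W x)%:E).
Proof. by move=> /bounded_support_mul/integrable_bounded_support. Qed.

Lemma weightedD b c : bounded_measurable b -> bounded_measurable c ->
  I (fun x => b x + c x) = I b + I c.
Proof.
move=> hb hc; rewrite -RintegralD//; try exact: integrable_weighted.
by apply: eq_Rintegral => x _; rewrite mulrDl.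
Qed.

Lemma weightedZ r b : bounded_measurable b -> I (fun x => r * b x) = r * I b.
Proof.
move=> hb; rewrite -RintegralZl//; try exact: integrable_weighted.
by apply: eq_Rintegral => x _; rewrite mulrA.
Qed.

Lemma le_weighted b c : bounded_measurable b -> bounded_measurable c ->
  (forall x, W x != 0 -> b x <= c x) -> I b <= I c.
Proof.
move=> hb hc bc; apply: le_Rintegral => //; try exact: integrable_weighted.
move=> x _; case: (eqVneq (W x) 0) => [->|/bc xx]; first by rewrite !mulr0.
by rewrite ler_wpM2r.
Qed.

Lemma weighted_ge0 b : (forall x, 0 <= b x) -> 0 <= I b.
Proof. by move=> b0; apply: Rintegral_ge0 => x _; rewrite mulr_ge0. Qed.

End weighted_integral.

Section exponential_bounds.
Context {R : realType}.

Lemma expR_ge_cubic (y : R) : 1 + y + y ^+ 2 / 2 + y ^+ 3 / 6 <= expR y.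
Proof.
pose g (t : R) := (1 + t + t ^+ 2 / 2 + t ^+ 3 / 6) * expR (- t).
have dg (t : R) : is_derive t (1 : R) g (- (t ^+ 3 / 6) * expR (- t)).
  apply: is_derive_eq; rewrite /GRing.scale/=.
  by rewrite !(mulr1, mulr0, add0r, addr0, expr1, mulrN1, subr0); field.
rewrite -[expR y]mul1r -[expR y]invrK -expRN.
rewrite ler_pdivlMr ?expR_gt0// -/(g y).
have g0 : g 0 = 1 by rewrite /g !expr0n/= !mul0r !addr0 oppr0 expR0 mulr1.
rewrite -g0 -subr_le0.
have cg (a b : R) : {within `[a, b], continuous g}.
  apply: continuous_subspaceT => t.
  by apply: differentiable_continuous; apply/derivable1_diffP; case: (dg t).
have key (c z : R) : c * z >= 0 -> - (c ^+ 3 / 6) * expR (- c) * z <= 0.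
  move=> cz; rewrite (_ : _ * z = - (c ^+ 2 / 6 * expR (- c) * (c * z))); last by ring.
  by rewrite oppr_le0 mulr_ge0// mulr_ge0 ?expR_ge0// divr_ge0 ?sqr_ge0.
have [y0|y0|<-] := ltgtP 0 y; last by rewrite subrr.
- have [c /[!in_itv]/= /andP[c0 cy] ->] := MVT y0 (fun t _ => dg t) (cg _ _).
  by rewrite subr0; apply: key; rewrite mulr_ge0// ltW.
- have [c /[!in_itv]/= /andP[c0 cy]] := MVT y0 (fun t _ => dg t) (cg _ _).
  move=> /eqP; rewrite -subr_eq0 -(opprB (g y)) => /eqP h.
  have -> : g y - g 0 = - (c ^+ 3 / 6) * expR (- c) * y by lra.
  by apply: key; rewrite mulr_le0// ltW.
Qed.

Lemma expR_le_quadratic (w : R) : 0 <= w -> w <= 1 / 2 ->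
  expR w <= 1 + w + 2 * w ^+ 2.
Proof.
move=> w0 w1; have := expR_ge1Dx (- w) => h.
have h1 : 0 < 1 - w by lra.
rewrite -[expR w]invrK -expRN.
apply: (@le_trans _ _ ((1 - w)^-1)).
  by rewrite lef_pV2 ?posrE ?expR_gt0.
by rewrite -[leLHS]mul1r ler_pdivrMr//; nra.
Qed.

End exponential_bounds.

(** * The Poincare inequality for a strongly convex potential *)

Section poincare_strongly_convex.
Context {R : realType} {n : nat}.

Lemma scaler_half (x : 'rV[R]_n) : 2^-1 *: (x + x) = x.
Proof.
rewrite -{1 2}[x]scale1r -scalerDl scalerA (_ : _ * _ = 1) ?scale1r//.
by rewrite -mulr2n mulVf.
Qed.

Lemma le0_small_linear (x K s0 : R) : 0 < s0 ->
  (forall s, 0 < s -> s <= s0 -> x <= K * s) -> x <= 0.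
Proof.
move=> s00 H; rewrite leNgt; apply/negP => x0.
have K1 : 0 < `|K| + 1 by rewrite ltr_wpDl.
pose s := Num.min s0 (x / (2 * (`|K| + 1))).
have sp : 0 < s by rewrite lt_min s00 divr_gt0// mulr_gt0.
have := H s sp; rewrite ge_min lexx => /(_ isT) h.
have : K * s <= (`|K| + 1) * s.
  by rewrite ler_pM2r// (le_trans (ler_norm _))// lerDl.
have : (`|K| + 1) * s <= x / 2.
  rewrite -ler_pdivlMl//.
  have -> : (`|K| + 1)^-1 * (x / 2) = x / (2 * (`|K| + 1)) by field; rewrite gt_eqF.
  by rewrite ge_min lexx orbT.
lra.
Qed.

Variables (V : 'rV[R]_n -> R) (B : set 'rV[R]_n) (k M r : R).
Hypotheses (k0 : 0 < k) (mV : measurable_fun setT V) (mB : measurable B).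
Hypotheses (Br : forall x i, B x -> `|x ord0 i| <= r) (VM : forall x, B x -> - M <= V x).
Hypothesis convB : forall x y, B x -> B y -> B (2^-1 *: (x + y)).
Hypothesis convV : forall x y, B x -> B y ->
  2 * V (2^-1 *: (x + y)) + k / 4 * dot (x - y) (x - y) <= V x + V y.

Definition restricted_gibbs (x : 'rV[R]_n) : R := expR (- V x) * \1_B x.
Local Notation W := restricted_gibbs.

Lemma restricted_gibbs_ge0 x : 0 <= W x.
Proof. by rewrite mulr_ge0 ?expR_ge0. Qed.

Lemma restricted_gibbs_bounded_support : bounded_support W.
Proof.
split.
  apply: measurable_funM; last by apply: measurable_indic.
  by apply: measurableT_comp => //; exact: measurableT_comp.
exists (expR M), r; split => [x|x i xi].
  rewrite ger0_norm ?restricted_gibbs_ge0// /W indicE.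
  case: (boolP (x \in B)) => xB; last by rewrite mulr0 expR_ge0.
  by rewrite mulr1 ler_expR lerNl VM//; exact: set_mem.
rewrite /W indicE memNset ?mulr0// => xB.
by have := Br i xB; rewrite leNgt xi.
Qed.

Lemma bounded_measurable_expR (b : 'rV[R]_n -> R) :
  bounded_measurable b -> bounded_measurable (fun x => expR (b x)).
Proof.
move=> [mb [N bN]]; split; first exact: measurableT_comp.
exists (expR N) => x; rewrite ger0_norm ?expR_ge0// ler_expR.
by rewrite (le_trans (ler_norm _)).
Qed.

(** Linearisation of the Prekopa-Leindler inequality: it is applied to
    e^{su} W, e^{-su} W and e^{w} W, where w is the smallest multiple of
    dot G G that the midpoint convexity of V allows. Comparing the terms of
    order s^2 as s tends to 0 gives the inequality. *)
Lemma poincare_strongly_convex u G : C11 u G ->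
  \int[lebesgue_rV n]_x (u x * W x) = 0 ->
  k * \int[lebesgue_rV n]_x (u x ^+ 2 * W x) <=
    \int[lebesgue_rV n]_x (dot (G x) (G x) * W x).
Proof.
move=> uG u_mean; have [mu mG [C C0 HC]] := uG.
have bW := restricted_gibbs_bounded_support.
have W0 := restricted_gibbs_ge0.
have bu := C11_bounded_fun uG.
have bG := C11_bounded_dot uG.
have bone := @bounded_measurable_cst _ _ R 1.
have bu2 : bounded_measurable (fun x => u x ^+ 2) by exact: bounded_measurableX.
set I2 := \int[_]_x _; set J := \int[_]_x _.
pose I0 := \int[lebesgue_rV n]_x (1 * W x).
have I00 : 0 <= I0 by apply: weighted_ge0.
have I20 : 0 <= I2 by apply: weighted_ge0 => // x; exact: sqr_ge0.
have J0 : 0 <= J by apply: weighted_ge0 => // x; exact: dot_ge0.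
rewrite -subr_le0.
apply: (@le0_small_linear _ (2 * C * I2 + k * C ^+ 3 / 3 * I0 + 2 * C ^+ 2 / k * I0)
  (Num.min 1 (k / (4 * (C + 1))))).
  by rewrite lt_min ltr01 divr_gt0// mulr_gt0// ltr_wpDl.
move=> s s0; rewrite le_min => /andP[s1].
rewrite ler_pdivlMr ?mulr_gt0 ?ltr_wpDl// => sC.
have {}sC : s * C <= k / 4 by nra.
(* The second-order error of u costs 2 s C of the convexity k. *)
pose m := k - 2 * s * C.
have mk2 : k / 2 <= m by rewrite /m; lra.
have m0 : 0 < m by apply: lt_le_trans mk2; rewrite divr_gt0.
have mk : m <= k by rewrite /m lerBlDr lerDl !mulr_ge0// ltW.
pose q := s ^+ 2 / (2 * m).
have q0 : 0 <= q by rewrite divr_ge0 ?sqr_ge0// mulr_ge0// ltW.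
pose w x := q * dot (G x) (G x).
have w0 x : 0 <= w x by rewrite mulr_ge0// dot_ge0.
have wq x : w x <= q * C by rewrite ler_wpM2l//; case: (HC x).
have qC : q * C <= 1 / 2.
  rewrite /q mulrAC ler_pdivrMr ?mulr_gt0//.
  have : s * (s * C) <= k / 4.
    apply: le_trans sC; rewrite ler_piMl// mulr_ge0// ltW//.
  nra.
have bf : bounded_measurable (fun x => expR (s * u x)).
  by apply: bounded_measurable_expR; exact: bounded_measurableZ.
have bg : bounded_measurable (fun x => expR (- s * u x)).
  by apply: bounded_measurable_expR; exact: bounded_measurableZ.
have bw : bounded_measurable w by exact: bounded_measurableZ.
have bh : bounded_measurable (fun x => expR (w x)) by exact: bounded_measurable_expR.
have := @prekopa_leindler R n _ _ _ (bounded_support_mul bW bf)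
  (bounded_support_mul bW bg) (bounded_support_mul bW bh).
set A1 := \int[_]_x _; set A2 := \int[_]_x _; set H := \int[_]_x _ => PL.
have {}PL : A1 * A2 <= H ^+ 2.
  apply: PL; [by move=> x; rewrite mulr_ge0 ?expR_ge0..|].
  move=> x y; set z := 2^-1 *: (x + y).
  rewrite /W !indicE.
  case: (boolP (x \in B)) => [/set_mem xB|_]; last by rewrite !mulr0 mul0r sqr_ge0.
  case: (boolP (y \in B)) => [/set_mem yB|_]; last by rewrite !mulr0 sqr_ge0.
  rewrite mem_set ?mulr1; last exact: convB.
  rewrite -!expRD -expRM_natl ler_expR.
  pose d := 2^-1 *: (x - y).
  have xE : x = z + d.
    by rewrite /z /d -scalerDr addrACA subrr addr0 scaler_half.
  have yE : y = z + (- d).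
    by rewrite /z /d -scalerN -scalerDr opprB (addrC x) addrACA subrr addr0 scaler_half.
  have dE : dot (x - y) (x - y) = 4 * dot d d by rewrite /d dotZl dotZr; field.
  have := convV xB yB; rewrite -/z dE.
  clearbody z d => {dE}.
  have [_ _ Hz] := HC z.
  have := Hz d; rewrite -xE ler_norml => /andP[_].
  have := Hz (- d); rewrite -yE ler_norml => /andP[+ _].
  rewrite !dotNr !dotNl !opprK.
  (* The square completed here is that of s G z - m d, which is where the choice
     of q comes from. *)
  have : 0 <= (s ^+ 2 * dot (G z) (G z) / m - 2 * s * dot (G z) d + m * dot d d).
    have := dot_ge0 (s *: G z - m *: d).
    rewrite dotDl !dotDr !dotNl !dotNr !dotZl !dotZr (dotC d) opprK.
    set a := dot _ _; set b := dot _ _; set c := dot d d => h.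
    rewrite -(pmulr_lge0 _ m0).
    by move: h; congr (_ <= _); field; rewrite gt_eqF.
  have -> : s ^+ 2 * dot (G z) (G z) / m = 2 * w z.
    by rewrite /w /q; field; rewrite gt_eqF.
  set a := dot (G z) d; set b := dot d d.
  move=> h1 h2 h3 h4.
  have {}h2 : s * (u z - a - C * b) <= s * u y by rewrite ler_pM2l//; lra.
  have {}h3 : s * u x <= s * (u z + a + C * b) by rewrite ler_pM2l//; lra.
  rewrite /m in h1; lra.
(* The mean of u vanishes, so the linear term of e^{su} integrates to 0; e bounds
   the cubic term. *)
pose e := s ^+ 3 * C ^+ 3 / 6.
have be := @bounded_measurable_cst _ _ R (- e).
have lower (t : R) : (t = s \/ t = - s) ->
    I0 + s ^+ 2 / 2 * I2 - e * I0 <= \int[lebesgue_rV n]_x (expR (t * u x) * W x).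
  move=> ts; have t2 : t ^+ 2 = s ^+ 2 by case: ts => ->; rewrite ?sqrrN.
  have bt : bounded_measurable (fun x => expR (t * u x)) by case: ts => ->.
  have -> : I0 + s ^+ 2 / 2 * I2 - e * I0 = \int[lebesgue_rV n]_x
      ((1 + (t * u x + (s ^+ 2 / 2 * u x ^+ 2 + - e * 1))) * W x).
    rewrite !weightedD//; do ?[exact: bounded_measurableZ|apply: bounded_measurableD => //].
    rewrite !weightedZ// u_mean -/I0 -/I2; ring.
  apply: le_weighted => //; first by do ?[exact: bounded_measurableZ|apply: bounded_measurableD => //].
  move=> x _; apply: le_trans (expR_ge_cubic _).
  rewrite !exprMn t2 mulr1 !addrA -[leRHS]addrA.
  have -> : t ^+ 3 * u x ^+ 3 / 6 = (t * u x) ^+ 3 / 6 by rewrite exprMn.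
  have h3 : - (s * C) ^+ 3 <= (t * u x) ^+ 3.
    have h : `|t * u x| <= s * C.
      rewrite normrM; have -> : `|t| = s by case: ts => ->; rewrite ?normrN ger0_norm// ltW.
      by rewrite ler_pM2l//; case: (HC x).
    apply: (@le_trans _ _ (- `|(t * u x) ^+ 3|)); last by rewrite lerNl ler_normr lexx orbT.
    by rewrite lerN2 normrX lerXn2r// nnegrE mulr_ge0// ltW.
  by rewrite exprMn in h3; rewrite /e; lra.
have L1 := lower s (or_introl erefl).
have L2 := lower (- s) (or_intror erefl).
rewrite -/A1 in L1; rewrite -/A2 in L2.
have H0 : 0 <= H by apply: weighted_ge0 => // x; exact: expR_ge0.
have LH : I0 + s ^+ 2 / 2 * I2 - e * I0 <= H.
  set L := _ - _ in L1 L2 *.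
  have [L0|L0] := leP 0 L; last by apply: le_trans H0; exact: ltW.
  rewrite -(@ler_pXn2r _ 2)// ?nnegrE//; apply: le_trans PL.
  by rewrite expr2 ler_pM.
have UH : H <= I0 + q * J + 2 * (q * C) ^+ 2 * I0.
  have -> : I0 + q * J + 2 * (q * C) ^+ 2 * I0 = \int[lebesgue_rV n]_x
      ((1 + (q * dot (G x) (G x) + 2 * (q * C) ^+ 2 * 1)) * W x).
    rewrite !weightedD//; do ?[exact: bounded_measurableZ|apply: bounded_measurableD => //].
    by rewrite !weightedZ// -/I0 -/J; ring.
  apply: le_weighted => //; first by do ?[exact: bounded_measurableZ|apply: bounded_measurableD => //].
  move=> x _; apply: le_trans (expR_le_quadratic (w0 x) _) _.
    exact: le_trans qC.
  rewrite mulr1 -addrA lerD2l lerD2l ler_pM2l//.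
  by rewrite lerXn2r// nnegrE// (le_trans (w0 x)).
have key : m * I2 <= m * s * C ^+ 3 / 3 * I0 + J + s ^+ 2 * C ^+ 2 / m * I0.
  have h := le_trans LH UH.
  have p : 0 < 2 * m / s ^+ 2 by rewrite divr_gt0 ?mulr_gt0// exprn_gt0.
  have {}h : s ^+ 2 / 2 * I2 <= e * I0 + q * J + 2 * (q * C) ^+ 2 * I0 by lra.
  move: h; rewrite -(ler_pM2l p).
  rewrite (_ : _ * (s ^+ 2 / 2 * I2) = m * I2); last by field; rewrite gt_eqF.
  move/le_trans; apply; rewrite le_eqVlt; apply/orP; left; apply/eqP.
  by rewrite /e /q; field; rewrite !gt_eqF.
have b1 : m * s * C ^+ 3 / 3 * I0 <= k * s * C ^+ 3 / 3 * I0.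
  by rewrite ler_wpM2r// ler_pM2r// ler_wpM2r ?exprn_ge0// ler_pM2r.
have b2 : s ^+ 2 * C ^+ 2 / m * I0 <= s * C ^+ 2 * (2 / k) * I0.
  rewrite ler_wpM2r//; apply: ler_pM.
  - by rewrite mulr_ge0 ?sqr_ge0.
  - by rewrite invr_ge0 ltW.
  - by rewrite ler_wpM2r ?sqr_ge0// expr2 ler_piMl// ltW.
  by rewrite -[2 / k]invf_div lef_pV2// posrE divr_gt0.
rewrite (_ : 2 * C ^+ 2 / k = C ^+ 2 * (2 / k)); last by field; rewrite gt_eqF.
have kE : k = m + 2 * s * C by rewrite /m subrK.
have : k * I2 = m * I2 + 2 * s * C * I2 by rewrite -mulrDl -kE.
lra.
Qed.

End poincare_strongly_convex.

(** * Calculus along lines *)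

Section line_calculus.
Context {R : realType} {n : nat}.
Implicit Types (f V : 'rV[R]_n -> R) (x v : 'rV[R]_n).

Lemma is_derive_line f x v (t : R) : differentiable f (x + t *: v) ->
  is_derive t (1 : R) (fun s => f (x + s *: v)) ('D_v f (x + t *: v)).
Proof.
move=> df; have dv := @diff_derivable _ _ _ _ _ v df.
have E : (fun h : R => h^-1 *: (((fun s => f (x + s *: v)) \o shift t) (h *: 1) -
                           f (x + t *: v))) =
         (fun h : R => h^-1 *: ((f \o shift (x + t *: v)) (h *: v) - f (x + t *: v))).
  apply/funext => h /=; congr (_ *: (f _ - _)).
  by rewrite [h *: 1]mulr1 scalerDl addrCA.
by apply: DeriveDef; [rewrite /derivable E|rewrite /derive E].
Qed.

Lemma derive_partial f x v : differentiable f x ->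
  'D_v f x = \sum_i v ord0 i * partial i f x.
Proof.
move=> df; rewrite deriveE// {1}(row_sum_delta v) linear_sum/=.
by apply: eq_bigr => i _; rewrite linearZ/= /partial deriveE.
Qed.

Lemma smooth_differentiable f : smooth f -> forall x, differentiable f x.
Proof. by move=> sf x; exact: (sf [::]). Qed.

Lemma smooth_partial f i : smooth f -> smooth (partial i f).
Proof.
move=> sf s x; have := sf (rcons s i) x.
by rewrite -cats1 foldr_cat.
Qed.

Lemma smooth_continuous f : smooth f -> continuous f.
Proof. by move=> sf x; apply: differentiable_continuous; exact: smooth_differentiable. Qed.

Lemma is_derive2_line f x v (t : R) : smooth f ->
  is_derive t (1 : R) (fun s => 'D_v f (x + s *: v))
    ((v *m hessian f (x + t *: v) *m v^T) ord0 ord0).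
Proof.
move=> sf.
rewrite (_ : (fun s => _) = \sum_i (v ord0 i \*: (fun s : R => partial i f (x + s *: v)))); last first.
  apply/funext => s; rewrite derive_partial; last exact: smooth_differentiable.
  by rewrite fct_sumE; apply: eq_bigr.
have dp i : is_derive t (1 : R) (fun s : R => partial i f (x + s *: v))
    ('D_v (partial i f) (x + t *: v)).
  by apply: is_derive_line; exact/smooth_differentiable/smooth_partial.
apply: is_derive_eq.
rewrite !mxE; apply: eq_bigr => j _; rewrite !mxE mulrC; congr (_ * _).
rewrite derive_partial; last exact/smooth_differentiable/smooth_partial.
by apply: eq_bigr => i _; rewrite mxE.
Qed.

(** Midpoint form of strong convexity: the mean value theorem for the
    derivative along the segment minus its linear part. *)
Lemma midpoint_strongly_convex V (B : set 'rV[R]_n) (k : R) x y : smooth V ->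
  (forall t : R, 0 <= t -> t <= 1 -> B (x + t *: (y - x))) ->
  (forall z, B z -> hess_ge V z k) ->
  2 * V (2^-1 *: (x + y)) + k / 4 * dot (x - y) (x - y) <= V x + V y.
Proof.
move=> sV seg hV; set d := y - x in seg *.
have -> : dot (x - y) (x - y) = dot d d by rewrite -opprB dotNl dotNr opprK.
have -> : 2^-1 *: (x + y) = x + 2^-1 *: d.
  rewrite /d scalerBr scalerDr addrCA -{2}[x]scale1r -scalerBl addrC; congr (_ *: _ + _).
  by field.
have -> : V x = V (x + 0 *: d) by rewrite scale0r addr0.
have -> : V y = V (x + 1 *: d) by rewrite scale1r /d addrC subrK.
set D := dot d d; clearbody d.
pose phi (t : R) := V (x + t *: d) - k * D / 2 * t ^+ 2.
pose phi' (t : R) := 'D_d V (x + t *: d) - k * D * t.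
have d1 (t : R) : is_derive t (1 : R) phi (phi' t).
  have := is_derive_line (smooth_differentiable sV (x + t *: d)) => h.
  apply: is_derive_eq; rewrite /phi' /GRing.scale/=; congr (_ - _).
  by rewrite !(mulr1, mulr0, expr1, addr0, add0r); field.
have d2 (t : R) : is_derive t (1 : R) phi'
    ((d *m hessian V (x + t *: d) *m d^T) ord0 ord0 - k * D).
  have h := @is_derive2_line V x d t sV.
  apply: is_derive_eq; rewrite /GRing.scale/=; congr (_ - _).
  by rewrite !(mulr1, mulr0, expr1, addr0, add0r).
have cont (g : R -> R) (g' : R -> R) : (forall t, is_derive t (1 : R) g (g' t)) ->
    forall a b : R, {within `[a, b], continuous g}.
  move=> dg a b; apply: continuous_subspaceT => t.
  by apply: differentiable_continuous; apply/derivable1_diffP; case: (dg t).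
have h01 : (0 : R) < 2^-1 by rewrite invr_gt0.
have h11 : (2^-1 : R) < 1 by rewrite invf_lt1// ltr1n.
have [a] := MVT h01 (fun t _ => d1 t) (cont _ _ d1 _ _).
rewrite in_itv/= => /andP[a0 a1] Ea.
have [b] := MVT h11 (fun t _ => d1 t) (cont _ _ d1 _ _).
rewrite in_itv/= => /andP[b0 b1] Eb.
have ab := lt_trans a1 b0.
have [c] := MVT ab (fun t _ => d2 t) (cont _ _ d2 _ _).
rewrite in_itv/= => /andP[ac cb] Ec.
have : 0 <= phi' b - phi' a.
  rewrite Ec mulr_ge0 ?subr_ge0 ?(ltW ab)//.
  by apply: hV; apply: seg; [exact: ltW (lt_trans a0 ac)|exact: ltW (lt_trans cb b1)].
move: Ea Eb; rewrite /phi expr0n/= mulr0 !subr0 expr1n mulr1 => Ea Eb h.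
rewrite /D in Ea Eb *; move: Ea Eb; set dd := dot d d; set v0 := V _; set v1 := V _; set v2 := V _.
set p := phi' a in h *; set q := phi' b in h *; move=> Ea Eb.
have E4 : k * dd / 2 * 2^-1 ^+ 2 = k * dd / 8 by field.
have E5 : 1 - 2^-1 = 2^-1 :> R by field.
rewrite E4 in Ea Eb; rewrite E5 in Eb.
lra.
Qed.

End line_calculus.

(** * Radial potentials *)

Section radial_potential.
Context {R : realType} {n : nat}.
Variables (alpha Ra : R) (V : 'rV[R]_n -> R).
Hypotheses (alpha1 : 1 < alpha) (alpha2 : alpha <= 2) (Ra0 : 0 <= Ra).
Hypothesis sV : smooth V.
Hypothesis VE : forall x, Ra <= enorm x -> V x = enorm x `^ alpha / alpha.
Implicit Types x v : 'rV[R]_n.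

Let alpha0 : 0 < alpha. Proof. exact: lt_trans ltr01 alpha1. Qed.

(** The squared norm along a line, so that V is a power of a polynomial there. *)
Let q x v (s : R) : R := dot x x + 2 * s * dot x v + s ^+ 2 * dot v v.

Let qE x v s : dot (x + s *: v) (x + s *: v) = q x v s.
Proof. by rewrite dotDl !dotDr !dotZl !dotZr (dotC v x) /q; ring. Qed.

Let is_derive_q x v (s : R) : is_derive s (1 : R) (q x v) (2 * dot x v + 2 * s * dot v v).
Proof.
apply: is_derive_eq; rewrite /GRing.scale/=.
by rewrite !(mulr1, mulr0, expr1, addr0, add0r); ring.
Qed.

Let outside_near x v : Ra < enorm x ->
  \forall s \near (0 : R), Ra < enorm (x + s *: v).
Proof.
move=> xR.
have : q x v s @[s --> (0 : R)] --> q x v 0.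
  apply: differentiable_continuous; apply/derivable1_diffP.
  by case: (is_derive_q x v 0).
have E s : (Ra < enorm (x + s *: v)) = (Ra ^+ 2 < q x v s).
  by rewrite -qE -sqr_enorm ltr_pXn2r// nnegrE enorm_ge0.
move=> /cvgrPdist_lt.
have e0 : 0 < q x v 0 - Ra ^+ 2 by rewrite subr_gt0 -E scale0r addr0.
move=> /(_ _ e0); apply: filterS => s; rewrite E.
by rewrite ltr_distlC subKr => /andP[].
Qed.

Let enorm_powR x p : enorm x `^ p = dot x x `^ (p / 2).
Proof. by rewrite /enorm -powR12_sqrt ?dot_ge0// -powRrM mulrC. Qed.

Lemma derive_radial x v : Ra < enorm x ->
  'D_v V x = enorm x `^ (alpha - 2) * dot x v.
Proof.
move=> xR.
have h1 := @is_derive_line R n V x v 0 (smooth_differentiable sV _).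
rewrite scale0r addr0 in h1.
have q0 : 0 < q x v 0.
  rewrite -qE scale0r addr0 -sqr_enorm exprn_gt0//; exact: le_lt_trans xR.
have h2 : is_derive (0 : R) (1 : R) (alpha^-1 \*: ((@powR R)^~ (alpha / 2) \o q x v))
    (alpha^-1 * ((alpha / 2 * q x v 0 `^ (alpha / 2 - 1)) * (2 * dot x v + 2 * 0 * dot v v))).
  have := is_derive1_powR (alpha / 2) q0 => h; have h' := is_derive_q x v 0.
  by apply: is_deriveZ.
have h3 : is_derive (0 : R) (1 : R) (fun s => V (x + s *: v))
    (alpha^-1 * ((alpha / 2 * q x v 0 `^ (alpha / 2 - 1)) * (2 * dot x v + 2 * 0 * dot v v))).
  apply: near_eq_is_derive h2; apply: filterS (outside_near v xR) => s xs.
  by rewrite VE ?(ltW xs)// enorm_powR qE [RHS]mulrC.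
rewrite -(@derive_val _ _ _ _ _ _ _ h1) (@derive_val _ _ _ _ _ _ _ h3).
rewrite enorm_powR mulrBl divff// -qE scale0r addr0.
by field; rewrite gt_eqF.
Qed.

Lemma hessian_radial x v : Ra < enorm x ->
  (v *m hessian V x *m v^T) ord0 ord0 =
  (alpha - 2) * dot x x `^ (alpha / 2 - 2) * dot x v ^+ 2 +
  enorm x `^ (alpha - 2) * dot v v.
Proof.
move=> xR.
have h1 := @is_derive2_line R n V x v 0 sV.
rewrite scale0r addr0 in h1.
have q0 : 0 < q x v 0.
  rewrite -qE scale0r addr0 -sqr_enorm exprn_gt0//; exact: le_lt_trans xR.
pose b := alpha / 2 - 1.
have h2 : is_derive (0 : R) (1 : R)
    (((@powR R)^~ b \o q x v) * (fun s : R => dot x v + s * dot v v))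
    (((@powR R)^~ b \o q x v) 0 *: (dot v v) + (fun s : R => dot x v + s * dot v v) 0 *:
     ((b * q x v 0 `^ (b - 1)) * (2 * dot x v + 2 * 0 * dot v v))).
  apply: is_deriveM.
    have h := is_derive1_powR b q0; have h' := is_derive_q x v 0.
    exact: is_derive1_comp.
  by apply: is_derive_eq; rewrite /GRing.scale/=; ring.
have h3 : is_derive (0 : R) (1 : R) (fun s => 'D_v V (x + s *: v))
    (((@powR R)^~ b \o q x v) 0 *: (dot v v) + (fun s : R => dot x v + s * dot v v) 0 *:
     ((b * q x v 0 `^ (b - 1)) * (2 * dot x v + 2 * 0 * dot v v))).
  apply: near_eq_is_derive h2; apply: filterS (outside_near v xR) => s xs.
  rewrite derive_radial// enorm_powR qE dotDl dotZl.
  by rewrite mulrBl divff.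
rewrite -(@derive_val _ _ _ _ _ _ _ h1) (@derive_val _ _ _ _ _ _ _ h3).
have b2 : (alpha - 2) / 2 = b by rewrite /b; field.
rewrite enorm_powR b2 /= -!qE scale0r addr0.
rewrite (_ : b - 1 = alpha / 2 - 2); last by rewrite /b; lra.
by rewrite /GRing.scale/= mul0r addr0 /b; field.
Qed.

(** The Hessian of |x|^alpha / alpha is |x|^(alpha - 2) times the identity plus
    (alpha - 2) times the projection on x; since alpha <= 2 its smallest
    eigenvalue is the one in the direction of x. *)
Lemma hess_ge_radial x : Ra < enorm x ->
  hess_ge V x ((alpha - 1) * enorm x `^ (alpha - 2)).
Proof.
move=> xR v; rewrite hessian_radial//.
have x0 : 0 < dot x x.
  by rewrite -sqr_enorm exprn_gt0//; exact: le_lt_trans xR.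
have E : enorm x `^ (alpha - 2) = dot x x `^ (alpha / 2 - 2) * dot x x.
  transitivity (dot x x `^ (alpha / 2 - 2) * dot x x `^ 1); last by rewrite powRr1 ?ltW.
  rewrite enorm_powR -powRD; last by apply/implyP => _; rewrite gt_eqF.
  by congr (_ `^ _); lra.
have p0 := powR_ge0 (dot x x) (alpha / 2 - 2).
rewrite E; set p := _ `^ _ in p0 *.
have := ler_wpM2l p0 (sqr_dot_le x v).
rewrite -subr_ge0 => XY; rewrite -subr_ge0.
rewrite (_ : _ - _ = (2 - alpha) * (p * (dot x x * dot v v) - p * dot x v ^+ 2)).
  by rewrite mulr_ge0// subr_ge0.
by ring.
Qed.

End radial_potential.

(** * Operations on C^{1,1} functions *)

Section C11_algebra.
Context {R : realType} {n : nat}.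
Implicit Types (u v : 'rV[R]_n -> R) (G H : 'rV[R]_n -> 'rV[R]_n) (x y h : 'rV[R]_n).

Lemma dotD_le x y : dot (x + y) (x + y) <= 2 * dot x x + 2 * dot y y.
Proof.
have := dot_ge0 (x - y).
by rewrite !dotDl !dotDr !dotNl !dotNr (dotC y x); lra.
Qed.

Lemma dotB_ge x y : dot x x / 2 - dot y y <= dot (x + y) (x + y).
Proof.
have := dotD_le (x + y) (- y); rewrite addrK dotNl dotNr opprK; lra.
Qed.

Lemma norm_dot_le_add x y : `|dot x y| <= dot x x + dot y y.
Proof.
have h1 := dot_ge0 (x - y); have h2 := dot_ge0 (x + y).
have h3 := dot_ge0 x; have h4 := dot_ge0 y.
move: h1 h2; rewrite !dotDl !dotDr !dotNl !dotNr (dotC y x) ler_norml => h1 h2.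
by apply/andP; split; lra.
Qed.

(** For large increments the bounds on u and its gradient already give the
    quadratic estimate. *)
Lemma C11_local u G (C d : R) : 0 <= C -> 0 < d ->
  measurable_fun setT u -> (forall i, measurable_fun setT (fun x => G x ord0 i)) ->
  (forall x, `|u x| <= C) -> (forall x, dot (G x) (G x) <= C) ->
  (forall x h, dot h h <= d -> `|u (x + h) - u x - dot (G x) h| <= C * dot h h) ->
  C11 u G.
Proof.
move=> C0 d0 mu mG uC GC H; split => //.
exists (C + 3 * C / d + 1); first by rewrite !addr_ge0// divr_ge0 ?mulr_ge0// ltW.
have p : 0 <= 3 * C / d by rewrite divr_ge0 ?mulr_ge0// ltW.
move=> x; split; first by apply: le_trans (uC x) _; lra.
  by apply: le_trans (GC x) _; lra.
move=> h; have h0 := dot_ge0 h.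
have [hd|hd] := leP (dot h h) d.
  by apply: le_trans (H x h hd) _; rewrite ler_wpM2r//; lra.
have e1 := uC (x + h); have e2 := uC x; have e3 := norm_dot_le_add (G x) h.
have e4 := GC x.
have e5 : 3 * C <= 3 * C / d * dot h h.
  by rewrite -[leRHS]mulrA ler_peMr ?mulr_ge0// ler_pdivlMl// mulr1 ltW.
have e6 : 0 <= C * dot h h by rewrite mulr_ge0.
apply: le_trans (ler_normB _ _) _; apply: le_trans (lerD (ler_normB _ _) (lexx _)) _.
by rewrite !mulrDl mul1r; lra.
Qed.

Lemma C11_cst (a : R) : C11 (fun=> a) (fun=> 0 : 'rV[R]_n).
Proof.
split; first exact: measurable_cst.
  by move=> i; under eq_fun do rewrite mxE; exact: measurable_cst.
exists `|a| => // x; split => //; first by rewrite dot0l.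
by move=> h; rewrite dot0l subrr subr0 normr0 mulr_ge0// dot_ge0.
Qed.

Lemma C11D u G v H : C11 u G -> C11 v H -> C11 (fun x => u x + v x) (fun x => G x + H x).
Proof.
move=> [mu mG [C C0 uC]] [mv mH [D D0 vD]]; split; first exact: measurable_funD.
  by move=> i; under eq_fun do rewrite mxE; exact: measurable_funD.
exists (2 * C + 2 * D); first by rewrite addr_ge0 ?mulr_ge0.
move=> x; have [c1 c2 c3] := uC x; have [d1 d2 d3] := vD x; split.
- by apply: le_trans (ler_normD _ _) _; lra.
- by apply: le_trans (dotD_le _ _) _; lra.
- move=> h; rewrite dotDl.
  rewrite (_ : _ - _ = (u (x + h) - u x - dot (G x) h) + (v (x + h) - v x - dot (H x) h)); last by ring.
  apply: le_trans (ler_normD _ _) _; have := c3 h; have := d3 h.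
  have : 0 <= C * dot h h by rewrite mulr_ge0 ?dot_ge0.
  have : 0 <= D * dot h h by rewrite mulr_ge0 ?dot_ge0.
  by rewrite mulrDl -!mulrA; lra.
Qed.

Lemma C11M u G v H : C11 u G -> C11 v H ->
  C11 (fun x => u x * v x) (fun x => u x *: H x + v x *: G x).
Proof.
move=> [mu mG [C C0 uC]] [mv mH [D D0 vD]].
pose M := C + D + 1.
have M1 : 1 <= M by rewrite /M; lra.
have M0 : 0 <= M by lra.
have {}uC x : [/\ `|u x| <= M, dot (G x) (G x) <= M &
    forall h, `|u (x + h) - u x - dot (G x) h| <= M * dot h h].
  have [c1 c2 c3] := uC x; split; rewrite /M; [lra|lra|].
  move=> h; apply: le_trans (c3 h) _; rewrite ler_wpM2r ?dot_ge0//; lra.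
have {}vD x : [/\ `|v x| <= M, dot (H x) (H x) <= M &
    forall h, `|v (x + h) - v x - dot (H x) h| <= M * dot h h].
  have [c1 c2 c3] := vD x; split; rewrite /M; [lra|lra|].
  move=> h; apply: le_trans (c3 h) _; rewrite ler_wpM2r ?dot_ge0//; lra.
have lip f F : (forall x, [/\ `|f x| <= M, dot (F x) (F x) <= M &
    forall h, `|f (x + h) - f x - dot (F x) h| <= M * dot h h]) ->
    forall x h, dot h h <= 1 -> (f (x + h) - f x) ^+ 2 <= 2 * (M + M ^+ 2) * dot h h.
  move=> fM x h h1; have [_ c2 /(_ h) c3] := fM x.
  have h0 := dot_ge0 h; have c4 := sqr_dot_le (F x) h.
  have {}c4 : dot (F x) h ^+ 2 <= M * dot h h by apply: le_trans c4 _; rewrite ler_wpM2r.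
  set a := dot (F x) h in c3 c4; set b := f (x + h) - f x in c3 *.
  have c5 : (b - a) ^+ 2 <= M ^+ 2 * dot h h.
    rewrite -real_normK ?num_real//; apply: (@le_trans _ _ ((M * dot h h) ^+ 2)).
      by rewrite lerXn2r// nnegrE// mulr_ge0.
    by rewrite exprMn ler_wpM2l ?sqr_ge0// expr2 ler_piMl.
  by have := sqr_ge0 (b - a - a); nra.
apply: (@C11_local _ _ (4 * M ^+ 3 + 2 * (M + M ^+ 2) + 2 * M ^+ 2) 1) => //.
- by rewrite !addr_ge0 ?mulr_ge0 ?addr_ge0 ?exprn_ge0.
- exact: measurable_funM.
- move=> i; under eq_fun do rewrite !mxE.
  by apply: measurable_funD; exact: measurable_funM.
- move=> x; have [c1 _ _] := uC x; have [d1 _ _] := vD x.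
  have : `|u x * v x| <= M ^+ 2 by rewrite normrM expr2 ler_pM.
  have : 0 <= M ^+ 3 by rewrite exprn_ge0.
  have : 0 <= M ^+ 2 by rewrite exprn_ge0.
  lra.
- move=> x; have [c1 c2 _] := uC x; have [d1 d2 _] := vD x.
  apply: le_trans (dotD_le _ _) _; rewrite !dotZl !dotZr.
  rewrite (_ : _ + _ = 2 * u x ^+ 2 * dot (H x) (H x) + 2 * v x ^+ 2 * dot (G x) (G x)); last by ring.
  have sq (a b : R) : `|a| <= M -> 0 <= b -> b <= M -> 2 * a ^+ 2 * b <= 2 * M ^+ 3.
    move=> aM b0 bM; rewrite -mulrA ler_pM2l// (exprSr _ 2) ler_pM ?sqr_ge0//.
    by rewrite -real_normK ?num_real// lerXn2r// nnegrE.
  have := sq _ _ c1 (dot_ge0 (H x)) d2; have := sq _ _ d1 (dot_ge0 (G x)) c2.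
  have : 0 <= M ^+ 2 by rewrite exprn_ge0.
  lra.
- move=> x h h1; have [c1 _ /(_ h) c3] := uC x; have [d1 _ /(_ h) d3] := vD x.
  have a1 := lip _ _ uC x h h1; have a2 := lip _ _ vD x h h1.
  rewrite dotDl !dotZl.
  set p := u (x + h) - u x in c3 a1; set q := v (x + h) - v x in d3 a2.
  rewrite (_ : _ - _ = p * q + (u x * (q - dot (H x) h) + v x * (p - dot (G x) h))); last first.
    by rewrite /p /q; ring.
  have h0 := dot_ge0 h.
  have e1 : `|u x * (q - dot (H x) h)| <= M ^+ 2 * dot h h.
    by rewrite normrM expr2 -mulrA ler_pM.
  have e2 : `|v x * (p - dot (G x) h)| <= M ^+ 2 * dot h h.
    by rewrite normrM expr2 -mulrA ler_pM.
  have e3 : `|p * q| <= 2 * (M + M ^+ 2) * dot h h.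
    have s1 := sqr_ge0 (p - q); have s2 := sqr_ge0 (p + q).
    by rewrite ler_norml; apply/andP; split; nra.
  have e4 : 0 <= 4 * M ^+ 3 * dot h h by rewrite !mulr_ge0 ?exprn_ge0.
  apply: le_trans (ler_normD _ _) _; apply: le_trans (lerD (lexx _) (ler_normD _ _)) _.
  lra.
Qed.

Lemma C11Z u G (a : R) : C11 u G -> C11 (fun x => a * u x) (fun x => a *: G x).
Proof.
move=> h; have := C11M (C11_cst a) h.
by under [X in C11 _ X]eq_fun do rewrite scaler0 addr0.
Qed.

Lemma C11_line_derivative u G x i : C11 u G ->
  is_derive (0 : R) (1 : R) (fun t : R => u (x + t *: delta_mx ord0 i)) (G x ord0 i).
Proof.
move=> [_ _ [C C0 H]]; have [_ _ {}H] := H x.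
have dotdelta : dot (G x) (delta_mx ord0 i) = G x ord0 i.
  rewrite /dot (bigD1 i)//= mxE !eqxx mulr1 big1 ?addr0// => j ji.
  by rewrite mxE (negbTE ji) andbF mulr0.
have dd : dot (delta_mx ord0 i : 'rV[R]_n) (delta_mx ord0 i) = 1.
  rewrite /dot (bigD1 i)//= mxE !eqxx mulr1 big1 ?addr0// => j ji.
  by rewrite mxE (negbTE ji) andbF mulr0.
pose w (h : R) := h^-1 *: (((fun t : R => u (x + t *: delta_mx ord0 i)) \o shift 0) (h *: 1) -
   u (x + 0 *: delta_mx ord0 i)).
have : w h @[h --> 0^'] --> G x ord0 i.
  apply/cvgrPdist_le => e e0.
  near=> h.
  have h0 : h != 0 by near: h; exact: nbhs_dnbhs_neq.
  rewrite /w /= scale0r !addr0 [h *: 1]mulr1 distrC.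
  have := H (h *: delta_mx ord0 i); rewrite dotZr dotdelta dotZl dotZr dd mulr1.
  set b := u _ - u x => hb.
  rewrite (_ : _ - _ = h^-1 * (b - h * G x ord0 i)); last first.
    by rewrite /GRing.scale/=; field.
  rewrite normrM normfV ler_pdivrMl ?normr_gt0//.
  apply: le_trans hb _.
  rewrite -expr2 -[h ^+ 2]real_normK ?num_real// expr2 mulrCA ler_wpM2l//.
  have hC : `|h| <= e / (C + 1).
    near: h; apply: dnbhs0_le; rewrite divr_gt0// ltr_wpDl//.
  apply: le_trans (ler_wpM2l C0 hC) _.
  by rewrite mulrCA ler_piMr ?(ltW e0)// ler_pdivrMr ?mul1r ?ltr_wpDl// lerDl.
move=> cw; apply: DeriveDef; first exact: cvgP cw.
by apply/cvg_lim => //; exact: cw.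
Unshelve. all: by end_near. Qed.

End C11_algebra.

(** * Radial cutoff functions *)

Section radial_cutoff.
Context {R : realType}.

Definition pospart (t : R) : R := Num.max t 0.
(** A C^{1,1} function equal to 1 for t <= 0 and to 0 for t >= 1; squaring the
    positive parts makes the derivative Lipschitz. *)
Definition step01 (t : R) : R := pospart (1 - pospart t ^+ 2) ^+ 2.
Definition dstep01 (t : R) : R := - 4 * pospart (1 - pospart t ^+ 2) * pospart t.

Lemma pospart_ge0 t : 0 <= pospart t. Proof. by rewrite le_max lexx orbT. Qed.

Let pospartP t : (0 <= t /\ pospart t = t) \/ (t <= 0 /\ pospart t = 0).
Proof. by rewrite /pospart; case: (leP t 0) => h; [right|left; split=> //; exact: ltW]. Qed.

Let pospart_sqr_expansion (t s : R) :
  `|pospart (t + s) ^+ 2 - pospart t ^+ 2 - 2 * pospart t * s| <= s ^+ 2.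
Proof.
case: (pospartP t) => -[t0 ->]; case: (pospartP (t + s)) => -[s0 ->];
  rewrite ler_norml; apply/andP; split; nra.
Qed.

Lemma step01_ge0 t : 0 <= step01 t. Proof. exact: sqr_ge0. Qed.

Lemma step01_le1 t : step01 t <= 1.
Proof.
rewrite /step01 expr_le1// ?pospart_ge0// ge_max ler01 andbT gerBl.
exact: sqr_ge0.
Qed.

Lemma step01_le0 t : t <= 0 -> step01 t = 1.
Proof.
by move=> t0; rewrite /step01 /pospart (max_r t0) expr0n subr0 max_l ?expr1n.
Qed.

Lemma step01_ge1 t : 1 <= t -> step01 t = 0.
Proof.
move=> t1; rewrite /step01 {1}/pospart max_r ?expr0n// subr_le0.
by rewrite /pospart max_l ?expr_ge1//; apply: le_trans t1.
Qed.

Lemma dstep01_le0 t : t <= 0 -> dstep01 t = 0.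
Proof. by move=> t0; rewrite /dstep01 [X in _ * X]/pospart (max_r t0) mulr0. Qed.

Lemma dstep01_ge1 t : 1 <= t -> dstep01 t = 0.
Proof.
move=> t1; rewrite /dstep01 {1}/pospart max_r ?mulr0 ?mul0r// subr_le0.
by rewrite /pospart max_l ?expr_ge1//; apply: le_trans t1.
Qed.

Lemma sqr_dstep01_le t : dstep01 t ^+ 2 <= 16.
Proof.
have [t1|t1] := leP 1 t; first by rewrite dstep01_ge1// expr0n.
rewrite /dstep01.
have a0 := pospart_ge0 t; have b0 := pospart_ge0 (1 - pospart t ^+ 2).
have a1 : pospart t <= 1 by rewrite ge_max (ltW t1) ler01.
have b1 : pospart (1 - pospart t ^+ 2) <= 1.
  by rewrite ge_max ler01 andbT gerBl sqr_ge0.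
set a := pospart t in a0 a1 *; set b := pospart _ in b0 b1 *.
have : a ^+ 2 <= 1 by rewrite expr_le1.
have : b ^+ 2 <= 1 by rewrite expr_le1.
have : 0 <= a ^+ 2 by exact: sqr_ge0.
have : 0 <= b ^+ 2 by exact: sqr_ge0.
rewrite !exprMn; nra.
Qed.

Lemma step01_expansion (t s : R) : t <= 5 -> `|s| <= 8 ->
  `|step01 (t + s) - step01 t - dstep01 t * s| <= 326 * s ^+ 2.
Proof.
move=> t5 s8.
have := pospart_sqr_expansion t s.
have := pospart_sqr_expansion (1 - pospart t ^+ 2)
  (pospart t ^+ 2 - pospart (t + s) ^+ 2).
rewrite /step01 /dstep01 addrA subrK.
have a5 : pospart t <= 5 by rewrite ge_max t5 ler0n.
have a0 := pospart_ge0 t; have b0 := pospart_ge0 (1 - pospart t ^+ 2).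
have b1 : pospart (1 - pospart t ^+ 2) <= 1.
  by rewrite ge_max ler01 andbT gerBl sqr_ge0.
set b := pospart (1 - pospart t ^+ 2) in b0 b1 *; set a := pospart t in a0 a5 *.
set A := pospart (1 - pospart (t + s) ^+ 2) ^+ 2; set c := pospart (t + s) ^+ 2.
set w := a ^+ 2 - c => h1 h2.
have s2 := sqr_ge0 s.
have wE : `|w| <= 18 * `|s|.
  have -> : w = - (c - a ^+ 2 - 2 * a * s) - 2 * a * s by rewrite /w; ring.
  apply: le_trans (ler_normB _ _) _; rewrite normrN !normrM (ger0_norm a0) normr_nat.
  apply: le_trans (lerD h2 (lexx _)) _.
  have -> : s ^+ 2 = `|s| ^+ 2 by rewrite real_normK ?num_real.
  have := normr_ge0 s; nra.
have w2 : w ^+ 2 <= 324 * s ^+ 2.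
  rewrite -[w ^+ 2]real_normK ?num_real// -[s ^+ 2]real_normK ?num_real//.
  by have := normr_ge0 w; have := normr_ge0 s; nra.
rewrite (_ : _ - _ = (A - b ^+ 2 - 2 * b * w) - 2 * b * (c - a ^+ 2 - 2 * a * s)); last first.
  by rewrite /w; ring.
apply: le_trans (ler_normB _ _) _.
have : `|2 * b * (c - a ^+ 2 - 2 * a * s)| <= 2 * s ^+ 2.
  rewrite normrM ger0_norm ?mulr_ge0//.
  by have := normr_ge0 (c - a ^+ 2 - 2 * a * s); nra.
lra.
Qed.

Variables (n : nat) (P : R).
Hypothesis P0 : 0 < P.
Implicit Types x h : 'rV[R]_n.

Definition radial_cutoff x : R := step01 (dot x x / P - 1).
Definition grad_radial_cutoff x : 'rV[R]_n :=
  (dstep01 (dot x x / P - 1) * (2 / P)) *: x.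

Lemma radial_cutoff_ge0 x : 0 <= radial_cutoff x. Proof. exact: step01_ge0. Qed.
Lemma radial_cutoff_le1 x : radial_cutoff x <= 1. Proof. exact: step01_le1. Qed.

Lemma radial_cutoff_inside x : dot x x <= P -> radial_cutoff x = 1.
Proof. by move=> xP; rewrite /radial_cutoff step01_le0// subr_le0 ler_pdivrMr// mul1r. Qed.

Lemma radial_cutoff_outside x : 2 * P <= dot x x -> radial_cutoff x = 0.
Proof.
by move=> xP; rewrite /radial_cutoff step01_ge1// lerBrDr ler_pdivlMr.
Qed.

Lemma grad_radial_cutoff_inside x : dot x x <= P -> grad_radial_cutoff x = 0.
Proof.
by move=> xP; rewrite /grad_radial_cutoff dstep01_le0 ?mul0r ?scale0r// subr_le0 ler_pdivrMr// mul1r.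
Qed.

Lemma grad_radial_cutoff_outside x : 2 * P <= dot x x -> grad_radial_cutoff x = 0.
Proof.
by move=> xP; rewrite /grad_radial_cutoff dstep01_ge1 ?mul0r ?scale0r// lerBrDr ler_pdivlMr.
Qed.

(** The gradient lives where P <= dot x x <= 2 P, and there its size is of order
    1 / sqrt P. *)
Lemma sqr_grad_radial_cutoff_le x :
  dot (grad_radial_cutoff x) (grad_radial_cutoff x) <= 128 / P.
Proof.
have [xP|xP] := leP (2 * P) (dot x x).
  by rewrite grad_radial_cutoff_outside// dot0l divr_ge0// ltW.
rewrite /grad_radial_cutoff dotZl dotZr mulrA -expr2 exprMn.
have h := sqr_dstep01_le (dot x x / P - 1); have h' := sqr_ge0 (dstep01 (dot x x / P - 1)).
set d := _ ^+ 2 in h h' *.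
have -> : 128 / P = 16 * (2 / P) ^+ 2 * (2 * P) by field; rewrite gt_eqF.
apply: ler_pM; [|exact: dot_ge0| |exact: ltW].
  by rewrite mulr_ge0// sqr_ge0.
by apply: ler_wpM2r => //; exact: sqr_ge0.
Qed.

Let measurable_dot : measurable_fun setT (fun x : 'rV[R]_n => dot x x).
Proof.
apply: measurable_sum => i; apply: measurable_funM; exact: measurable_coord.
Qed.

Let measurable_pospart : measurable_fun setT (pospart : R -> R).
Proof. by apply: measurable_maxr. Qed.

Lemma C11_radial_cutoff : C11 radial_cutoff grad_radial_cutoff.
Proof.
have mq : measurable_fun setT (fun x : 'rV[R]_n => dot x x / P - 1).
  by apply: measurable_funB => //; apply: measurable_funM.
have ms : measurable_fun setT (fun t : R => 1 - pospart t ^+ 2).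
  by apply: measurable_funB => //; apply: measurable_funX.
have [K KE] : exists K : R, K = 326 * 50 + 4 by exists (326 * 50 + 4).
have K0 : 0 <= K by lra.
have [L LE] : exists L : R, L = 128 by exists 128.
have L0 : 0 <= L by lra.
apply: (@C11_local _ _ _ _ (1 + L / P + K / P) P) => //.
- by rewrite !addr_ge0 ?divr_ge0// ltW.
- apply: (measurableT_comp (f := step01)) => //.
  by apply: measurable_funX; exact: measurableT_comp.
- move=> i; under eq_fun do rewrite mxE.
  apply: measurable_funM; last exact: measurable_coord.
  apply: measurable_funM => //; apply: (measurableT_comp (f := dstep01)) => //.
  apply: measurable_funM => //; apply: measurable_funM => //.
  exact: measurableT_comp.
- move=> x; rewrite ger0_norm ?radial_cutoff_ge0//.
  apply: le_trans (radial_cutoff_le1 x) _.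
  by rewrite -addrA lerDl addr_ge0 ?divr_ge0// ltW.
- move=> x; apply: le_trans (sqr_grad_radial_cutoff_le x) _.
  by rewrite -LE addrAC lerDr addr_ge0 ?divr_ge0// ltW.
move=> x h hP; have h0 := dot_ge0 h.
suff : `|radial_cutoff (x + h) - radial_cutoff x - dot (grad_radial_cutoff x) h| <=
    K / P * dot h h.
  by move/le_trans; apply; rewrite ler_wpM2r// lerDr addr_ge0 ?divr_ge0// ltW.
have [xP|xP] := leP (6 * P) (dot x x).
  rewrite radial_cutoff_outside; last by have := dotB_ge x h; lra.
  rewrite radial_cutoff_outside; last by lra.
  rewrite grad_radial_cutoff_outside; last by lra.
  by rewrite dot0l !subr0 normr0 mulr_ge0 ?divr_ge0// ltW.
pose t := dot x x / P - 1; pose s := (2 * dot x h + dot h h) / P.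
have tE : dot (x + h) (x + h) / P - 1 = t + s.
  by rewrite /t /s dotDl !dotDr (dotC h x); ring.
have s2 : s ^+ 2 <= 50 * dot h h / P.
  rewrite /s expr_div_n ler_pdivrMr ?exprn_gt0//.
  have -> : 50 * dot h h / P * P ^+ 2 = 50 * dot h h * P by field; rewrite gt_eqF.
  have e1 := sqr_dot_le x h.
  have e2 : dot x x * dot h h <= 6 * P * dot h h by rewrite ler_wpM2r// ltW.
  have e3 : dot h h * dot h h <= P * dot h h by rewrite ler_wpM2r.
  have := sqr_ge0 (2 * dot x h - dot h h); nra.
have s8 : `|s| <= 8.
  rewrite -(@ler_pXn2r _ 2)// ?nnegrE// real_normK ?num_real//.
  apply: le_trans s2 _; rewrite ler_pdivrMr//; lra.
have t5 : t <= 5 by rewrite /t lerBlDr ler_pdivrMr//; lra.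
have := step01_expansion t5 s8.
rewrite /radial_cutoff /grad_radial_cutoff tE -/t dotZl => E.
rewrite (_ : _ - _ = (step01 (t + s) - step01 t - dstep01 t * s) + dstep01 t * (dot h h / P)); last first.
  by rewrite /s; field; rewrite gt_eqF.
have d4 : `|dstep01 t| <= 4.
  rewrite -(@ler_pXn2r _ 2)// ?nnegrE// real_normK ?num_real//.
  by apply: le_trans (sqr_dstep01_le t) _; rewrite -natrX.
apply: le_trans (ler_normD _ _) _.
have : `|dstep01 t * (dot h h / P)| <= 4 * (dot h h / P).
  have hp : 0 <= dot h h / P by rewrite divr_ge0// ltW.
  by rewrite normrM (ger0_norm hp) ler_wpM2r.
rewrite -(mulrA 50) in s2; rewrite mulrAC -mulrA.
by have hp : 0 <= dot h h / P by [rewrite divr_ge0// ltW]; rewrite KE; lra.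
Qed.

End radial_cutoff.

(** * Integration by parts *)

Section real_dominated_convergence.
Context d (T : measurableType d) {R : realType} (mu : {measure set T -> \bar R}).

Lemma dominated_cvg_Rintegral (f_ : nat -> T -> R) (f g : T -> R) :
  (forall k, measurable_fun setT (f_ k)) ->
  (forall x, f_ k x @[k --> \oo] --> f x) ->
  mu.-integrable setT (EFin \o g) ->
  (forall k x, `|f_ k x| <= g x) ->
  mu.-integrable setT (EFin \o f) /\
  \int[mu]_x f_ k x @[k --> \oo] --> \int[mu]_x f x.
Proof.
move=> mf_ ff ig fg.
have mf : measurable_fun setT f by apply: (measurable_fun_cvg mf_) => x _; exact: ff.
have [|||||i1 _ i2] := @dominated_convergence _ _ _ mu setT measurableT
  (fun k => EFin \o f_ k) (EFin \o f) (EFin \o g).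
- by move=> k; exact/measurable_EFinP.
- exact/measurable_EFinP.
- by apply: aeW => x _; apply: cvg_comp (ff x) _ => //.
- exact: ig.
- by apply: aeW => x k _; rewrite lee_fin.
split => //.
have fin k : (\int[mu]_x (f_ k x)%:E)%E \is a fin_num.
  apply: integrable_fin_num => //; apply: le_integrable ig => //.
    exact/measurable_EFinP.
  by move=> x _ /=; rewrite lee_fin (le_trans (fg k x))// ler_norm.
apply: fine_cvg; rewrite /= fineK; first exact: i2.
exact: integrable_fin_num.
Qed.

Lemma Rintegral_sum (I : Type) (s : seq I) (f : I -> T -> R) :
  (forall i, mu.-integrable setT (EFin \o f i)) ->
  mu.-integrable setT (fun x => (\sum_(i <- s) f i x)%:E) /\
  \int[mu]_x (\sum_(i <- s) f i x) = \sum_(i <- s) \int[mu]_x f i x.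
Proof.
move=> fi; elim: s => [|i s [IH1 IH2]].
  split; first by under eq_fun do rewrite big_nil; exact: integrable0.
  by under eq_Rintegral do rewrite big_nil; rewrite Rintegral_cst// mul0r big_nil.
split.
  under eq_fun do rewrite big_cons EFinD.
  exact: (integrableD measurableT (fi i) IH1).
under eq_Rintegral do rewrite big_cons.
by rewrite RintegralD// big_cons IH2.
Qed.

End real_dominated_convergence.

Section integration_by_parts.
Context {R : realType} {n : nat}.
Implicit Types (phi psi : 'rV[R]_n -> R).

Lemma integral_translation (h : 'rV[R]_n) (f : 'rV[R]_n -> \bar R) :
  measurable_fun setT f ->
  (\int[lebesgue_rV n]_x f (x + h)%R = \int[lebesgue_rV n]_x f x)%E.
Proof.
move=> mf; rewrite integralE [RHS]integralE; congr (_ - _)%E.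
  rewrite -(@ge0_integral_translation _ _ h (f^\+)%E)//; last exact: measurable_funepos.
  by apply: eq_integral => x _; rewrite !funeposE.
rewrite -(@ge0_integral_translation _ _ h (f^\-)%E)//; last exact: measurable_funeneg.
by apply: eq_integral => x _; rewrite !funenegE.
Qed.

Lemma line_MVT_bound phi psi (e : 'rV[R]_n) (L : R) :
  (forall x, is_derive (0 : R) (1 : R) (fun t : R => phi (x + t *: e)) (psi x)) ->
  (forall x, `|psi x| <= L) ->
  forall x t, 0 < t -> `|phi (x + t *: e) - phi x| <= L * t.
Proof.
move=> dphi psiL x t t0.
have d (s : R) : is_derive s (1 : R) (fun t : R => phi (x + t *: e)) (psi (x + s *: e)).
  have [h1 h2] := dphi (x + s *: e).
  have E : (fun h : R => h^-1 *: (((fun t : R => phi (x + t *: e)) \o shift s) (h *: 1) -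
      phi (x + s *: e))) =
    (fun h : R => h^-1 *: (((fun t : R => phi (x + s *: e + t *: e)) \o shift 0) (h *: 1) -
      phi (x + s *: e + 0 *: e))).
    apply/funext => h /=; rewrite scale0r !addr0; congr (_ *: (phi _ - _)).
    by rewrite scalerDl -addrA (addrC (s *: e)).
  by apply: DeriveDef; [rewrite /derivable E|rewrite /derive E].
have c : {within `[0, t], continuous (fun t : R => phi (x + t *: e))}.
  apply: continuous_subspaceT => s.
  by apply: differentiable_continuous; apply/derivable1_diffP; case: (d s).
have [s _] := MVT t0 (fun s _ => d s) c.
rewrite scale0r addr0 subr0 => ->.
by rewrite normrM (gtr0_norm t0) ler_pM2r.
Qed.

(** The difference quotients integrate to 0 because Lebesgue measure is
    translation invariant, and they converge dominatedly. *)
Lemma Rintegral_line_derivative phi psi i (L : R) : bounded_support phi ->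
  (forall x, is_derive (0 : R) (1 : R)
     (fun t : R => phi (x + t *: delta_mx ord0 i)) (psi x)) ->
  (forall x, `|psi x| <= L) ->
  (lebesgue_rV n).-integrable setT (EFin \o psi) /\
  \int[lebesgue_rV n]_x psi x = 0.
Proof.
move=> bphi dphi psiL; set e := delta_mx ord0 i in dphi.
have L0 : 0 <= L by exact: le_trans (psiL 0).
have [mphi [M [r [M0 r0 phiM phir]]]] := bounded_supportP bphi.
pose u (k : nat) x := k.+1%:R * (phi (x + k.+1%:R^-1 *: e) - phi x).
have mtr k : measurable_fun setT (fun x : 'rV[R]_n => phi (x + k.+1%:R^-1 *: e)).
  by apply: measurableT_comp => //; exact: measurable_translate.
have shift0 k (x : 'rV[R]_n) j : r + 1 < `|x ord0 j| -> phi (x + k.+1%:R^-1 *: e) = 0.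
  move=> xj; apply: (phir _ j); rewrite !mxE.
  have k1 : `|k.+1%:R^-1 * ((0 == 0 :> 'I_1) && (j == i))%:R| <= 1 :> R.
    rewrite normrM ger0_norm ?invr_ge0// mulr_ile1 ?invr_ge0//.
      by rewrite invf_le1// ler1n.
    by case: (_ && _); rewrite ?normr1 ?normr0.
  move: k1 xj; set b := _ * _ => k1 xj.
  rewrite -[x ord0 j](addrK b) in xj.
  have := ler_normB (x ord0 j + b) b; lra.
have int0 k : \int[lebesgue_rV n]_x u k x = 0.
  have bs : bounded_support (fun x : 'rV[R]_n => phi (x + k.+1%:R^-1 *: e)).
    by split => //; exists M, (r + 1); split => // x j; exact: shift0.
  rewrite RintegralZl//.
    rewrite RintegralB//; try exact: integrable_bounded_support.
    rewrite {1}/Rintegral (@integral_translation _ (fun x => (phi x)%:E)).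
      by rewrite -/(Rintegral _ _ _) subrr mulr0.
    exact/measurable_EFinP.
  exact: (integrableB measurableT (integrable_bounded_support bs) (integrable_bounded_support bphi)).
have r10 : 0 <= r + 1 by rewrite addr_ge0.
have [||||ipsi] := @dominated_cvg_Rintegral _ _ _ (lebesgue_rV n) u psi
    (fun x => L * \1_(@cube R n (r + 1)) x).
- by move=> k; apply: measurable_funM => //; exact: measurable_funB.
- move=> x; have [d1 d2] := dphi x.
  have : h^-1 *: (((fun t : R => phi (x + t *: e)) \o shift 0) (h *: 1) -
      phi (x + 0 *: e)) @[h --> (0 : R)^'] --> psi x by rewrite -d2; exact: d1.
  move=> /cvg_dnbhs_at_right /cvg_at_rightP /(_ (fun k => k.+1%:R^-1)) H.
  have -> : (fun k => u k x) = (fun k => (k.+1%:R^-1)^-1 *: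
     (((fun t : R => phi (x + t *: e)) \o shift 0) (k.+1%:R^-1 *: 1) - phi (x + 0 *: e))).
    apply/funext => k; rewrite /u invrK /= scale0r !addr0; congr (_ * (phi (_ + _ *: _) - _)).
    by rewrite [RHS]mulr1.
  by apply: H; split; [move=> k; rewrite invr_gt0|exact: cvg_harmonic].
- exact: (@integrable_cube_indicator R n L (r + 1) r10).
- move=> k x.
  apply: le_cube_indicator => // y.
    rewrite normrM ger0_norm// -ler_pdivlMl// mulrC.
    by apply: line_MVT_bound dphi psiL _ _ _; rewrite invr_gt0.
  move=> j yj; rewrite /u (shift0 _ _ j)// (phir _ j) ?subr0 ?mulr0//.
  by apply: lt_trans yj; rewrite ltrDl.
under eq_fun do rewrite int0.
by move=> /cvg_lim <-//; rewrite lim_cst.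
Qed.

End integration_by_parts.

(** * The tail inequality *)

Section compact_bounds.
Context {R : realType} {n : nat}.

Lemma continuous_bounded_cube (f : 'rV[R]_n -> R) (r : R) : continuous f ->
  exists2 M, 0 <= M & forall x, cube r x -> `|f x| <= M.
Proof.
move=> cf.
have cc : compact (@cube R n r).
  apply: (@rV_compact _ n (fun=> `[- r, r]%classic)) => i; exact: segment_compact.
have /compact_bounded [M [_ HM]] : compact (f @` @cube R n r).
  by apply: continuous_compact => //; exact: continuous_subspaceT.
exists (`|M| + 1) => [|x xr]; first by rewrite addr_ge0.
apply: HM; first by apply: le_lt_trans (ler_norm M) _; rewrite ltrDl.
by exists x.
Qed.

End compact_bounds.

Section tail.
Context {R : realType} {n : nat}.
Variables (alpha Ra : R) (V : 'rV[R]_n -> R).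
Hypotheses (alpha1 : 1 < alpha) (Ra0 : 0 <= Ra).
Hypothesis sV : smooth V.
Hypothesis VE : forall x, Ra <= enorm x -> V x = enorm x `^ alpha / alpha.
Variables (P S r : R).
Hypotheses (P0 : 0 < P) (RaP : Ra ^+ 2 < P) (S0 : 0 < S).
Hypothesis Pn : forall x : 'rV[R]_n, P <= dot x x -> 2 * n%:R <= enorm x `^ alpha.
Hypothesis PS : forall x : 'rV[R]_n, P <= dot x x -> S <= enorm x `^ (alpha - 1).
Local Notation W := (restricted_gibbs V (@cube R n r)).

Let s (x : 'rV[R]_n) : R := Num.sqrt (P + dot x x).

Let s2 x : s x ^+ 2 = P + dot x x.
Proof. by rewrite sqr_sqrtr// addr_ge0 ?dot_ge0// ltW. Qed.

Let s_gt0 x : 0 < s x.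
Proof. by rewrite sqrtr_gt0 ltr_pwDl// dot_ge0. Qed.

Let is_derive_Vs x i : is_derive (0 : R) (1 : R)
  (fun t : R => (s (x + t *: delta_mx ord0 i))^-1) (- x ord0 i / s x ^+ 3).
Proof.
have e : (fun t : R => s (x + t *: delta_mx ord0 i)) =
    Num.sqrt \o (fun t : R => P + dot x x + 2 * t * x ord0 i + t ^+ 2).
  apply/funext => t /=; congr (Num.sqrt _).
  have dotdelta (y : 'rV[R]_n) : dot y (delta_mx ord0 i) = y ord0 i.
    rewrite /dot (bigD1 i)//= mxE !eqxx mulr1 big1 ?addr0// => j ji.
    by rewrite mxE (negbTE ji) andbF mulr0.
  rewrite dotDl !dotDr !dotZl !dotZr (dotC (delta_mx _ _) x) !dotdelta mxE !eqxx.
  by rewrite mulr1; ring.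
pose qq (t : R) : R := P + dot x x + 2 * t * x ord0 i + t ^+ 2.
have d1 : is_derive (0 : R) (1 : R) qq (2 * x ord0 i).
  by apply: is_derive_eq; rewrite /GRing.scale/=; ring.
have p0 : 0 < qq 0.
  by rewrite /qq mulr0 mul0r expr0n/= !addr0 ltr_pwDl// dot_ge0.
have d2 := is_derive1_sqrt p0.
have d3 : is_derive (0 : R) (1 : R) (fun t : R => s (x + t *: delta_mx ord0 i))
    ((2 * s x)^-1 * (2 * x ord0 i)).
  rewrite e; have := @is_derive1_comp _ Num.sqrt qq _ _ _ d2 d1.
  by rewrite {2}/qq mulr0 mul0r expr0n/= !addr0.
have nz : s (x + 0 *: delta_mx ord0 i) != 0 by rewrite gt_eqF.
have := @is_deriveV _ (fun t : R => s (x + t *: delta_mx ord0 i)) 0 _ 1 nz d3.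
rewrite scale0r addr0; congr (is_derive _ _ _ _).
by rewrite /GRing.scale/=; field; rewrite gt_eqF.
Qed.

Variables (g : 'rV[R]_n -> R) (G : 'rV[R]_n -> 'rV[R]_n).
Hypotheses (gG : C11 g G).
Hypothesis g_in : forall x, dot x x < P -> g x = 0.
Hypothesis g_out : forall x, ~ cube r x -> g x = 0.

(** The components of the vector field g^2 e^{-V} x / sqrt (P + |x|^2) and their
    diagonal partial derivatives. Dividing by sqrt (P + |x|^2) rather than by
    |x| keeps the field regular at the origin. *)
Let phi i x := g x * g x * expR (- V x) * x ord0 i * (s x)^-1.
Let psi i x := (2 * g x * G x ord0 i - g x * g x * partial i V x) * expR (- V x) *
    x ord0 i * (s x)^-1 + g x * g x * expR (- V x) * ((s x)^-1 - x ord0 i ^+ 2 / s x ^+ 3).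

Let is_derive_phi i x : is_derive (0 : R) (1 : R)
  (fun t : R => phi i (x + t *: delta_mx ord0 i)) (psi i x).
Proof.
pose gg (t : R) := g (x + t *: delta_mx ord0 i).
pose vv (t : R) := V (x + t *: delta_mx ord0 i).
pose ss (t : R) := (s (x + t *: delta_mx ord0 i))^-1.
have dg : is_derive (0 : R) (1 : R) gg (G x ord0 i) by exact: C11_line_derivative.
have dV : is_derive (0 : R) (1 : R) vv (partial i V x).
  have := @is_derive_line _ _ V x (delta_mx ord0 i) 0 (smooth_differentiable sV _).
  by rewrite scale0r addr0.
have ds : is_derive (0 : R) (1 : R) ss (- x ord0 i / s x ^+ 3) by exact: is_derive_Vs.
have de : is_derive (0 : R) (1 : R) (expR \o (fun t => - vv t))
    (expR (- vv 0) * - partial i V x).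
  exact: is_derive1_comp.
have mE (a b : R -> R) t : (a * b) t = a t * b t by [].
rewrite (_ : (fun t : R => _) =
  gg * gg * (expR \o (fun t => - vv t)) * (fun t : R => x ord0 i + t) * ss); last first.
  apply/funext => t; rewrite /phi /gg /vv /ss /= !mxE !eqxx mulr1.
  by [].
apply: is_derive_eq; rewrite !mE /GRing.scale/= /gg /vv /ss !scale0r !addr0.
by rewrite /psi; field; rewrite gt_eqF.
Qed.

Let V_ge0 x : P <= dot x x -> 0 <= V x.
Proof.
move=> xP; rewrite VE ?divr_ge0 ?powR_ge0//; first by rewrite ltW// (lt_trans ltr01).
rewrite -(@ler_pXn2r _ 2)// ?nnegrE ?enorm_ge0// sqr_enorm.
by rewrite ltW// (lt_le_trans RaP).
Qed.

Let cases x : g x = 0 \/ [/\ P <= dot x x, Ra < enorm x & cube r x].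
Proof.
have [xP|xP] := leP P (dot x x); last by left; exact: g_in.
have [xr|xr] := pselect (cube r x); last by left; exact: g_out.
right; split => //.
by rewrite -(@ltr_pXn2r _ 2)// ?nnegrE ?enorm_ge0// sqr_enorm (lt_le_trans RaP).
Qed.

Let coord_le_s (x : 'rV[R]_n) i : `|x ord0 i| <= s x.
Proof.
rewrite -(@ler_pXn2r _ 2)// ?nnegrE ?(ltW (s_gt0 x))// s2 real_normK ?num_real//.
by apply: le_trans (sqr_coord_le_dot _ _) _; rewrite lerDr ltW.
Qed.

Let bounded_psi i : exists L : R, forall x, `|psi i x| <= L.
Proof.
have [C C0 HC] : exists2 C : R, 0 <= C & forall x, `|g x| <= C /\ `|G x ord0 i| <= C.
  have [_ [C1 H1]] := C11_bounded_fun gG; have [_ [C2 H2]] := C11_bounded_coord i gG.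
  exists (Num.max C1 C2).
    by rewrite le_max (le_trans (normr_ge0 _) (H1 0)).
  by move=> x; split; rewrite le_max ?H1 ?H2 ?orbT.
have [M M0 HM] := continuous_bounded_cube r (smooth_continuous (smooth_partial i sV)).
have sP : 0 < Num.sqrt P by rewrite sqrtr_gt0.
exists (2 * C * C + C * C * M + C * C * (2 / Num.sqrt P)) => x.
have [g0|[xP xR xr]] := cases x.
  rewrite /psi g0 !(mulr0, mul0r, subrr, addr0) normr0.
  by rewrite !addr_ge0 ?mulr_ge0 ?invr_ge0 ?(ltW sP).
have [c1 c2] := HC x; have c3 := HM x xr.
have e1 : `|expR (- V x)| <= 1.
  by rewrite ger0_norm ?expR_ge0// -expR0 ler_expR oppr_le0 V_ge0.
have e2 : `|x ord0 i * (s x)^-1| <= 1.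
  by rewrite normrM normfV (gtr0_norm (s_gt0 x)) ler_pdivrMr// mul1r.
have sx : Num.sqrt P <= s x by rewrite ler_wsqrtr// lerDl dot_ge0.
have e3 : `|(s x)^-1 - x ord0 i ^+ 2 / s x ^+ 3| <= 2 / Num.sqrt P.
  have h : x ord0 i ^+ 2 / s x ^+ 3 = (x ord0 i * (s x)^-1) ^+ 2 * (s x)^-1.
    by field; rewrite gt_eqF.
  have h2 : (x ord0 i * (s x)^-1) ^+ 2 <= 1.
    by rewrite -[X in X <= _]real_normK ?num_real// expr_le1.
  have h3 : (s x)^-1 <= (Num.sqrt P)^-1 by rewrite lef_pV2 ?posrE.
  have h4 : 0 < (s x)^-1 by rewrite invr_gt0.
  apply: le_trans (ler_normB _ _) _; rewrite h normrM (gtr0_norm h4) (ger0_norm (sqr_ge0 _)).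
  have := sqr_ge0 (x ord0 i * (s x)^-1); nra.
rewrite /psi; apply: le_trans (ler_normD _ _) _; apply: lerD; last first.
  rewrite !normrM; apply: ler_pM => //; apply: le_trans (ler_piMr _ e1) _ => //.
  exact: ler_pM.
rewrite -[X in `|X|]mulrA normrM; apply: le_trans (ler_piMr (normr_ge0 _) e2) _.
rewrite normrM; apply: le_trans (ler_piMr (normr_ge0 _) e1) _.
apply: le_trans (ler_normB _ _) _; rewrite !normrM (ger0_norm (ler0n _ 2)).
by apply: lerD; do !apply: ler_pM => //; rewrite ?mulr_ge0.
Qed.

Let bounded_support_phi i : bounded_support (phi i).
Proof.
have mV := measurable_continuous_rV (smooth_continuous sV).
have mg : measurable_fun setT g by case: gG.
have mq : measurable_fun setT (fun x : 'rV[R]_n => P + dot x x).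
  apply: measurable_funD => //; apply: measurable_sum => j.
  by apply: measurable_funM; exact: measurable_coord.
have ms : measurable_fun setT (fun x : 'rV[R]_n => (s x)^-1).
  rewrite (_ : (fun x => _) = fun x : 'rV[R]_n => (P + dot x x) `^ (- (2^-1))).
    by apply: (measurableT_comp (f := fun t : R => t `^ (- (2^-1)))) => //; exact: measurable_powR.
  by apply/funext => x; rewrite powRN powR12_sqrt// addr_ge0 ?dot_ge0// ltW.
have [C0 HC] := C11_bounded_fun gG; case: HC => C HC.
split.
  apply: measurable_funM => //; apply: measurable_funM; last exact: measurable_coord.
  apply: measurable_funM; first exact: measurable_funM.
  by apply: measurableT_comp => //; exact: measurableT_comp.
exists (C * C), r; split => [x|x j xj].
  have CC : 0 <= C by exact: le_trans (HC 0).
  have [g0|[xP xR xr]] := cases x.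
    by rewrite /phi g0 !mul0r normr0 mulr_ge0.
  have e1 : `|expR (- V x)| <= 1.
    by rewrite ger0_norm ?expR_ge0// -expR0 ler_expR oppr_le0 V_ge0.
  have e2 : `|x ord0 i * (s x)^-1| <= 1.
    by rewrite normrM normfV (gtr0_norm (s_gt0 x)) ler_pdivrMr// mul1r.
  rewrite /phi -[X in `|X|]mulrA normrM; apply: le_trans (ler_piMr (normr_ge0 _) e2) _.
  rewrite normrM; apply: le_trans (ler_piMr (normr_ge0 _) e1) _.
  by rewrite normrM ler_pM.
rewrite /phi g_out ?mul0r// => /(_ j); rewrite in_itv/= -ler_norml leNgt xj.
by [].
Qed.

(** Where g does not vanish, V is radial with x . grad V = |x|^alpha. Since
    |x|^alpha >= 2 n, half of it survives the divergence n of x. Dividing by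
    s x <= 2 |x| turns this half into at least S / 4, since
    S <= |x|^(alpha - 1) there. *)
Let psi_sum_le x : \sum_i psi i x <=
  (- (S / 8) * g x ^+ 2 + 8 / S * dot (G x) (G x)) * W x.
Proof.
have [g0|[xP xR xr]] := cases x.
  rewrite big1; last by move=> i _; rewrite /psi g0 !(mulr0, mul0r, subrr, addr0).
  have S8 : 0 <= 8 / S by rewrite divr_ge0// ltW.
  rewrite g0 expr0n/= mulr0 add0r mulr_ge0 ?restricted_gibbs_ge0//.
  by rewrite mulr_ge0 ?dot_ge0.
have -> : W x = expR (- V x) by rewrite /restricted_gibbs indicE mem_set// mulr1.
have pV i : partial i V x = enorm x `^ (alpha - 2) * x ord0 i.
  rewrite /partial (derive_radial alpha1 Ra0 sV VE)//; congr (_ * _).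
  rewrite /dot (bigD1 i)//= mxE !eqxx mulr1 big1 ?addr0// => j ji.
  by rewrite mxE (negbTE ji) andbF mulr0.
have N0 : 0 < enorm x by exact: le_lt_trans xR.
have NE : enorm x `^ (alpha - 2) * dot x x = enorm x `^ alpha.
  rewrite -sqr_enorm -powR_mulrn ?enorm_ge0// -powRD; last by apply/implyP => _; rewrite gt_eqF.
  by rewrite subrK.
have sx0 := s_gt0 x.
have -> : \sum_i psi i x = expR (- V x) * ((2 * g x * dot (G x) x -
    g x ^+ 2 * (enorm x `^ alpha - n%:R)) / s x - g x ^+ 2 * dot x x / s x ^+ 3).
  have -> : n%:R = \sum_(i < n) (1 : R) by rewrite sumr_const card_ord.
  rewrite -NE /dot !mulr_sumr -!sumrB !mulr_sumr -!sumrB !mulr_suml -!sumrB mulr_sumr.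
  by apply: eq_bigr => i _; rewrite /psi pV; field; rewrite gt_eqF.
rewrite [leRHS]mulrC ler_pM2l ?expR_gt0//.
have PNn := Pn xP; have PSx := PS xP.
have a0 : 0 < enorm x `^ alpha by rewrite powR_gt0.
have sN : s x <= 2 * enorm x.
  rewrite -(@ler_pXn2r _ 2)// ?nnegrE ?mulr_ge0 ?enorm_ge0 ?(ltW sx0)// s2 exprMn sqr_enorm.
  by have := dot_ge0 x; lra.
have key : S / 4 <= (enorm x `^ alpha - n%:R) / s x.
  have N1 : enorm x `^ alpha = enorm x `^ (alpha - 1) * enorm x.
    rewrite -{3}(powRr1 (enorm_ge0 x)) -powRD; last by apply/implyP => _; rewrite gt_eqF.
    by rewrite subrK.
  rewrite ler_pdivlMr//.
  have : S / 4 * s x <= S / 4 * (2 * enorm x) by rewrite ler_wpM2l// divr_ge0// ltW.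
  have : S * enorm x <= enorm x `^ alpha by rewrite N1 ler_wpM2r// enorm_ge0.
  lra.
have gs : (dot (G x) x / s x) ^+ 2 <= dot (G x) (G x).
  rewrite expr_div_n ler_pdivrMr ?exprn_gt0// s2.
  apply: le_trans (sqr_dot_le _ _) _; rewrite ler_wpM2l ?dot_ge0// lerDr ltW//.
set d := dot (G x) (G x) in gs *; set gg := dot (G x) x / s x in gs *.
have -> : (2 * g x * dot (G x) x - g x ^+ 2 * (enorm x `^ alpha - n%:R)) / s x =
    2 * g x * gg - g x ^+ 2 * ((enorm x `^ alpha - n%:R) / s x).
  by rewrite /gg; field; rewrite gt_eqF.
have h1 : 0 <= g x ^+ 2 * dot x x / s x ^+ 3.
  apply: divr_ge0; first by rewrite mulr_ge0 ?sqr_ge0 ?dot_ge0.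
  by rewrite exprn_ge0// ltW.
have h2 : g x ^+ 2 * (S / 4) <= g x ^+ 2 * ((enorm x `^ alpha - n%:R) / s x).
  by rewrite ler_wpM2l ?sqr_ge0.
(* The cross term is absorbed by half of the negative term. *)
have h3 : 2 * g x * gg <= S / 8 * g x ^+ 2 + 8 / S * gg ^+ 2.
  rewrite -subr_ge0 (_ : _ - _ = 8 / S * (gg - S / 8 * g x) ^+ 2).
    by rewrite mulr_ge0 ?sqr_ge0// divr_ge0// ltW.
  by field; rewrite gt_eqF.
have h4 : 8 / S * gg ^+ 2 <= 8 / S * d by rewrite ler_wpM2l// divr_ge0// ltW.
lra.
Qed.

(** The divergence of the field has integral 0, while it is bounded above by a
    negative multiple of g^2 plus a multiple of the squared gradient. *)
Lemma tail_inequality :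
  S ^+ 2 * \int[lebesgue_rV n]_x (g x ^+ 2 * W x) <=
    64 * \int[lebesgue_rV n]_x (dot (G x) (G x) * W x).
Proof.
have ipsi i : (lebesgue_rV n).-integrable setT (EFin \o psi i) /\
    \int[lebesgue_rV n]_x psi i x = 0.
  have [L HL] := bounded_psi i.
  exact: (Rintegral_line_derivative (bounded_support_phi i) (is_derive_phi i) HL).
have [i1] := Rintegral_sum (index_enum 'I_n) (fun i => (ipsi i).1).
rewrite big1 => [i2|i _]; last by case: (ipsi i).
have mV := measurable_continuous_rV (smooth_continuous sV).
have [M M0 HM] := continuous_bounded_cube r (smooth_continuous sV).
have bW : bounded_support W.
  apply: (@restricted_gibbs_bounded_support _ _ V _ M r) => //; first exact: measurable_cube.
    by move=> x i /(_ i); rewrite in_itv/= -ler_norml.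
  by move=> x /HM; rewrite ler_norml => /andP[].
have W0 := @restricted_gibbs_ge0 R n V (@cube R n r).
have bg : bounded_measurable (fun x => g x ^+ 2).
  by apply: bounded_measurableX; exact: C11_bounded_fun gG.
have bG := C11_bounded_dot gG.
have bsum : bounded_measurable (fun x => - (S / 8) * g x ^+ 2 + 8 / S * dot (G x) (G x)).
  by apply: bounded_measurableD; exact: bounded_measurableZ.
have : 0 <= - (S / 8) * \int[lebesgue_rV n]_x (g x ^+ 2 * W x) +
    8 / S * \int[lebesgue_rV n]_x (dot (G x) (G x) * W x).
  rewrite -!weightedZ// -weightedD//; try exact: bounded_measurableZ.
  rewrite -i2; apply: le_Rintegral => //; first exact: integrable_weighted.
set I := \int[_]_x _; set J := \int[_]_x _ => h.
rewrite -subr_ge0.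
rewrite (_ : _ - _ = 8 * S * (- (S / 8) * I + 8 / S * J)); last by field; rewrite gt_eqF.
by rewrite mulr_ge0// mulr_ge0// ltW.
Qed.

End tail.

(** * The Poincare inequality for functions of compact support *)

Section compactly_supported_poincare.
Context {R : realType} {n : nat}.
Variables (alpha Ra : R) (V : 'rV[R]_n -> R).
Hypotheses (alpha1 : 1 < alpha) (Ra0 : 0 <= Ra).
Hypothesis sV : smooth V.
Hypothesis VE : forall x, Ra <= enorm x -> V x = enorm x `^ alpha / alpha.
Variables (P S k : R).
Hypotheses (P0 : 0 < P) (RaP : Ra ^+ 2 < P) (S0 : 0 < S) (k0 : 0 < k).
Hypothesis Pn : forall x : 'rV[R]_n, P <= dot x x -> 2 * n%:R <= enorm x `^ alpha.
Hypothesis PS : forall x : 'rV[R]_n, P <= dot x x -> S <= enorm x `^ (alpha - 1).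
Hypothesis hessV : forall x : 'rV[R]_n, dot x x <= 4 * P -> hess_ge V x k.
Hypothesis kP : 128 <= k * P.
Hypothesis SP : 64 * 512 <= S ^+ 2 * P.

Definition centered_ball (Q : R) : set 'rV[R]_n := [set x | dot x x <= Q].
Local Notation B := (centered_ball (4 * P)).

Lemma measurable_sqr_norm : measurable_fun setT (fun x : 'rV[R]_n => dot x x).
Proof.
apply: measurable_sum => i; apply: measurable_funM; exact: measurable_coord.
Qed.

Lemma measurable_centered_ball Q : measurable (centered_ball Q).
Proof.
rewrite (_ : centered_ball Q = (fun x : 'rV[R]_n => dot x x) @^-1` `]-oo, Q]); last first.
  by apply/seteqP; split => x /=; rewrite in_itv.
rewrite -[X in measurable X]setTI; exact: measurable_sqr_norm.
Qed.

Lemma centered_ball_sub_cube Q r : 0 <= r -> Q <= r ^+ 2 ->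
  centered_ball Q `<=` @cube R n r.
Proof.
move=> r0 Qr x /= xQ i; rewrite in_itv/= -ler_norml.
rewrite -(@ler_pXn2r _ 2)// ?nnegrE// real_normK ?num_real//.
by apply: le_trans (sqr_coord_le_dot _ _) (le_trans xQ Qr).
Qed.

Lemma enorm_segment (x y : 'rV[R]_n) (t : R) : 0 <= t -> t <= 1 ->
  enorm (x + t *: (y - x)) <= Num.max (enorm x) (enorm y).
Proof.
move=> t0 t1; set M := Num.max _ _.
have M0 : 0 <= M by rewrite le_max enorm_ge0.
rewrite -(@ler_pXn2r _ 2)// ?nnegrE ?enorm_ge0// sqr_enorm.
have -> : x + t *: (y - x) = (1 - t) *: x + t *: y.
  by rewrite scalerBr scalerBl scale1r addrCA addrC.
rewrite dotDl !dotDr !dotZl !dotZr (dotC y x).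
have hx : dot x x <= M ^+ 2.
  by rewrite -sqr_enorm lerXn2r// ?nnegrE ?enorm_ge0// le_max lexx.
have hy : dot y y <= M ^+ 2.
  by rewrite -sqr_enorm lerXn2r// ?nnegrE ?enorm_ge0// le_max lexx orbT.
have hxy : 2 * dot x y <= dot x x + dot y y.
  by have := dot_ge0 (x - y); rewrite dotDl !dotDr !dotNl !dotNr (dotC y x); lra.
have t10 : 0 <= (1 - t) * t by rewrite mulr_ge0// subr_ge0.
have h1 := ler_wpM2l t10 hxy.
have h2 : (1 - t) * dot x x <= (1 - t) * M ^+ 2 by rewrite ler_wpM2l// subr_ge0.
have h3 := ler_wpM2l t0 hy.
lra.
Qed.

Let seg_ball x y (t : R) : B x -> B y -> 0 <= t -> t <= 1 -> B (x + t *: (y - x)).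
Proof.
rewrite /centered_ball /= -!sqr_enorm => Bx By t0 t1.
apply: (@le_trans _ _ (Num.max (enorm x) (enorm y) ^+ 2)).
  by rewrite lerXn2r// ?nnegrE ?enorm_ge0 ?enorm_segment// le_max enorm_ge0.
by rewrite /Num.max; case: ifP.
Qed.

Let mid x y : (x + 2^-1 *: (y - x) : 'rV[R]_n) = 2^-1 *: (x + y).
Proof.
rewrite scalerBr scalerDr addrCA -{1}[x]scale1r -scalerBl addrC; congr (_ *: _ + _).
by field.
Qed.

Let convB x y : B x -> B y -> B (2^-1 *: (x + y)).
Proof.
by move=> Bx By; rewrite -mid; apply: seg_ball => //; rewrite ?invr_ge0// invf_le1// ler1n.
Qed.

Let convV x y : B x -> B y ->
  2 * V (2^-1 *: (x + y)) + k / 4 * dot (x - y) (x - y) <= V x + V y.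
Proof.
move=> Bx By; apply: (@midpoint_strongly_convex _ _ V B) => //.
by move=> t t0 t1; exact: seg_ball.
Qed.

Let mV : measurable_fun setT V.
Proof. exact: measurable_continuous_rV (smooth_continuous sV). Qed.

Let rB : R := 2 * Num.sqrt P.

Let rB0 : 0 <= rB. Proof. by rewrite mulr_ge0// sqrtr_ge0. Qed.

Let rB2 : rB ^+ 2 = 4 * P.
Proof. by rewrite exprMn sqr_sqrtr ?(ltW P0)//; congr (_ * _); rewrite -natrX. Qed.

Local Notation WB := (restricted_gibbs V B).

(** Inside the ball of radius 2 sqrt P the potential is k-convex, and subtracting
    the mean leaves the variance of the restricted measure. *)
Let local_poincare u G : C11 u G ->
  k * (\int[lebesgue_rV n]_x (u x ^+ 2 * WB x) -
       (\int[lebesgue_rV n]_x (u x * WB x)) ^+ 2 / \int[lebesgue_rV n]_x (1 * WB x)) <=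
  \int[lebesgue_rV n]_x (dot (G x) (G x) * WB x).
Proof.
move=> uG.
have [M M0 HM] := continuous_bounded_cube rB (smooth_continuous sV).
have Bcube : B `<=` cube rB by apply: centered_ball_sub_cube => //; rewrite rB2.
have Br x i : B x -> `|x ord0 i| <= rB.
  by move=> /Bcube /(_ i); rewrite in_itv/= -ler_norml.
have VM x : B x -> - M <= V x.
  by move=> /Bcube/HM; rewrite ler_norml => /andP[].
have mB := measurable_centered_ball (4 * P).
have bW := restricted_gibbs_bounded_support mV mB Br VM.
have W0 := restricted_gibbs_ge0 V B.
have bu := C11_bounded_fun uG.
have bu2 : bounded_measurable (fun x => u x ^+ 2) by exact: bounded_measurableX.
have bone := @bounded_measurable_cst _ _ R 1.
set I2 := \int[_]_x _; set I1 := \int[_]_x _; set I0 := \int[_]_x _.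
pose m := I1 / I0.
have I1E : I1 = m * I0.
  have [I00|I00] := eqVneq I0 0; last by rewrite /m divfK.
  rewrite I00 mulr0.
  have [_ [C HC]] := bu.
  have up : I1 <= C * I0.
    rewrite -weightedZ//; apply: le_weighted => //; first exact: bounded_measurableZ.
    by move=> x _; rewrite mulr1 (le_trans (ler_norm _)).
  have lo : - C * I0 <= I1.
    rewrite -weightedZ//; apply: le_weighted => //; first exact: bounded_measurableZ.
    by move=> x _; rewrite mulr1 lerNl (le_trans _ (HC x))// -normrN ler_norm.
  by apply/eqP; rewrite eq_le; move: up lo; rewrite I00 !mulr0 => -> ->.
have vG := C11D uG (C11_cst (- m)).
have := poincare_strongly_convex k0 mV mB Br VM convB convV vG.
have bm := @bounded_measurable_cst _ _ R (- m).
have e1 : \int[lebesgue_rV n]_x ((u x + - m) * WB x) = 0.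
  rewrite weightedD// (_ : \int[_]_x (- m * WB x) = - m * I0); last first.
    rewrite -weightedZ//; apply: eq_Rintegral => x _; by rewrite mulr1.
  by rewrite -/I1 I1E mulNr subrr.
have e2 : \int[lebesgue_rV n]_x ((u x + - m) ^+ 2 * WB x) = I2 - I1 ^+ 2 / I0.
  have -> : \int[lebesgue_rV n]_x ((u x + - m) ^+ 2 * WB x) =
      \int[lebesgue_rV n]_x ((u x ^+ 2 + (- (2 * m) * u x + m ^+ 2 * 1)) * WB x).
    by apply: eq_Rintegral => x _; congr (_ * _); ring.
  rewrite !weightedD//; try (by repeat first [exact: bounded_measurableZ | apply: bounded_measurableD]).
  rewrite !weightedZ// -/I2 -/I1 -/I0 I1E.
  have [->|I00] := eqVneq I0 0; first by rewrite invr0 !mulr0; ring.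
  by field.
move=> /(_ e1); rewrite e2; move/le_trans; apply; rewrite le_eqVlt; apply/orP; left; apply/eqP.
by apply: eq_Rintegral => x _; rewrite addr0.
Qed.

(** Inside, the strongly convex ball controls F up to its gradient and a small
    multiple of its mass outside; outside, the tail inequality controls F up to
    its gradient and a small multiple of its mass inside. *)
Lemma compactly_supported_poincare F G r : C11 F G ->
  (forall x, ~ cube r x -> F x = 0) -> (forall x, ~ cube r x -> G x = 0) ->
  \int[lebesgue_rV n]_x (F x ^+ 2 * expR (- V x)) <=
   (6 / k + 512 / S ^+ 2) * \int[lebesgue_rV n]_x (dot (G x) (G x) * expR (- V x)) +
   3 * ((\int[lebesgue_rV n]_x (F x * radial_cutoff (2 * P) x * expR (- V x))) ^+ 2 /
         \int[lebesgue_rV n]_x (1 * WB x)).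
Proof.
move=> FG F0 G0.
pose q := Num.max r rB.
have q0 : 0 <= q by rewrite le_max rB0 orbT.
have rq : @cube R n r `<=` cube q.
  move=> x xr i; move: (xr i); rewrite !in_itv/= -!ler_norml => /le_trans; apply.
  by rewrite le_max lexx.
have Bq : B `<=` cube q.
  apply: centered_ball_sub_cube => //; rewrite -rB2 lerXn2r// ?nnegrE//.
  by rewrite le_max lexx orbT.
pose W := restricted_gibbs V (@cube R n q).
have [M M0 HM] := continuous_bounded_cube q (smooth_continuous sV).
have bW : bounded_support W.
  apply: (@restricted_gibbs_bounded_support _ _ V _ M q) => //; first exact: measurable_cube.
    by move=> x i /(_ i); rewrite in_itv/= -ler_norml.
  by move=> x /HM; rewrite ler_norml => /andP[].
have W0 : forall x, 0 <= W x by exact: restricted_gibbs_ge0.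
have toW b : (forall x, ~ cube r x -> b x = 0) ->
    \int[lebesgue_rV n]_x (b x * expR (- V x)) = \int[lebesgue_rV n]_x (b x * W x).
  move=> b0; apply: eq_Rintegral => x _; rewrite /W /restricted_gibbs indicE.
  have [xq|xq] := pselect (cube q x); first by rewrite mem_set// mulr1.
  by rewrite b0 ?mul0r// => /rq.
have toWB b : \int[lebesgue_rV n]_x (b x * WB x) =
    \int[lebesgue_rV n]_x ((b x * \1_B x) * W x).
  apply: eq_Rintegral => x _; rewrite /W /restricted_gibbs !indicE.
  have [xB|xB] := pselect (B x); last by rewrite [x \in B]memNset//= !(mulr0, mul0r).
  by rewrite !mem_set ?mulr1//; exact: Bq.
have P20 : 0 < 2 * P by rewrite mulr_gt0.
have c1 := @C11_radial_cutoff R n P P0.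
have c2 := @C11_radial_cutoff R n (2 * P) P20.
pose E := (\int[lebesgue_rV n]_x (F x * radial_cutoff (2 * P) x * expR (- V x))) ^+ 2 /
         \int[lebesgue_rV n]_x (1 * WB x).
rewrite -/E.
have cut2_0 x : ~ B x -> radial_cutoff (2 * P) x = 0.
  move=> xB; rewrite radial_cutoff_outside// mulrA -natrM.
  by rewrite leNgt; apply/negP => /ltW.
(* The inner part v lives in the convex ball, the outer part g where V is radial;
   each gradient produces an error only in the region of the other. *)
pose v x := F x * radial_cutoff (2 * P) x.
pose Gv x := F x *: grad_radial_cutoff (2 * P) x + radial_cutoff (2 * P) x *: G x.
have vC : C11 v Gv by exact: C11M.
have inner := local_poincare vC.
have EE : \int[lebesgue_rV n]_x (v x * WB x) =
    \int[lebesgue_rV n]_x (F x * radial_cutoff (2 * P) x * expR (- V x)).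
  rewrite toW; last by move=> x xr; rewrite F0 ?mul0r.
  rewrite toWB; apply: eq_Rintegral => x _; rewrite indicE.
  have [xB|xB] := pselect (B x); first by rewrite mem_set// mulr1.
  by rewrite /v cut2_0// !(mulr0, mul0r).
rewrite EE -/E in inner.
have tcut := C11D (C11_cst 1) (C11Z (-1) c1).
pose g x := F x * (1 + -1 * radial_cutoff P x).
pose Gg x := F x *: (0 + -1 *: grad_radial_cutoff P x) + (1 + -1 * radial_cutoff P x) *: G x.
have gC : C11 g Gg by exact: C11M.
have bone := @bounded_measurable_cst _ 'rV[R]_n R 1.
pose A := [set x : 'rV[R]_n | dot x x < 2 * P].
have mA : measurable A.
  rewrite (_ : A = (fun x : 'rV[R]_n => dot x x) @^-1` `]-oo, 2 * P[); last first.
    by apply/seteqP; split => x /=; rewrite in_itv.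
  rewrite -[X in measurable X]setTI; exact: measurable_sqr_norm.
have bA : bounded_measurable (\1_A : 'rV[R]_n -> R).
  split; first exact: measurable_indic.
  by exists 1 => x; rewrite indicE; case: (_ \in _); rewrite ?normr1 ?normr0.
have tail : S ^+ 2 * \int[lebesgue_rV n]_x (g x ^+ 2 * W x) <=
    64 * \int[lebesgue_rV n]_x (dot (Gg x) (Gg x) * W x).
  apply: (tail_inequality alpha1 Ra0 sV VE P0 RaP S0 Pn PS gC) => x xh.
    by rewrite /g radial_cutoff_inside ?(ltW xh)// mulr1 subrr mulr0.
  by rewrite /g F0 ?mul0r// => /rq.
pose nA x : R := 1 + -1 * \1_A x.
have bnA : bounded_measurable nA.
  by apply: bounded_measurableD => //; exact: bounded_measurableZ.
have bF2 : bounded_measurable (fun x => F x ^+ 2).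
  by apply: bounded_measurableX; exact: C11_bounded_fun FG.
have bG := C11_bounded_dot FG.
have bFA : bounded_measurable (fun x => F x ^+ 2 * \1_A x) by exact: bounded_measurableM.
have bFnA : bounded_measurable (fun x => F x ^+ 2 * nA x) by exact: bounded_measurableM.
have bB : bounded_measurable (\1_B : 'rV[R]_n -> R).
  split; first by apply: measurable_indic; exact: measurable_centered_ball.
  by exists 1 => x; rewrite indicE; case: (_ \in _); rewrite ?normr1 ?normr0.
rewrite !toW; first last.
- by move=> x xr; rewrite F0// expr0n.
- by move=> x xr; rewrite G0// dot0l.
set J := \int[_]_x (dot _ _ * W x).
pose Bn := \int[lebesgue_rV n]_x (F x ^+ 2 * \1_A x * W x).
pose T := \int[lebesgue_rV n]_x (F x ^+ 2 * nA x * W x).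
have split_I : \int[lebesgue_rV n]_x (F x ^+ 2 * W x) = Bn + T.
  rewrite -weightedD//; apply: eq_Rintegral => x _; congr (_ * _).
  by rewrite /nA; ring.
have A1 x : A x -> \1_A x = 1 :> R by move=> Ax; rewrite indicE mem_set.
have A0 x : ~ A x -> \1_A x = 0 :> R by move=> Ax; rewrite indicE memNset.
have nonA x : ~ A x -> 2 * P <= dot x x by move=> /negP; rewrite -leNgt.
have i1 : Bn <= \int[lebesgue_rV n]_x (v x ^+ 2 * WB x).
  rewrite toWB; apply: le_weighted => //.
    apply: bounded_measurableM => //; apply: bounded_measurableX.
    exact: C11_bounded_fun vC.
  move=> x _; have [Ax|Ax] := pselect (A x); last first.
    by rewrite A0// mulr0 mulr_ge0 ?sqr_ge0.
  rewrite A1// mulr1 /v (radial_cutoff_inside P20) ?mulr1; last by move: Ax; rewrite /A /= => /ltW.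
  rewrite indicE mem_set ?mulr1//.
  by move: Ax; rewrite /A /centered_ball /=; lra.
have E1 (a : R) (X : 'rV[R]_n) : dot (a *: X) (a *: X) = a ^+ 2 * dot X X.
  by rewrite dotZl dotZr mulrA -expr2.
have i2 : \int[lebesgue_rV n]_x (dot (Gv x) (Gv x) * WB x) <= 2 * J + 128 / P * T.
  rewrite toWB -!weightedZ// -weightedD//; try exact: bounded_measurableZ.
  apply: le_weighted => //.
  - by apply: bounded_measurableM => //; exact: C11_bounded_dot vC.
  - by apply: bounded_measurableD; exact: bounded_measurableZ.
    move=> x _; apply: (@le_trans _ _ (dot (Gv x) (Gv x))).
    rewrite ler_piMr ?dot_ge0// indicE; by case: (_ \in _).
  apply: le_trans (dotD_le _ _) _.
  rewrite (E1 (F x)) (E1 (radial_cutoff (2 * P) x)) addrC; apply: lerD.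
    rewrite ler_pM2l// ler_piMl ?dot_ge0// expr_le1 ?radial_cutoff_le1//.
    exact: radial_cutoff_ge0.
  have [Ax|Ax] := pselect (A x).
        rewrite (grad_radial_cutoff_inside P20); last by move: Ax; rewrite /A /= => /ltW.
    by rewrite dot0l !mulr0 /nA A1// mulr1 subrr !mulr0.
  rewrite /nA A0// mulr0 addr0 mulr1.
  have := @sqr_grad_radial_cutoff_le R n (2 * P) P20 x; set d := dot _ _ => h.
  rewrite (_ : 128 / P * _ = 2 * (F x ^+ 2 * (128 / (2 * P)))); last by field; rewrite gt_eqF.
  by rewrite ler_pM2l// ler_wpM2l// sqr_ge0.
have t1 : T <= \int[lebesgue_rV n]_x (g x ^+ 2 * W x).
  apply: le_weighted => //.
    by apply: bounded_measurableX; exact: C11_bounded_fun gC.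
  move=> x _; have [Ax|Ax] := pselect (A x).
    by rewrite /nA A1// mulr1 subrr mulr0 sqr_ge0.
  by rewrite /nA A0// /g radial_cutoff_outside ?nonA// !mulr0 addr0 !mulr1.
have t2 : \int[lebesgue_rV n]_x (dot (Gg x) (Gg x) * W x) <= 2 * J + 256 / P * Bn.
  rewrite -!weightedZ// -weightedD//; try exact: bounded_measurableZ.
  apply: le_weighted => //.
  - exact: C11_bounded_dot gC.
  - by apply: bounded_measurableD; exact: bounded_measurableZ.
  move=> x _; apply: le_trans (dotD_le _ _) _.
  rewrite (E1 (F x)) (E1 (1 + -1 * radial_cutoff P x)) addrC; apply: lerD.
    have h0 := @radial_cutoff_ge0 R n P x; have h1 := @radial_cutoff_le1 R n P x.
    by rewrite ler_pM2l// ler_piMl ?dot_ge0// expr_le1//; lra.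
  rewrite add0r (E1 (-1)) sqrrN expr1n mul1r.
  have [Ax|Ax] := pselect (A x); last first.
    by rewrite grad_radial_cutoff_outside ?nonA// dot0l !mulr0 A0// !mulr0.
  rewrite A1// mulr1.
  have := @sqr_grad_radial_cutoff_le R n P P0 x; set d := dot _ _ => h.
  rewrite (_ : 256 / P * _ = 2 * (F x ^+ 2 * (128 / P))); last by field; rewrite gt_eqF.
  by rewrite ler_pM2l// ler_wpM2l// sqr_ge0.
rewrite split_I.
have Bn0 : 0 <= Bn.
  by apply: weighted_ge0 => // x; rewrite mulr_ge0 ?sqr_ge0// indicE; case: (_ \in _).
have T0 : 0 <= T.
  apply: weighted_ge0 => // x; rewrite mulr_ge0 ?sqr_ge0// /nA indicE.
  by case: (_ \in _); rewrite ?mulr1 ?subrr ?mulr0 ?addr0.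
have J0 : 0 <= J by apply: weighted_ge0 => // x; exact: dot_ge0.
have S20 : 0 < S ^+ 2 by rewrite exprn_gt0.
have bk : 128 / P <= k by rewrite ler_pdivrMr.
have bS : 64 * (256 / P) <= S ^+ 2 / 2.
  have : 64 * 512 / P <= S ^+ 2 by rewrite ler_pdivrMr.
  rewrite (_ : 64 * 512 / P = 2 * (64 * (256 / P))); last by field; rewrite gt_eqF.
  lra.
have r1 : k * Bn <= 2 * J + k * T + k * E.
  have e1 := ler_wpM2r T0 bk.
  have e2 : k * (Bn - E) <= 2 * J + 128 / P * T.
    apply: le_trans i2; apply: le_trans inner; rewrite ler_pM2l//.
    by rewrite lerB.
  by rewrite mulrBr in e2; lra.
have r2 : S ^+ 2 * T <= 128 * J + S ^+ 2 / 2 * Bn.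
  have e1 := ler_wpM2r Bn0 bS.
  have e2 : S ^+ 2 * T <= 64 * (2 * J + 256 / P * Bn).
    apply: (@le_trans _ _ (S ^+ 2 * \int[lebesgue_rV n]_x (g x ^+ 2 * W x))).
      by rewrite ler_pM2l.
    by apply: le_trans tail _; rewrite ler_pM2l.
  lra.
have r1' : Bn <= 2 * J / k + T + E.
  rewrite -(ler_pM2l k0) (_ : k * (_ + _ + E) = 2 * J + k * T + k * E)//.
  by field; rewrite gt_eqF.
have r2' : T <= 128 * J / S ^+ 2 + Bn / 2.
  rewrite -(ler_pM2l S20) (_ : S ^+ 2 * (_ + Bn / 2) = 128 * J + S ^+ 2 / 2 * Bn)//.
  by field; rewrite gt_eqF.
rewrite mulrDl (_ : 6 / k * J = 3 * (2 * J / k)); last by field; rewrite gt_eqF.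
rewrite (_ : 512 / S ^+ 2 * J = 4 * (128 * J / S ^+ 2)); last by field; rewrite gt_eqF.
set a := 2 * J / k in r1' *; set b := 128 * J / S ^+ 2 in r2' *.
lra.
Qed.

End compactly_supported_poincare.

(** * Continuity of translations in L^1 and L^2 *)

Section translation_continuity.
Context {R : realType} {n : nat}.
Local Notation L1 f := ((lebesgue_rV n).-integrable setT (EFin \o f)).
Local Notation I f := (\int[lebesgue_rV n]_x f x).
Implicit Types (f g : 'rV[R]_n -> R) (A : set 'rV[R]_n).

Lemma L1_measurable f : L1 f -> measurable_fun setT f.
Proof. by move=> /measurable_int /measurable_EFinP. Qed.

Lemma L1_translation f z : L1 f -> L1 (fun x => f (x + z)).
Proof.
move=> /[dup] /L1_measurable mf /integrableP[_ lty]; apply/integrableP; split.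
  by apply/measurable_EFinP; apply: measurableT_comp => //; exact: measurable_translate.
rewrite (@ge0_integral_translation _ _ z (fun x => `|(f x)%:E|%E))//.
by apply: measurableT_comp => //; exact/measurable_EFinP.
Qed.

Lemma Rintegral_translation f z : measurable_fun setT f -> I (fun x => f (x + z)) = I f.
Proof.
move=> mf; congr fine; rewrite (@integral_translation _ _ z (fun x => (f x)%:E))//.
exact/measurable_EFinP.
Qed.

Lemma L1D f g : L1 f -> L1 g -> L1 (fun x => f x + g x).
Proof. by move=> hf hg; exact: (integrableD measurableT hf hg). Qed.

Lemma L1B f g : L1 f -> L1 g -> L1 (fun x => f x - g x).
Proof. by move=> hf hg; exact: (integrableB measurableT hf hg). Qed.

Lemma L1Z (a : R) f : L1 f -> L1 (fun x => a * f x).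
Proof. by move=> hf; exact: (integrableZl measurableT a hf). Qed.

Lemma L1_norm f : L1 f -> L1 (fun x => `|f x|).
Proof. by move=> hf; exact: (integrable_norm hf). Qed.

Definition translation_continuous f := forall e : R, 0 < e ->
  exists2 d : R, 0 < d & forall z, cube d z -> I (fun x => `|f (x + z) - f x|) <= e.

Lemma cube_sub (d d' : R) z : d <= d' -> cube d z -> @cube R n d' z.
Proof.
move=> dd zd i; move: (zd i); rewrite !in_itv/= -!ler_norml => h.
exact: le_trans dd.
Qed.

Lemma translation_continuousD f g : L1 f -> L1 g ->
  translation_continuous f -> translation_continuous g ->
  translation_continuous (fun x => f x + g x).
Proof.
move=> hf hg cf cg e e0.
have e20 : 0 < e / 2 by rewrite divr_gt0.
have [d1 d10 H1] := cf _ e20; have [d2 d20 H2] := cg _ e20.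
exists (Num.min d1 d2); first by rewrite lt_min d10.
move=> z zd.
have {}H1 := H1 z (cube_sub _ zd); have {}H2 := H2 z (cube_sub _ zd).
rewrite !ge_min !lexx orbT in H1 H2.
have {}H1 := H1 isT; have {}H2 := H2 isT.
have i1 := L1_norm (L1B (L1_translation z hf) hf).
have i2 := L1_norm (L1B (L1_translation z hg) hg).
rewrite (splitr e); apply: (@le_trans _ _ (I (fun x => `|f (x + z) - f x| + `|g (x + z) - g x|))).
  apply: le_Rintegral => //.
  - exact: (L1_norm (L1B (L1_translation z (L1D hf hg)) (L1D hf hg))).
  - exact: L1D.
  - by move=> x _; rewrite opprD addrACA ler_normD.
by rewrite RintegralD// lerD.
Qed.

Lemma translation_continuousZ (a : R) f : L1 f ->
  translation_continuous f -> translation_continuous (fun x => a * f x).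
Proof.
move=> hf cf e e0.
have a0 : 0 < `|a| + 1 by rewrite ltr_wpDl.
have [d d0 H] := cf _ (divr_gt0 e0 a0); exists d => // z /H {}H.
have i1 := L1_norm (L1B (L1_translation z hf) hf).
have -> : I (fun x => `|a * f (x + z) - a * f x|) = `|a| * I (fun x => `|f (x + z) - f x|).
  by rewrite -RintegralZl//; apply: eq_Rintegral => x _; rewrite -mulrBr normrM.
apply: le_trans (ler_wpM2l (normr_ge0 a) H) _.
by rewrite mulrCA ler_piMr ?(ltW e0)// ler_pdivrMr// mul1r lerDl.
Qed.

(** Approximation in L^1: translating the difference does not change its norm. *)
Lemma translation_continuous_closed f : L1 f ->
  (forall e : R, 0 < e -> exists g,
    [/\ L1 g, translation_continuous g & I (fun x => `|f x - g x|) <= e]) ->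
  translation_continuous f.
Proof.
move=> hf app e e0.
have e30 : 0 < e / 3 by rewrite divr_gt0.
have [g [hg cg fg]] := app _ e30; have [d d0 H] := cg _ e30.
exists d => // z /H {}H.
have i1 := L1_norm (L1B (L1_translation z hg) hg).
have i2 := L1_norm (L1B hf hg).
have i3 := L1_translation z i2.
apply: (@le_trans _ _ (I (fun x => `|f (x + z) - g (x + z)| +
   (`|g (x + z) - g x| + `|f x - g x|)))).
  apply: le_Rintegral => //.
  - exact: (L1_norm (L1B (L1_translation z hf) hf)).
  - by apply: L1D => //; exact: L1D.
  - move=> x _; rewrite (_ : _ - _ = (f (x + z) - g (x + z)) +
      ((g (x + z) - g x) - (f x - g x))); last by ring.
    by rewrite (le_trans (ler_normD _ _))// lerD2l ler_normB.
rewrite RintegralD//; last exact: L1D.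
rewrite RintegralD// (@Rintegral_translation (fun x => `|f x - g x|)); last exact: L1_measurable.
lra.
Qed.

Lemma L1_indic A r : measurable A -> 0 <= r -> A `<=` cube r -> L1 (\1_A : 'rV[R]_n -> R).
Proof.
move=> mA r0 Ar; apply: (@integrable_on_cube _ _ _ 1 r) => //.
- by move=> x; rewrite indicE; case: (_ \in _); rewrite ?normr1 ?normr0.
- move=> x i xi; rewrite indicE memNset// => /Ar /(_ i).
  by rewrite in_itv/= -ler_norml leNgt xi.
Qed.

(** If U is open then, as z tends to 0, the part of U that leaves U under the
    translation by z tends to be empty; it has the same volume as the part that
    enters U. *)
Lemma translation_continuous_open A r : open A -> measurable A -> 0 <= r ->
  A `<=` cube r -> translation_continuous \1_A.
Proof.
move=> oA mA r0 Ar; have hA := L1_indic mA r0 Ar.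
apply: contrapT => /existsNP[e /not_implyP[e0 He]].
have bad (k : nat) : exists z, cube (k.+1%:R^-1) z /\
    e < I (fun x => `|\1_A (x + z) - \1_A x|).
  apply: contrapT => nz; apply: He; exists k.+1%:R^-1; first by rewrite invr_gt0.
  move=> z zk; rewrite leNgt; apply/negP => ez; apply: nz; by exists z.
have [z Hz] := choice bad.
have [||||_] := @dominated_cvg_Rintegral _ _ _ (lebesgue_rV n)
  (fun k x => \1_A x * (1 - \1_A (x + z k))) (cst 0) \1_A.
- move=> k; apply: measurable_funM => //; apply: measurable_funB => //.
  by apply: L1_measurable; exact: L1_translation.
- move=> x; have [xA|xA] := pselect (A x); last first.
    by under eq_fun do rewrite indicE memNset// mul0r; exact: cvg_cst.
  have /nbhs_ballP[d /= d0 dA] := open_nbhs_nbhs (conj oA xA).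
  apply: cvg_near_cst.
  near=> k; rewrite [\1_A (x + _)]indicE mem_set ?subrr ?mulr0//.
  apply: dA; rewrite /ball/=; split => // i j.
  rewrite (ord1 i) /ball/= mxE opprD addrA subrr sub0r normrN.
  have [/(_ j) + _] := Hz k; rewrite in_itv/= -ler_norml => /le_lt_trans; apply.
  by near: k; apply: near_infty_natSinv_lt (PosNum d0).
- exact: hA.
- move=> k x; rewrite !indicE; case: (x \in A); case: (_ \in _);
    by rewrite /= ?(subrr, subr0, mulr0, mul0r, mulr1, normr0, normr1).
rewrite Rintegral_cst// mul0r => /cvgrPdist_lt /(_ (e / 2)).
rewrite divr_gt0// => /(_ isT) [N _ /(_ N (leqnn N))]/=.
rewrite sub0r normrN => small.
have [_] := Hz N; apply/negP; rewrite -leNgt.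
have hz := L1_translation (z N) hA.
have mz := L1_measurable hz.
have hp : L1 (fun x => \1_A x * (1 - \1_A (x + z N))).
  apply: (@le_integrable _ _ _ _ _ measurableT _ (EFin \o \1_A)) => //.
    apply/measurable_EFinP; apply: measurable_funM => //; exact: measurable_funB.
  move=> x _ /=; rewrite lee_fin !indicE; case: (x \in A); case: (_ \in _);
    by rewrite /= ?(subrr, subr0, mulr0, mul0r, mulr1, normr0, normr1).
have -> : I (fun x => `|\1_A (x + z N) - \1_A x|) =
    I (fun x => (\1_A (x + z N) - \1_A x) + 2 * (\1_A x * (1 - \1_A (x + z N)))).
  apply: eq_Rintegral => x _; rewrite !indicE; case: (x \in A); case: (_ \in _);
    rewrite /= ?(subrr, subr0, mulr0, mul0r, mulr1, normr0, normr1, sub0r, normrN, addr0); lra.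
rewrite RintegralD//; [|exact: L1B|exact: L1Z].
rewrite RintegralB// Rintegral_translation; last exact: L1_measurable.
rewrite subrr add0r RintegralZl//.
by have := ler_norm (I (fun x => \1_A x * (1 - \1_A (x + z N)))); lra.
Unshelve. all: by end_near. Qed.

End translation_continuity.

Section L2_translation_continuity.
Context {R : realType} {n : nat}.
Local Notation L1 f := ((lebesgue_rV n).-integrable setT (EFin \o f)).
Implicit Types (f g : 'rV[R]_n -> R) (A : set 'rV[R]_n).

Let open_measurable_sets : set (set 'rV[R]_n) := [set A : set 'rV[R]_n | open A /\ measurable A].

(** The open measurable sets form a pi-system that generates the sigma-algebra,
    so Dynkin's theorem extends the continuity of translations from open sets to
    measurable ones. *)
Let measurable_rV_open : @measurable _ 'rV[R]_n = <<s open_measurable_sets >>.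
Proof.
apply/seteqP; split; last first.
  apply: smallest_sub; first exact: sigma_algebra_measurable.
  by move=> A [].
apply: smallest_sub; first exact: smallest_sigma_algebra.
move=> A; rewrite -bigcup_seq => -[i _ [B mB <-]]; rewrite setTI.
pose F := [set B : set R | <<s open_measurable_sets >> ((fun x : 'rV[R]_n => x ord0 i) @^-1` B)].
have sF : sigma_algebra setT F.
  split.
  - by rewrite /F /= preimage_set0; exact: sigma_algebra0.
  - move=> C; rewrite /F /= setTD => FC.
    rewrite preimage_setC -setTD; exact: sigma_algebraCD.
  - move=> C FC; rewrite /F /= preimage_bigcup; exact: sigma_algebra_bigcup.
suff : @measurable _ (measurableTypeR R) `<=` F by apply.
have E : @measurable _ (measurableTypeR R) = <<s @RGenOInfty.G R >>.
  exact: RGenOInfty.measurableE.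
rewrite E.
apply: smallest_sub => // C [x ->]; apply: sub_sigma_algebra; split.
  apply: open_comp; last exact: interval_open.
  by move=> y _; exact: coord_continuous.
by rewrite -[X in measurable X]setTI; exact: measurable_coord.
Qed.

Let Q (r : R) : set 'rV[R]_n := ball (0 : 'rV[R]_n) r.

Let Q_cube r : Q r `<=` cube r.
Proof.
move=> x [_ xr] i; have := xr ord0 i.
by rewrite /ball/= mxE sub0r normrN in_itv/= -ler_norml => /ltW.
Qed.

Let open_Q r : open (Q r).
Proof. exact: ball_open. Qed.

Let measurable_Q r : 0 < r -> measurable (Q r).
Proof.
move=> r0.
rewrite (_ : Q r = \bigcap_(i in [set: 'I_n])
     ((fun y : 'rV[R]_n => y ord0 i) @^-1` `]- r, r[)); last first.
  apply/seteqP; split => y.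
    move=> [_ h] i _; have := h ord0 i.
    by rewrite /ball/= mxE sub0r normrN in_itv/= -ltr_norml.
  move=> h; split => // a j; rewrite (ord1 a) /ball/= mxE sub0r normrN ltr_norml.
  by have := h j I; rewrite /= in_itv.
apply: fin_bigcap_measurable => // i _.
by rewrite -[X in measurable X]setTI; exact: measurable_coord.
Qed.

Let translation_continuous_measurable A r : 0 < r -> measurable A ->
  translation_continuous (\1_(A `&` Q r) : 'rV[R]_n -> R).
Proof.
move=> r0; have mQ := measurable_Q r0.
have sQ B : B `&` Q r `<=` cube r by move=> x [_ /Q_cube].
have hL B : measurable B -> L1 (\1_(B `&` Q r) : 'rV[R]_n -> R).
  by move=> mB; apply: (L1_indic _ (ltW r0)) => //; exact: measurableI.
rewrite measurable_rV_open; move: A.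
apply: (@dynkin_induction _ _ _ (fun A => translation_continuous (\1_(A `&` Q r) : 'rV[R]_n -> R)) measurable_rV_open).
- by move=> A B [oA mA] [oB mB]; split; [exact: openI|exact: measurableI].
- rewrite /= setTI. exact: (translation_continuous_open (@open_Q r) mQ (ltW r0) (@Q_cube r)).
- move=> A [oA mA]; apply: (@translation_continuous_open _ _ _ r) => //.
  + exact: openI.
  + exact: measurableI.
  + exact: ltW.
- move=> A mA cA.
  rewrite (_ : \1_(~` A `&` Q r) = fun x => \1_(Q r) x + -1 * \1_(A `&` Q r) x); last first.
    apply/funext => x; rewrite !indicE.
    have [xA|xA] := pselect (A x); have [xQ|xQ] := pselect (Q r x).
    + rewrite memNset; last by case.
      by rewrite !mem_set//= mulr1 subrr.
    + by rewrite !memNset//= ?mulr0 ?addr0//; case.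
    + rewrite [x \in ~` A `&` _]mem_set// [x \in Q r]mem_set// memNset ?mulr0 ?addr0//.
      by case.
    + by rewrite !memNset//= ?mulr0 ?addr0//; case.
  have hQ : L1 (\1_(Q r) : 'rV[R]_n -> R).
    by have := hL setT measurableT; rewrite setTI.
  apply: translation_continuousD => //; first by apply: L1Z; exact: hL.
    exact: (translation_continuous_open (@open_Q r) mQ (ltW r0) (@Q_cube r)).
  by apply: translation_continuousZ => //; exact: hL.
- move=> F mF tF cF.
  have mU : measurable (\bigcup_k F k) by exact: bigcupT_measurable.
  pose S k (x : 'rV[R]_n) : R := \sum_(i < k) \1_(F i `&` Q r) x.
  have hS k : L1 (S k) /\ translation_continuous (S k).
    rewrite /S; elim: k => [|k [IH1 IH2]].
      under eq_fun do rewrite big_ord0.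
      split; first exact: integrable0.
      move=> e e0; exists 1 => // z _.
      under eq_Rintegral do rewrite subrr normr0.
      by rewrite Rintegral_cst// mul0r ltW.
    under eq_fun do rewrite big_ord_recr/=.
    split; first by apply: L1D => //; exact: hL.
    by apply: translation_continuousD => //; exact: hL.
  have SU k x : S k x = \1_(\bigcup_(i < k) F i `&` Q r) x.
    have [[i /= ik Fi]|nF] := pselect ((\bigcup_(i < k) F i) x); last first.
      rewrite indicE memNset; last by case.
      rewrite /S big1// => i _; rewrite indicE memNset// => -[Fx _].
      by apply: nF; exists i => /=.
    rewrite /S (bigD1 (Ordinal ik))//= big1 ?addr0; last first.
      move=> j ji; rewrite indicE memNset// => -[Fj _].
      have /trivIsetP/(_ i j I I) := tF.
      have ij : i != j by apply: contra_neq ji => ij; apply: val_inj => /=.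
      by move=> /(_ ij) /seteqP[/(_ x) + _] => /(_ (conj Fi Fj)).
    rewrite !indicE; congr ((nat_of_bool _)%:R); apply/idP/idP; rewrite !inE => -[h1 h2]; split => //.
    by exists i.
  apply: translation_continuous_closed; first exact: hL.
  move=> e e0.
  have [||||_] := @dominated_cvg_Rintegral _ _ _ (lebesgue_rV n)
    (fun k x => `|\1_(\bigcup_k F k `&` Q r) x - S k x|) (cst 0) \1_(Q r).
  + move=> k; apply: L1_measurable; apply: L1_norm; apply: L1B; first exact: hL.
    by case: (hS k).
  + move=> x; have [[i _ Fi]|nF] := pselect ((\bigcup_i F i) x).
      apply: cvg_near_cst; near=> k; rewrite SU.
      rewrite (_ : \1_(\bigcup_(i < k) F i `&` Q r) x = \1_(\bigcup_i F i `&` Q r) x).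
        by rewrite subrr normr0.
      rewrite !indicE; congr ((nat_of_bool _)%:R); apply/idP/idP; rewrite !inE => -[_ h2]; split => //.
        by exists i.
      by exists i => //=; near: k; exact: nbhs_infty_gt.
    apply: cvg_near_cst; near=> k; rewrite SU !indicE !memNset ?subrr ?normr0//;
      by move=> [[i _ Fi] _]; apply: nF; exists i.
  + by have := hL setT measurableT; rewrite setTI.
  + move=> k x; rewrite normr_id SU !indicE.
    have [xQ|xQ] := pselect (Q r x); last first.
      by rewrite !memNset//= ?subrr ?normr0//; case.
    rewrite (mem_set xQ); case: (_ \in _); case: (_ \in _);
      by rewrite /= ?(subrr, subr0, sub0r, normrN, normr0, normr1).
  rewrite Rintegral_cst// mul0r => /cvgrPdist_le /(_ e e0) [N _ /(_ N (leqnn N))]/=.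
  rewrite sub0r normrN => small.
  exists (S N); have [h1 h2] := hS N; split => //.
  by apply: le_trans small; exact: ler_norm.
Unshelve. all: by end_near. Qed.

Import HBSimple.

(** Simple functions are combinations of indicators and approximate f in L^1. *)
Lemma L1_translation_continuous f r : 0 < r -> L1 f ->
  (forall x, ~ Q r x -> f x = 0) -> translation_continuous f.
Proof.
move=> r0 hf f0; apply: translation_continuous_closed => // e e0.
have mQ := measurable_Q r0.
have [g [ig _ gf]] := approximation_sfun_integrable measurableT hf.
have mg k : measurable_fun setT (g k) by [].
have gL k : L1 (fun x => g k x * \1_(Q r) x).
  apply: (le_integrable measurableT _ _ (ig k)).
    apply/measurable_EFinP; apply: measurable_funM => //; exact: measurable_indic.
  move=> x _ /=; rewrite lee_fin normrM indicE.
  by case: (_ \in _); rewrite ?normr1 ?normr0 ?mulr1 ?mulr0.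
have gT k : translation_continuous (fun x => g k x * \1_(Q r) x).
  have E x : g k x * \1_(Q r) x =
      \sum_(y <- finmap.enum_fset (fset_set (range (g k)))) y * \1_(g k @^-1` [set y] `&` Q r) x.
    rewrite {1}fimfunE fsbig_finite//= mulr_suml; apply: eq_bigr => y _.
    by rewrite -mulrA -[\1_(_ `&` _)]/(\1_(_ `&` _)) indicI.
  have hL y : L1 (\1_(g k @^-1` [set y] `&` Q r) : 'rV[R]_n -> R).
    apply: (L1_indic _ (ltW r0)); last by move=> x [_ /Q_cube].
    by apply: measurableI.
  rewrite (funext E); elim: (finmap.enum_fset _) => [|y s IH].
    rewrite (_ : (fun x => _) = cst 0); last by apply/funext => x; rewrite big_nil.
    move=> e1 e10; exists 1 => // z _.
    under eq_Rintegral do rewrite subrr normr0.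
    by rewrite Rintegral_cst// mul0r ltW.
  rewrite (_ : (fun x => _) = fun x => y * \1_(g k @^-1` [set y] `&` Q r) x +
      \sum_(y <- s) y * \1_(g k @^-1` [set y] `&` Q r) x); last first.
    by apply/funext => x; rewrite big_cons.
  apply: translation_continuousD => //.
  - exact: L1Z.
  - have [] := @Rintegral_sum _ _ _ (lebesgue_rV n) R s
      (fun y x => y * \1_(g k @^-1` [set y] `&` Q r) x) => //.
    by move=> y'; exact: L1Z.
  - apply: translation_continuousZ => //.
    by apply: translation_continuous_measurable.
have := gf; move=> /fine_cvgP[_ /cvgrPdist_le /(_ e e0)[N _ /(_ N (leqnn N))]]/=.
rewrite sub0r normrN => small.
exists (fun x => g N x * \1_(Q r) x); split => //.
have iN := L1_norm (L1B hf (ig N)).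
apply: (@le_trans _ _ (\int[lebesgue_rV n]_x `|f x - g N x|)).
  apply: le_Rintegral => //; first exact: (L1_norm (L1B hf (gL N))).
  move=> x _; have [xQ|xQ] := pselect (Q r x).
    by rewrite indicE mem_set// mulr1.
  by rewrite indicE memNset// mulr0 f0// subrr normr0.
by apply: le_trans small; exact: ler_norm.
Qed.

(** Truncation at a high level M reduces L^2 to L^1, since
    (a - b)^2 <= 2 M |a - b| for a and b bounded by M. *)
Lemma L2_translation_continuous f r (e : R) : 0 < r -> measurable_fun setT f ->
  L1 (fun x => f x ^+ 2) -> (forall x, ~ cube r x -> f x = 0) -> 0 < e ->
  exists2 d : R, 0 < d & forall z, cube d z ->
    \int[lebesgue_rV n]_x ((f (x + z) - f x) ^+ 2) <= e.
Proof.
move=> r0 mf f2 f0 e0.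
pose T (M : nat) x : R := f x * \1_[set x | `|f x| <= M%:R] x.
have mT M : measurable_fun setT (T M).
  apply: measurable_funM => //; apply: measurable_indic.
  rewrite (_ : [set x | _] = (fun x => `|f x|) @^-1` `]-oo, M%:R]).
    by rewrite -[X in measurable X]setTI; apply: measurableT_comp.
  by apply/seteqP; split => x /=; rewrite in_itv.
have Tcases M x : (T M x = f x /\ `|f x| <= M%:R) \/ T M x = 0.
  rewrite /T indicE; have [h|h] := pselect (`|f x| <= M%:R).
    by left; rewrite mem_set// mulr1.
  by right; rewrite memNset// mulr0.
have TM M x : `|T M x| <= M%:R.
  by case: (Tcases M x) => [[-> //]|->]; rewrite normr0.
have T0 M x : ~ cube r x -> T M x = 0.
  by move=> /f0 h; rewrite /T h mul0r.
have TL M : L1 (T M).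
  apply: (@integrable_on_cube _ _ _ M%:R r) => //; first exact: ltW.
  move=> x i xi; apply: T0 => /(_ i); rewrite in_itv/= -ler_norml leNgt xi.
  by [].
have dL M : L1 (fun x => (f x - T M x) ^+ 2).
  apply: (le_integrable measurableT _ _ f2).
    by apply/measurable_EFinP; apply: measurable_funX; exact: measurable_funB.
  move=> x _ /=; rewrite lee_fin.
  by case: (Tcases M x) => [[-> _]|->]; rewrite ?subr0// subrr expr0n/= normr0.
have tail : \int[lebesgue_rV n]_x (f x - T M x) ^+ 2 @[M --> \oo] --> (0 : R).
  have [||||_] := @dominated_cvg_Rintegral _ _ _ (lebesgue_rV n)
    (fun M x => (f x - T M x) ^+ 2) (cst 0) (fun x => f x ^+ 2).
  - by move=> M; exact: L1_measurable.
  - move=> x; apply: cvg_near_cst; near=> M.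
    rewrite /T indicE mem_set ?mulr1 ?subrr ?expr0n//=.
    by near: M; exact: nbhs_infty_ger.
  - exact: f2.
  - move=> M x; rewrite ger0_norm ?sqr_ge0//.
    by case: (Tcases M x) => [[-> _]|->]; rewrite ?subr0// subrr expr0n/= sqr_ge0.
  by rewrite Rintegral_cst// mul0r.
have e12 : 0 < e / 12 by rewrite divr_gt0.
move/cvgrPdist_le : tail => /(_ _ e12)[M _ /(_ M (leqnn M))]/=.
rewrite sub0r normrN ger0_norm; last by apply: Rintegral_ge0 => x _; exact: sqr_ge0.
move=> small.
have r20 : 0 < r + 1 by rewrite addr_gt0.
have TQ x : ~ Q (r + 1) x -> T M x = 0.
  move=> xQ; apply: T0 => xr; apply: xQ; split => // i j.
  rewrite (ord1 i) /ball/= mxE sub0r normrN.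
  by have := xr j; rewrite in_itv/= -ler_norml => /le_lt_trans; apply; rewrite ltrDl.
have cT := L1_translation_continuous r20 (TL M) TQ.
pose c : R := 6 * M%:R + 1.
have c0 : 0 < c by rewrite ltr_wpDl// mulr_ge0.
have c20 : 0 < 2 * c by rewrite mulr_gt0.
have [d d0 H] := cT (e / (2 * c)) (divr_gt0 e0 c20).
exists d => // z /H {}H.
have iz := L1_norm (L1B (L1_translation z (TL M)) (TL M)).
have idz := L1_translation z (dL M).
have i2 : L1 (fun x => (f (x + z) - f x) ^+ 2).
  have f2z := L1_translation z f2.
  apply: (le_integrable measurableT _ _ (L1D (L1Z 2 f2z) (L1Z 2 f2))).
    apply/measurable_EFinP; apply: measurable_funX; apply: measurable_funB => //.
    by apply: measurableT_comp => //; exact: measurable_translate.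
  move=> x _ /=; rewrite lee_fin !ger0_norm ?sqr_ge0//; last first.
    by rewrite addr_ge0// mulr_ge0// sqr_ge0.
  by have := sqr_ge0 (f (x + z) + f x); lra.
apply: (@le_trans _ _ (\int[lebesgue_rV n]_x (3 * (f (x + z) - T M (x + z)) ^+ 2 +
   (c * `|T M (x + z) - T M x| + 3 * (f x - T M x) ^+ 2)))).
  apply: le_Rintegral => //.
    by apply: L1D; [exact: L1Z|apply: L1D; exact: L1Z].
  move=> x _; set a := T M (x + z); set b := T M x.
  have h1 : (a - b) ^+ 2 <= 2 * M%:R * `|a - b|.
    rewrite -real_normK ?num_real// expr2 ler_wpM2r//.
    by rewrite (le_trans (ler_normB _ _))//; have := TM M x; have := TM M (x + z); rewrite -/a -/b; lra.
  set p := f (x + z) - a; set q := f x - b.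
  have -> : f (x + z) - f x = p + (a - b) - q by rewrite /p /q; ring.
  have n0 := normr_ge0 (a - b).
  have h2 : (p + (a - b) - q) ^+ 2 <= 3 * p ^+ 2 + 3 * (a - b) ^+ 2 + 3 * q ^+ 2.
    have := sqr_ge0 (p - (a - b)); have := sqr_ge0 (p + q); have := sqr_ge0 (a - b + q); lra.
  have h3 : 3 * (a - b) ^+ 2 <= c * `|a - b| by rewrite /c; lra.
  lra.
rewrite RintegralD//; [|exact: L1Z|by apply: L1D; exact: L1Z].
rewrite RintegralD//; [|exact: L1Z|exact: L1Z].
rewrite !RintegralZl// (@Rintegral_translation _ _ (fun x => (f x - T M x) ^+ 2)); last first.
  exact: L1_measurable.
have : c * \int[lebesgue_rV n]_x `|T M (x + z) - T M x| <= e / 2.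
  apply: le_trans (ler_wpM2l (ltW c0) H) _; rewrite le_eqVlt; apply/orP; left; apply/eqP.
  by field; rewrite gt_eqF.
lra.
Unshelve. all: by end_near. Qed.

End L2_translation_continuity.

(** * Smooth bump functions *)

Section smooth_functions.
Context {R : realType} {n : nat}.
Implicit Types (f g : 'rV[R]_n -> R).

(** The inductive form of smoothness: closure under products follows by induction
    on k, which the list of iterated derivatives does not allow directly. *)
Fixpoint Ck (k : nat) f : Prop := (forall x, differentiable f x) /\
  if k is k'.+1 then forall i, Ck k' (partial i f) else True.

Lemma CkS k f : Ck k.+1 f -> Ck k f.
Proof.
by elim: k f => [|k IH] f [df h]; split => // i; apply: IH; exact: h.
Qed.

Lemma smoothP f : smooth f <-> forall k, Ck k f.
Proof.
split=> [sf k|h s].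
  elim: k f sf => [|k IH] f sf; split => //; try exact: smooth_differentiable.
  by move=> i; apply: IH; exact: smooth_partial.
have {h} : Ck (size s) f by [].
elim/last_ind: s f => [|s i IH] f; first by case.
rewrite size_rcons => -[_ h] x; rewrite -cats1 foldr_cat/=.
by apply: IH; exact: h.
Qed.

Lemma partial_cst (a : R) i : partial i (fun _ : 'rV[R]_n => a) = fun=> 0.
Proof. by apply/funext => x; rewrite /partial derive_cst. Qed.

Lemma Ck_cst k (a : R) : Ck k (fun=> a).
Proof.
elim: k a => [|k IH] a; split => //; try by move=> x; exact: differentiable_cst.
by move=> i; rewrite partial_cst; exact: IH.
Qed.

Lemma CkD k f g : Ck k f -> Ck k g -> Ck k (fun x => f x + g x).
Proof.
elim: k f g => [|k IH] f g [df hf] [dg hg]; split => //.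
- by move=> x; apply: differentiableD.
- by move=> x; apply: differentiableD.
move=> i; rewrite (_ : partial i _ = fun x => partial i f x + partial i g x).
  by apply: IH; [exact: hf|exact: hg].
by apply/funext => x; rewrite /partial deriveD//; exact: diff_derivable.
Qed.

Lemma partialM f g i : (forall x, differentiable f x) -> (forall x, differentiable g x) ->
  partial i (fun x => f x * g x) = fun x => f x * partial i g x + g x * partial i f x.
Proof.
move=> df dg; apply/funext => x.
by rewrite /partial deriveM//; exact: diff_derivable.
Qed.

Lemma CkM k f g : Ck k f -> Ck k g -> Ck k (fun x => f x * g x).
Proof.
elim: k f g => [|k IH] f g Cf Cg; have [df hf] := Cf; have [dg hg] := Cg.
  by split => // x; exact: differentiableM.
split; first by move=> x; exact: differentiableM.
move=> i; rewrite partialM//; apply: CkD.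
  by apply: IH; [exact: CkS Cf|exact: hg].
by apply: IH; [exact: CkS Cg|exact: hf].
Qed.

Lemma Ck_prod k (I : Type) (s : seq I) (F : I -> 'rV[R]_n -> R) :
  (forall i, Ck k (F i)) -> Ck k (fun x => \prod_(i <- s) F i x).
Proof.
move=> hF; elim: s => [|i s IH].
  by under eq_fun do rewrite big_nil; exact: Ck_cst.
rewrite (_ : (fun x => _) = fun x => F i x * \prod_(i <- s) F i x); first exact: (CkM (hF i) IH).
by apply/funext => x; rewrite big_cons.
Qed.

(** A whole sequence h of successive derivatives is needed for the induction. *)
Lemma Ck_coord k (h : nat -> R -> R) (i : 'I_n) j :
  (forall j t, is_derive t (1 : R) (h j) (h j.+1 t)) -> Ck k (fun x => h j (x ord0 i)).
Proof.
move=> dh.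
have dc j' x : differentiable (fun x : 'rV[R]_n => h j' (x ord0 i)) x.
  apply: (@differentiable_comp _ _ _ _ (fun x : 'rV[R]_n => x ord0 i) (h j')).
    exact: differentiable_coord.
  by apply/derivable1_diffP; case: (dh j' (x ord0 i)).
elim: k j => [|k IH] j; split => // l.
have -> : partial l (fun x => h j (x ord0 i)) =
    fun x => ((l == i)%:R : R) * h j.+1 (x ord0 i).
  apply/funext => x.
  have := @is_derive_line _ _ (fun x => h j (x ord0 i)) x (delta_mx ord0 l) 0 (dc _ _).
  rewrite scale0r addr0 => d1.
  have d2 : is_derive (0 : R) (1 : R) (fun t : R => x ord0 i + t * (i == l)%:R) ((i == l)%:R).
    by apply: is_derive_eq; rewrite /GRing.scale/=; ring.
  have d3 : is_derive (x ord0 i + 0 * (i == l)%:R) (1 : R) (h j) (h j.+1 (x ord0 i)).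
    by rewrite mul0r addr0.
  have := @is_derive1_comp _ (h j) (fun t : R => x ord0 i + t * (i == l)%:R) 0 _ _ d3 d2.
  rewrite (_ : _ \o _ = fun s : R => h j ((x + s *: delta_mx ord0 l) ord0 i)); last first.
    by apply/funext => s /=; rewrite !mxE eqxx.
  move=> d4; rewrite /partial -(@derive_val _ _ _ _ _ _ _ d1) (@derive_val _ _ _ _ _ _ _ d4).
  by rewrite mulrC eq_sym.
by apply: CkM; [exact: Ck_cst|exact: IH].
Qed.

Lemma partial_translation f (a : 'rV[R]_n) i :
  partial i (fun y => f (y + a)) = fun y => partial i f (y + a).
Proof.
apply/funext => y; rewrite /partial /derive.
suff -> : (fun h : R => h^-1 *: (((fun y => f (y + a)) \o shift y) (h *: delta_mx ord0 i) - f (y + a))) =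
    (fun h : R => h^-1 *: ((f \o shift (y + a)) (h *: delta_mx ord0 i) - f (y + a))) by [].
by apply/funext => h /=; rewrite addrA.
Qed.

Lemma differentiable_translation f (a : 'rV[R]_n) : (forall x, differentiable f x) ->
  forall x, differentiable (fun y => f (y + a)) x.
Proof.
by move=> df x; apply: (@differentiable_comp _ _ _ _ (fun y => y + a) f).
Qed.

Lemma Ck_translation k f (a : 'rV[R]_n) : Ck k f -> Ck k (fun y => f (y + a)).
Proof.
elim: k f => [|k IH] f [df hf].
  by split => //; exact: differentiable_translation.
have dt := differentiable_translation a df.
split; first exact: dt.
by move=> i; rewrite partial_translation; exact: IH (hf i).
Qed.

End smooth_functions.

Section flat_exponential.
Context {R : realType}.
Implicit Types p : {poly R}.

(** The functions p(1/t) e^{-1/t}, extended by 0, form a class that is closed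
    under differentiation; this makes e^{-1/t} smooth at 0. *)
Definition flat_exp p (t : R) : R := if 0 < t then p.[t^-1] * expR (- t^-1) else 0.
Definition flat_exp_deriv p : {poly R} := 'X^2 * (p - p^`()).

(** One factor of s comes from the difference quotient at 0, a second one makes
    it tend to 0. *)
Let poly_exp_bound p : exists2 C : R, 0 <= C & forall s, 0 < s ->
  `|p.[s]| * expR (- s) <= C * (s ^+ 2)^-1.
Proof.
exists (\sum_(i < size p) `|p`_i| * (i.+2)`!%:R).
  by apply: sumr_ge0 => i _; rewrite mulr_ge0.
move=> s s0; rewrite expRN ler_pdivrMr ?expR_gt0// mulrAC ler_pdivlMr ?exprn_gt0//.
rewrite mulr_suml horner_coef.
apply: le_trans (ler_wpM2r (sqr_ge0 s) (ler_norm_sum _ _ _)) _.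
rewrite mulr_suml; apply: ler_sum => i _.
rewrite normrM -!mulrA ler_wpM2l// normrX gtr0_norm// -exprD addn2.
have := expR_ge1Dxn i.+1 (ltW s0); have := fact_gt0 i.+2.
rewrite -(ltr0n R) => f0 h.
rewrite -ler_pdivrMl// mulrC; apply: le_trans h; by rewrite lerDr.
Qed.

Lemma is_derive_flat_exp p (t : R) :
  is_derive t (1 : R) (flat_exp p) (flat_exp (flat_exp_deriv p) t).
Proof.
have [t0|t0|<-] := ltgtP 0 t.
- have dinv : is_derive t (1 : R) (fun s : R => s^-1) (- t ^- 2).
    have := @is_deriveV R id t 1 1 (lt0r_neq0 t0) (is_derive_id _ _).
    by rewrite [_ *: 1]mulr1.
  have dp : is_derive t (1 : R) (horner p \o (fun s : R => s^-1)) (p^`().[t^-1] * (- t ^- 2)).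
    exact: is_derive1_comp.
  have de : is_derive t (1 : R) (expR \o (fun s : R => - s^-1)) (expR (- t^-1) * (- - t ^- 2)).
    exact: is_derive1_comp.
  have : is_derive t (1 : R) ((horner p \o (fun s : R => s^-1)) * (expR \o (fun s : R => - s^-1)))
      (flat_exp (flat_exp_deriv p) t).
    apply: is_derive_eq.
    rewrite /GRing.scale/= /flat_exp t0 /flat_exp_deriv hornerM hornerXn hornerD hornerN exprVn.
    ring.
  apply: near_eq_is_derive; near=> s.
  rewrite /flat_exp ifT//; near: s; exact: lt_nbhsr.
- have -> : flat_exp (flat_exp_deriv p) t = 0 by rewrite /flat_exp ltNge (ltW t0).
  apply: near_eq_is_derive (is_derive_cst (0 : R) t 1).
  near=> s; rewrite /flat_exp ifF//; apply/negbTE; rewrite -leNgt; apply: ltW.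
  by near: s; exact: lt_nbhsl.
- have -> : flat_exp (flat_exp_deriv p) 0 = 0 by rewrite /flat_exp ltxx.
  have [C C0 HC] := poly_exp_bound p.
  pose w (h : R) := h^-1 *: ((flat_exp p \o shift 0) (h *: 1) - flat_exp p 0).
  have cw : w h @[h --> 0^'] --> (0 : R).
    apply/cvgrPdist_le => e e0; near=> h.
    have h0 : h != 0 by near: h; exact: nbhs_dnbhs_neq.
    rewrite sub0r normrN /w /= addr0 [h *: 1]mulr1 [flat_exp p 0]/flat_exp ltxx subr0.
    rewrite /GRing.scale/= /flat_exp; case: ifPn => hp; last by rewrite mulr0 normr0 ltW.
    have ih : 0 < h^-1 by rewrite invr_gt0.
    have := HC _ ih; rewrite exprVn invrK => hc.
    rewrite normrM (gtr0_norm ih) normrM (ger0_norm (expR_ge0 _)) ler_pdivrMl//.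
    apply: le_trans hc _; rewrite expr2 mulrCA ler_pM2l//.
    have hC : `|h| <= e / (C + 1).
      near: h; apply: dnbhs0_le; rewrite divr_gt0// ltr_wpDl//.
    rewrite gtr0_norm// ler_pdivlMr ?ltr_wpDl// mulrDr mulr1 in hC.
    by rewrite mulrC; apply: le_trans hC; rewrite lerDl ltW.
  by apply: DeriveDef; [exact: cvgP cw|apply/cvg_lim => //; exact: cw].
Unshelve. all: by end_near. Qed.

Lemma flat_exp1_ge0 t : 0 <= flat_exp 1 t.
Proof. by rewrite /flat_exp; case: ifP => // _; rewrite hornerC mul1r expR_ge0. Qed.

Lemma flat_exp1_le1 t : flat_exp 1 t <= 1.
Proof.
rewrite /flat_exp; case: ifP => [t0|_]; last exact: ler01.
by rewrite hornerC mul1r -expR0 ler_expR oppr_le0 invr_ge0 ltW.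
Qed.

Lemma flat_exp1_le0 t : t <= 0 -> flat_exp 1 t = 0.
Proof. by move=> t0; rewrite /flat_exp ltNge t0. Qed.

Lemma flat_exp1_lower t : 1 / 2 <= t -> expR (- 2) <= flat_exp 1 t.
Proof.
move=> t2; have t0 : 0 < t by apply: lt_le_trans t2; rewrite divr_gt0.
rewrite /flat_exp t0 hornerC mul1r ler_expR lerN2.
by rewrite -[leRHS]invrK lef_pV2 ?posrE// -div1r.
Qed.

End flat_exponential.

Section bump.
Context {R : realType} {n : nat}.

Definition bump (e : R) (x : 'rV[R]_n) : R :=
  \prod_(i < n) (flat_exp 1 (1 + x ord0 i / e) * flat_exp 1 (1 - x ord0 i / e)).

Lemma smooth_bump e : smooth (bump e).
Proof.
apply/smoothP => k; apply: Ck_prod => i.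
have d (c s : R) j : Ck k (fun x : 'rV[R]_n =>
    s ^+ j * flat_exp (iter j (@flat_exp_deriv R) 1) (c + s * x ord0 i)).
  apply: (@Ck_coord _ _ _ (fun j (t : R) =>
    s ^+ j * flat_exp (iter j (@flat_exp_deriv R) 1) (c + s * t))) => {}j t.
  have d1 : is_derive t (1 : R) (fun t : R => c + s * t) s.
    by apply: is_derive_eq; rewrite /GRing.scale/=; ring.
  have d2 := is_derive_flat_exp (iter j (@flat_exp_deriv R) 1) (c + s * t).
  have d3 := @is_derive1_comp _ (flat_exp (iter j (@flat_exp_deriv R) 1))
    (fun t : R => c + s * t) t _ _ d2 d1.
  have d4 := is_deriveZ (s ^+ j) d3.
  apply: (is_derive_eq d4); rewrite /GRing.scale/= exprS; ring.
apply: CkM.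
- have := d 1 e^-1 0%N; rewrite (_ : (fun x => _) = fun x : 'rV[R]_n => flat_exp 1 (1 + x ord0 i / e))//.
  by apply/funext => x; rewrite expr0 mul1r mulrC.
- have := d 1 (- e^-1) 0%N; rewrite (_ : (fun x => _) = fun x : 'rV[R]_n => flat_exp 1 (1 - x ord0 i / e))//.
  by apply/funext => x; rewrite expr0 mul1r mulNr mulrC.
Qed.

Lemma bump_ge0 e x : 0 <= bump e x.
Proof. by apply: prodr_ge0 => i _; rewrite mulr_ge0 ?flat_exp1_ge0. Qed.

Lemma bump_support e x : 0 < e -> ~ cube e x -> bump e x = 0.
Proof.
move=> e0 /existsNP[i /negP xi]; rewrite /bump (bigD1 i)//=.
have [h|h] : 1 + x ord0 i / e <= 0 \/ 1 - x ord0 i / e <= 0.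
- move: xi; rewrite in_itv/= negb_and -!ltNge => /orP[h|h]; [left|right].
    by rewrite -lerBrDl sub0r ler_pdivrMr// mulN1r ltW.
  by rewrite subr_le0 ler_pdivlMr// mul1r ltW.
- by rewrite [flat_exp 1 (1 + _)]flat_exp1_le0// !mul0r.
- by rewrite [flat_exp 1 (1 - _)]flat_exp1_le0// mulr0 mul0r.
Qed.

Lemma bump_lower e x : 0 < e -> cube (e / 2) x -> (expR (- 2) * expR (- 2)) ^+ n <= bump e x.
Proof.
move=> e0 xe; rewrite -{1}(card_ord n) -prodr_const; apply: ler_prod => i _.
rewrite mulr_ge0 ?expR_ge0//= ler_pM ?expR_ge0//; apply: flat_exp1_lower.
  move: (xe i); rewrite in_itv/= => /andP[h _].
  by rewrite -lerBlDl ler_pdivlMr//; lra.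
move: (xe i); rewrite in_itv/= => /andP[_ h].
by rewrite lerBrDr -lerBrDl ler_pdivrMr//; lra.
Qed.

Lemma cube_enorm (r : R) (x : 'rV[R]_n) : 0 <= r -> cube r x -> dot x x <= n%:R * r ^+ 2.
Proof.
move=> r0 xr; have -> : n%:R * r ^+ 2 = \sum_(i < n) r ^+ 2 by rewrite sumr_const card_ord mulr_natl.
apply: ler_sum => i _; rewrite -expr2.
have := xr i; rewrite in_itv/= -ler_norml => h.
by rewrite -[leLHS]real_normK ?num_real// lerXn2r// nnegrE.
Qed.

Lemma test_function_cube f (r : R) : 0 <= r -> smooth f ->
  (forall x : 'rV[R]_n, ~ cube r x -> f x = 0) -> test_function f.
Proof.
move=> r0 sf f0; split => //; exists (Num.sqrt (n%:R * r ^+ 2) + 1) => x xr.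
apply: f0 => /(cube_enorm r0) h.
have : enorm x <= Num.sqrt (n%:R * r ^+ 2) by rewrite ler_wsqrtr.
lra.
Qed.

End bump.

(** * Test functions *)

Section test_functions.
Context {R : realType} {n : nat}.
Implicit Types (f phi : 'rV[R]_n -> R) (x h : 'rV[R]_n).

Definition gradient f x : 'rV[R]_n := \row_i partial i f x.

Lemma gradientE f x i : gradient f x ord0 i = partial i f x.
Proof. by rewrite mxE. Qed.

Lemma smoothM f g : smooth f -> smooth g -> smooth (fun x => f x * g x).
Proof. by move=> /smoothP sf /smoothP sg; apply/smoothP => k; exact: CkM. Qed.

Lemma smooth_translation f (a : 'rV[R]_n) : smooth f -> smooth (fun x => f (x + a)).
Proof. by move=> /smoothP sf; apply/smoothP => k; exact: Ck_translation. Qed.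

Lemma test_function_smooth phi : test_function phi -> smooth phi.
Proof. by case. Qed.

Lemma test_function_support phi : test_function phi ->
  exists2 r : R, 0 < r & forall x, ~ cube r x -> phi x = 0.
Proof.
move=> [_ [r h]]; exists (Num.max r 1); first by rewrite lt_max ltr01 orbT.
move=> x /existsNP[i /negP xi]; apply: h.
apply: le_trans (coord_le_enorm x i).
by move: xi; rewrite in_itv/= -ler_norml -ltNge gt_max => /andP[/ltW].
Qed.

Lemma test_functionM f phi : smooth f -> test_function phi ->
  test_function (fun x => f x * phi x).
Proof.
move=> sf [sp [r h]]; split; first exact: smoothM.
by exists r => x xr; rewrite h// mulr0.
Qed.

Lemma test_function_translation phi (a : 'rV[R]_n) : test_function phi ->
  test_function (fun x => phi (x + a)).
Proof.
move=> tp; have [r r0 h] := test_function_support tp; case: tp => sp _.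
have s0 : 0 <= \sum_i `|a ord0 i| by exact: sumr_ge0.
apply: (@test_function_cube _ _ _ (r + \sum_i `|a ord0 i|)).
- by rewrite addr_ge0// ltW.
- exact: smooth_translation.
move=> x xr; apply: h; apply: contra_not xr => xr i.
have := xr i; rewrite !in_itv/= -!ler_norml !mxE => xi.
have -> : x ord0 i = x ord0 i + a ord0 i - a ord0 i by rewrite addrK.
apply: le_trans (ler_normB _ _) _; apply: lerD => //.
by rewrite (bigD1 i)//= lerDl sumr_ge0.
Qed.

Lemma partial_support f (r : R) i : (forall x, ~ cube r x -> f x = 0) ->
  forall x, ~ cube r x -> partial i f x = 0.
Proof.
move=> f0 x /existsNP[j /negP xj].
have {}xj : r < `|x ord0 j| by move: xj; rewrite in_itv/= -ler_norml -ltNge.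
rewrite /partial -(@derive_cst R 'rV[R]_n R 0 x (delta_mx ord0 i)).
apply: near_eq_derive.
have c := cvg_norm (@coord_continuous R 1 n ord0 j x).
near=> y; apply: f0 => /(_ j); rewrite in_itv/= -ler_norml; apply/negP; rewrite -ltNge.
near: y; exact: (cvgr_gt _ (c _) _ xj).
Unshelve. all: by end_near. Qed.

Lemma test_function_partial phi i : test_function phi -> test_function (partial i phi).
Proof.
move=> tp; have [r r0 h] := test_function_support tp.
apply: (test_function_cube (ltW r0)); last exact: partial_support.
exact/smooth_partial/test_function_smooth.
Qed.

Lemma test_function_bounded phi : test_function phi ->
  exists2 M, 0 <= M & forall x, `|phi x| <= M.
Proof.
move=> tp; have [r r0 h] := test_function_support tp.
have [M M0 HM] := continuous_bounded_cube r (smooth_continuous (test_function_smooth tp)).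
exists M => // x; have [xr|xr] := pselect (cube r x); first exact: HM.
by rewrite h// normr0.
Qed.

Lemma test_function_measurable phi : test_function phi -> measurable_fun setT phi.
Proof. by move=> /test_function_smooth/smooth_continuous; exact: measurable_continuous_rV. Qed.

Lemma test_function_bounded_measurable phi : test_function phi -> bounded_measurable phi.
Proof.
move=> tp; split; first exact: test_function_measurable.
by have [M _ HM] := test_function_bounded tp; exists M.
Qed.

Lemma common_bound (I : eqType) (s : seq I) (F : I -> R -> Prop) :
  (forall i M M', M <= M' -> F i M -> F i M') -> (forall i, exists M, F i M) ->
  exists2 M, 0 <= M & forall i, i \in s -> F i M.
Proof.
move=> mono ex; elim: s => [|i s [M M0 HM]]; first by exists 0.
have [N HN] := ex i; exists (Num.max M N); first by rewrite le_max M0.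
move=> j; rewrite in_cons => /predU1P[->|js]; first by apply: mono HN; rewrite le_max lexx orbT.
by apply: mono (HM _ js); rewrite le_max lexx.
Qed.

(** The second partial derivatives are continuous with compact support, hence
    bounded; Taylor's formula is the mean value theorem applied twice along the
    segment. *)
Lemma test_function_C11 phi : test_function phi -> C11 phi (gradient phi).
Proof.
move=> tp; have sp := test_function_smooth tp.
have [M0 M00 H0] := test_function_bounded tp.
have [M1 M10 H1] : exists2 M, 0 <= M & forall i x, `|partial i phi x| <= M.
  have [|i|M M_ge0 HM] := @common_bound _ (enum 'I_n) (fun i M => forall x, `|partial i phi x| <= M).
  - by move=> i M M' MM' h x; exact: le_trans MM'.
  - by have [M _ h] := test_function_bounded (test_function_partial i tp); exists M.
  - by exists M => // i; apply: HM; rewrite mem_enum.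
have [M2 M20 H2] : exists2 M, 0 <= M & forall i j x, `|partial i (partial j phi) x| <= M.
  have [|i|M M_ge0 HM] := @common_bound _ (enum [set: 'I_n * 'I_n])
     (fun ij M => forall x, `|partial ij.1 (partial ij.2 phi) x| <= M).
  - by move=> i M M' MM' h x; exact: le_trans MM'.
  - have [M _ h] := test_function_bounded (test_function_partial i.1 (test_function_partial i.2 tp)).
    by exists M.
  - by exists M => // i j; apply: (HM (i, j)); rewrite mem_enum inE.
split.
- exact: test_function_measurable.
- move=> i; under eq_fun do rewrite gradientE.
  exact: test_function_measurable (test_function_partial i tp).
have p1 : 0 <= n%:R * M1 ^+ 2 by apply: mulr_ge0 => //; exact: sqr_ge0.
have p2 : 0 <= n%:R * M2 by exact: mulr_ge0.
exists (M0 + n%:R * M1 ^+ 2 + n%:R * M2) => [|x]; first by lra.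
split.
- by apply: le_trans (H0 x) _; lra.
- apply: (@le_trans _ _ (n%:R * M1 ^+ 2)); last by lra.
  apply: cube_enorm => // i; rewrite gradientE in_itv/= -ler_norml; exact: H1.
move=> h.
have Q (y : 'rV[R]_n) : `|(h *m hessian phi y *m h^T) ord0 ord0| <= n%:R * M2 * dot h h.
  have -> : (h *m hessian phi y *m h^T) ord0 ord0 =
      \sum_j \sum_i h ord0 i * h ord0 j * partial i (partial j phi) y.
    rewrite mxE; apply: eq_bigr => j _; rewrite !mxE mulr_suml; apply: eq_bigr => i _.
    by rewrite mxE mulrAC.
  apply: le_trans (ler_norm_sum _ _ _) _.
  apply: (@le_trans _ _ (\sum_(j < n) \sum_(i < n) M2 * ((h ord0 i ^+ 2 + h ord0 j ^+ 2) / 2))).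
    apply: ler_sum => j _; apply: le_trans (ler_norm_sum _ _ _) _; apply: ler_sum => i _.
    rewrite normrM mulrC ler_pM// normrM.
    have := sqr_ge0 (`|h ord0 i| - `|h ord0 j|).
    rewrite sqrrB !real_normK ?num_real// mulr2n; lra.
  have -> : \sum_(j < n) \sum_(i < n) M2 * ((h ord0 i ^+ 2 + h ord0 j ^+ 2) / 2) = n%:R * M2 * dot h h.
    have E : dot h h = \sum_i h ord0 i ^+ 2 by apply: eq_bigr => i _; rewrite expr2.
    have E2 (j : 'I_n) : \sum_(i < n) M2 * ((h ord0 i ^+ 2 + h ord0 j ^+ 2) / 2) =
        M2 / 2 * dot h h + (M2 / 2 * n%:R) * (h ord0 j ^+ 2).
      have -> : M2 / 2 * n%:R * h ord0 j ^+ 2 = \sum_(i < n) M2 / 2 * h ord0 j ^+ 2.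
        by rewrite sumr_const card_ord -[RHS]mulr_natr mulrAC.
      rewrite E mulr_sumr -big_split/=.
      by apply: eq_bigr => i _; field.
    under eq_bigr => j _ do rewrite E2.
    rewrite big_split/= sumr_const card_ord -mulr_sumr -E -[X in X + _]mulr_natr.
    by field.
  by [].
pose g (t : R) := phi (x + t *: h).
pose g' (t : R) := 'D_h phi (x + t *: h).
have d1 (t : R) : is_derive t (1 : R) g (g' t).
  exact: is_derive_line (smooth_differentiable sp _).
have d2 (t : R) : is_derive t (1 : R) g' ((h *m hessian phi (x + t *: h) *m h^T) ord0 ord0).
  exact: is_derive2_line.
have cont (u u' : R -> R) : (forall t, is_derive t (1 : R) u (u' t)) ->
    forall a b : R, {within `[a, b], continuous u}.
  move=> dg a b; apply: continuous_subspaceT => t.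
  by apply: differentiable_continuous; apply/derivable1_diffP; case: (dg t).
have [a] := MVT (@ltr01 R) (fun t _ => d1 t) (cont _ _ d1 _ _).
rewrite in_itv/= => /andP[a0 a1] Ea.
have [b] := MVT a0 (fun t _ => d2 t) (cont _ _ d2 _ _).
rewrite in_itv/= => /andP[b0 b1] Eb.
have -> : phi (x + h) = g 1 by rewrite /g scale1r.
have -> : phi x = g 0 by rewrite /g scale0r addr0.
have -> : dot (gradient phi x) h = g' 0.
  rewrite /g' scale0r addr0 derive_partial; last exact: smooth_differentiable.
  by rewrite /dot; apply: eq_bigr => i _; rewrite gradientE mulrC.
rewrite Ea subr0 mulr1 Eb subr0 normrM (gtr0_norm a0).
have := Q (x + b *: h); have := dot_ge0 h; set q := `|_| => h0 hq.
have q0 : 0 <= q by exact: normr_ge0.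
apply: (@le_trans _ _ q); first by rewrite ler_piMr// ltW.
by apply: le_trans hq _; rewrite ler_wpM2r//; lra.
Qed.

Lemma bump_le1 (e : R) x : bump e x <= 1.
Proof.
apply: prodr_ile1 => i _; rewrite mulr_ge0 ?flat_exp1_ge0//=.
by apply: mulr_ile1; rewrite ?flat_exp1_ge0 ?flat_exp1_le1.
Qed.

Lemma test_function_bump (e : R) : 0 < e -> test_function (@bump R n e).
Proof.
move=> e0; apply: (@test_function_cube _ _ _ e); first exact: ltW.
  exact: smooth_bump.
by move=> x; exact: bump_support.
Qed.

Lemma partial_scaling f (a : R) i : (forall x, differentiable f x) ->
  partial i (fun x => f (a *: x)) = fun x => a * partial i f (a *: x).
Proof.
move=> df; apply/funext => x.
have dl : is_derive (0 : R) (1 : R) (fun s : R => f (a *: x + s *: (a *: delta_mx ord0 i)))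
    ('D_(a *: delta_mx ord0 i) f (a *: x + 0 *: (a *: delta_mx ord0 i))).
  exact: is_derive_line.
have ds : differentiable (fun x => f (a *: x)) (x + 0 *: delta_mx ord0 i).
  by apply: (@differentiable_comp _ _ _ _ (fun x => a *: x) f).
have dr := is_derive_line ds.
rewrite /partial -[x in LHS]addr0 -[in LHS](scale0r (delta_mx ord0 i : 'rV[R]_n)).
rewrite -(@derive_val _ _ _ _ _ _ _ dr).
rewrite (_ : (fun s : R => _) = fun s : R => f (a *: x + s *: (a *: delta_mx ord0 i))); last first.
  by apply/funext => s; rewrite scalerDr !scalerA (mulrC a).
rewrite (@derive_val _ _ _ _ _ _ _ dl) scale0r addr0.
by rewrite !deriveE//= linearZ.
Qed.

End test_functions.

(** * The Hilbert space L^2 of a probability measure *)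

Section quadratic_discriminant.
Context {R : realType}.

Lemma discriminant_le0 (A B C : R) : (forall t, 0 <= A + 2 * t * B + t ^+ 2 * C) ->
  B ^+ 2 <= A * C.
Proof.
move=> h.
have [C0|C0] := eqVneq C 0.
  have [->|B0] := eqVneq B 0; first by rewrite C0 mulr0 expr0n.
  have := h (- (A + 1) / (2 * B)); rewrite C0 mulr0 addr0.
  have -> : A + 2 * (- (A + 1) / (2 * B)) * B = - 1 by field.
  by rewrite ler0N1.
have := h (- B / C).
have -> : A + 2 * (- B / C) * B + (- B / C) ^+ 2 * C = A - B ^+ 2 / C by field.
rewrite subr_ge0 => hB.
have Cp : 0 < C.
  rewrite lt_neqAle eq_sym C0/= leNgt; apply/negP => Cn.
  pose t := (`|A| + 2 * `|B| + 1) / (- C) + 1.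
  have Cn' : 0 < - C by rewrite oppr_gt0.
  have a0 := normr_ge0 A; have b0 := normr_ge0 B.
  have aA := ler_norm A; have bB := ler_norm B.
  have t1 : 1 <= t by rewrite /t lerDr divr_ge0 ?(ltW Cn')//; lra.
  have tC : t * (- C) = `|A| + 2 * `|B| + 1 - C by rewrite /t; field.
  have := h t.
  have -> : A + 2 * t * B + t ^+ 2 * C = A + t * (2 * B - t * (- C)) by ring.
  rewrite tC.
  have : t * (2 * B - (`|A| + 2 * `|B| + 1 - C)) <= 1 * (2 * B - (`|A| + 2 * `|B| + 1 - C)).
    by apply: ler_wnM2r => //; lra.
  lra.
by rewrite -ler_pdivrMr.
Qed.

End quadratic_discriminant.

Section L2_space.
Context d (T : measurableType d) {R : realType} (P : probability T R).
Implicit Types f g h : T -> R.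

Definition L2 f := measurable_fun setT f /\
  P.-integrable setT (EFin \o (fun x => f x ^+ 2)).

Definition ip f g : R := \int[P]_x (f x * g x).

Lemma Lfun2P f : f \in Lfun P 2%:E <-> L2 f.
Proof.
split=> [h|[mf h]].
  split; last exact: Lfun2_integrable_sqr.
  by move: h; rewrite inE => /andP[]; rewrite inE.
rewrite inE; apply/andP; split; first by rewrite inE.
rewrite inE/= /finite_norm unlock /Lnorm.
apply: poweR_lty.
under eq_integral => x _ do rewrite /= powR_mulrn// real_normK ?num_real//.
exact: (integrable_lty measurableT h).
Qed.

Lemma integrable_dominated f g : measurable_fun setT f ->
  P.-integrable setT (EFin \o g) -> (forall x, `|f x| <= g x) ->
  P.-integrable setT (EFin \o f).
Proof.
move=> mf ig fg; apply: (le_integrable measurableT _ _ ig).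
  exact/measurable_EFinP.
by move=> x _ /=; rewrite lee_fin (le_trans (fg x))// ler_norm.
Qed.

Lemma sqr_add_le (a b : R) : (a + b) ^+ 2 <= 2 * a ^+ 2 + 2 * b ^+ 2.
Proof. by have := sqr_ge0 (a - b); rewrite sqrrB sqrrD mulr2n; lra. Qed.

Lemma norm_mul_le (a b : R) : `|a * b| <= a ^+ 2 + b ^+ 2.
Proof.
have := sqr_ge0 (a - b); have := sqr_ge0 (a + b); rewrite sqrrB sqrrD mulr2n => h1 h2.
have := sqr_ge0 a; have := sqr_ge0 b.
by rewrite ler_norml; move=> h3 h4; apply/andP; split; lra.
Qed.

Lemma integrable_add f g : P.-integrable setT (EFin \o f) -> P.-integrable setT (EFin \o g) ->
  P.-integrable setT (EFin \o (fun x => f x + g x)).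
Proof. by move=> hf hg; exact: (integrableD measurableT hf hg). Qed.

Lemma integrable_scale (a : R) f : P.-integrable setT (EFin \o f) ->
  P.-integrable setT (EFin \o (fun x => a * f x)).
Proof. by move=> hf; exact: (integrableZl measurableT a hf). Qed.

Lemma L2D f g : L2 f -> L2 g -> L2 (fun x => f x + g x).
Proof.
move=> [mf f2] [mg g2]; split; first exact: measurable_funD.
apply: (@integrable_dominated _ (fun x => 2 * f x ^+ 2 + 2 * g x ^+ 2)).
- by apply: measurable_funX; exact: measurable_funD.
- by apply: integrable_add; exact: integrable_scale.
- by move=> x; rewrite ger0_norm ?sqr_ge0//; exact: sqr_add_le.
Qed.

Lemma L2M b f : bounded_measurable b -> L2 f -> L2 (fun x => b x * f x).
Proof.
move=> [mb [M bM]] [mf f2]; split; first exact: measurable_funM.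
apply: (@integrable_dominated _ (fun x => M ^+ 2 * f x ^+ 2)).
- by apply: measurable_funX; exact: measurable_funM.
- exact: integrable_scale.
- move=> x; rewrite ger0_norm ?sqr_ge0// exprMn ler_wpM2r ?sqr_ge0//.
  by rewrite -(real_normK (num_real (b x))) lerXn2r ?nnegrE//; exact: le_trans (bM x).
Qed.

Lemma L2Z (a : R) f : L2 f -> L2 (fun x => a * f x).
Proof. by apply: L2M; exact: bounded_measurable_cst. Qed.

Lemma L2_cst (a : R) : L2 (fun=> a).
Proof. by split; [exact: measurable_cst|exact: finite_measure_integrable_cst]. Qed.

Lemma L2_bounded b : bounded_measurable b -> L2 b.
Proof. by move=> bb; have := L2M bb (L2_cst 1); under eq_fun do rewrite mulr1. Qed.

Lemma L2N f : L2 f -> L2 (fun x => - f x).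
Proof. by move=> /(L2Z (-1)); under eq_fun do rewrite mulN1r. Qed.

Lemma L2B f g : L2 f -> L2 g -> L2 (fun x => f x - g x).
Proof. by move=> hf /L2N; exact: L2D. Qed.

Lemma integrable_ip f g : L2 f -> L2 g -> P.-integrable setT (EFin \o (fun x => f x * g x)).
Proof.
move=> [mf f2] [mg g2].
apply: (@integrable_dominated _ (fun x => f x ^+ 2 + g x ^+ 2)).
- exact: measurable_funM.
- exact: integrable_add.
- by move=> x; exact: norm_mul_le.
Qed.

Lemma L2_integrable f : L2 f -> P.-integrable setT (EFin \o f).
Proof.
by move=> hf; have := integrable_ip hf (L2_cst 1); under eq_fun do rewrite /= mulr1.
Qed.

Lemma ipC f g : ip f g = ip g f.
Proof. by apply: eq_Rintegral => x _; rewrite mulrC. Qed.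

Lemma ip1 f : ip f (fun=> 1) = \int[P]_x f x.
Proof. by apply: eq_Rintegral => x _; rewrite mulr1. Qed.

Lemma ip_ge0 f : 0 <= ip f f.
Proof. by apply: Rintegral_ge0 => x _; rewrite -expr2 sqr_ge0. Qed.

Lemma ip_sqr f : ip f f = \int[P]_x (f x ^+ 2).
Proof. by apply: eq_Rintegral => x _; rewrite expr2. Qed.

Lemma ipDl f g h : L2 f -> L2 g -> L2 h -> ip (fun x => f x + g x) h = ip f h + ip g h.
Proof.
move=> hf hg hh; rewrite -RintegralD//; try exact: integrable_ip.
by apply: eq_Rintegral => x _; rewrite mulrDl.
Qed.

Lemma ipZl (a : R) f h : L2 f -> L2 h -> ip (fun x => a * f x) h = a * ip f h.
Proof.
move=> hf hh; rewrite -RintegralZl//; try exact: integrable_ip.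
by apply: eq_Rintegral => x _; rewrite mulrA.
Qed.

Lemma ipDr f g h : L2 f -> L2 g -> L2 h -> ip h (fun x => f x + g x) = ip h f + ip h g.
Proof. by move=> hf hg hh; rewrite ipC ipDl// ![ip h _]ipC. Qed.

Lemma ipZr (a : R) f h : L2 f -> L2 h -> ip h (fun x => a * f x) = a * ip h f.
Proof. by move=> hf hh; rewrite ipC ipZl// [ip h _]ipC. Qed.

Lemma ipBl f g h : L2 f -> L2 g -> L2 h -> ip (fun x => f x - g x) h = ip f h - ip g h.
Proof.
move=> hf hg hh.
have -> : (fun x => f x - g x) = (fun x => f x + (-1) * g x).
  by apply/funext => x; rewrite mulN1r.
by rewrite ipDl ?ipZl ?mulN1r//; exact: L2Z.
Qed.

Lemma ipBr f g h : L2 f -> L2 g -> L2 h -> ip h (fun x => f x - g x) = ip h f - ip h g.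
Proof. by move=> hf hg hh; rewrite ipC ipBl// ![ip h _]ipC. Qed.

Lemma cauchy_schwarz f g : L2 f -> L2 g -> ip f g ^+ 2 <= ip f f * ip g g.
Proof.
move=> hf hg; apply: discriminant_le0 => t.
have hz := L2Z t hg.
have := ip_ge0 (fun x => f x + t * g x).
rewrite ipDl//; last exact: L2D.
rewrite !ipDr// !ipZl// !ipZr// (ipC g f).
have -> // : ip f f + t * ip f g + (t * ip f g + t * (t * ip g g)) =
   ip f f + 2 * t * ip f g + t ^+ 2 * ip g g by ring.
Qed.

End L2_space.

Section L2_complete.
Context d (T : measurableType d) {R : realType} (P : probability T R).
Implicit Types f g h : T -> R.

Lemma Lnorm2E f : L2 P f ->
  ('N[P]_2%:E[EFin \o f] = (Num.sqrt (\int[P]_x (f x ^+ 2)))%:E)%E.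
Proof.
move=> [mf if2]; rewrite unlock /Lnorm.
under eq_integral => x _ do rewrite /= powR_mulrn// real_normK ?num_real//.
rewrite -[X in (X `^ _)%E]fineK; last exact: integrable_fin_num.
by rewrite /= -powR12_sqrt// ?div1r//; apply: Rintegral_ge0 => x _; rewrite sqr_ge0.
Qed.

Lemma Rintegral_fatou (f_ : nat -> T -> R) f (e : R) :
  (forall k, P.-integrable setT (EFin \o f_ k)) -> (forall k x, 0 <= f_ k x) ->
  (forall x, f_ k x @[k --> \oo] --> f x) ->
  (\forall k \near \oo, \int[P]_x f_ k x <= e) ->
  P.-integrable setT (EFin \o f) /\ \int[P]_x f x <= e.
Proof.
move=> if_ f_0 ff fe.
have mf_ k : measurable_fun setT (f_ k) by have /measurable_int/measurable_EFinP := if_ k.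
have mf : measurable_fun setT f by apply: (measurable_fun_cvg mf_) => x _; exact: ff.
have f0 x : 0 <= f x.
  rewrite -(cvg_lim _ (ff x))//; apply: limr_ge; first exact: cvgP (ff x).
  by apply: nearW => k; exact: f_0.
have h : (\int[P]_x (f x)%:E <= e%:E)%E.
  have -> : (\int[P]_x (f x)%:E = \int[P]_x limn_einf (fun k => (f_ k x)%:E))%E.
    apply: eq_integral => x _; symmetry.
    by apply: (cvg_limn_einf_sup _).1; apply: cvg_comp (ff x) _.
  apply: le_trans (fatou P measurableT _ _) _.
  - by move=> k; exact/measurable_EFinP.
  - by move=> k x _; rewrite lee_fin.
  rewrite limn_einf_lim; apply: lime_le; first exact: is_cvg_einfs.
  near=> k.
  apply: (@le_trans _ _ (\int[P]_x (f_ k x)%:E)%E).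
    by apply: ereal_inf_lbound; exists k => //=.
  rewrite -[leLHS]fineK; last exact: (integrable_fin_num measurableT (if_ k)).
  by rewrite lee_fin; near: k.
have i : P.-integrable setT (EFin \o f).
  apply/integrableP; split; first exact/measurable_EFinP.
  under eq_integral => x _ do rewrite /= ger0_norm//.
  by apply: le_lt_trans h _; exact: ltry.
split => //; rewrite -lee_fin; apply: le_trans h.
by rewrite fineK//; exact: integrable_fin_num.
Unshelve. all: by end_near. Qed.

(** A series with geometrically decreasing norms converges almost everywhere:
    the integral of the sum of the absolute values is finite. *)
Lemma ae_converging_series (v : nat -> T -> R) :
  (forall j, L2 P (v j)) ->
  (forall j, \int[P]_x (v j x ^+ 2) <= (2^-1 ^+ j) ^+ 2) ->
  exists2 A : set T, measurable A /\ P (~` A) = 0%E &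
    forall x, A x -> cvgn (series (fun j => v j x)).
Proof.
move=> hv vj.
have mv j : measurable_fun setT (fun x => `|v j x|%:E).
  by apply/measurable_EFinP; apply: measurableT_comp => //; case: (hv j).
have pj j : 0 < (2^-1 : R) ^+ j by rewrite exprn_gt0// invr_gt0.
have iv j : P.-integrable setT (fun x => `|v j x|%:E).
  exact: (integrable_norm (L2_integrable (hv j))).
have vle j : (\int[P]_x `|v j x|%:E <= (2^-1 ^+ j)%:E)%E.
  rewrite -[leLHS]fineK; last exact: integrable_fin_num.
  rewrite lee_fin.
  (* |v| <= (q + v^2 / q) / 2 with q = 2^-j bounds the L^1 norm by q. *)
  apply: (@le_trans _ _ (\int[P]_x (((2^-1 ^+ j)^-1 / 2) * v j x ^+ 2 + (2^-1 ^+ j) / 2))).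
    apply: le_Rintegral; [exact: measurableT|exact: iv| |].
      apply: (@integrable_add _ _ _ _ (fun x => (2^-1 ^+ j)^-1 / 2 * v j x ^+ 2) (cst (2^-1 ^+ j / 2))).
        by apply: integrable_scale; case: (hv j).
      exact: finite_measure_integrable_cst.
    move=> x _; set q := 2^-1 ^+ j.
    have q0 : q != 0 by exact: lt0r_neq0 (pj j).
    rewrite -subr_ge0.
    have -> : q^-1 / 2 * v j x ^+ 2 + q / 2 - `|v j x| = (q^-1 / 2) * (`|v j x| - q) ^+ 2.
      by rewrite -[v j x ^+ 2]real_normK ?num_real//; field.
    by rewrite mulr_ge0 ?sqr_ge0// divr_ge0// invr_ge0 ltW//; exact: pj.
  rewrite RintegralD//; last 2 first.
  - by apply: integrable_scale; case: (hv j).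
  - exact: finite_measure_integrable_cst.
  have -> : \int[P]_x (2^-1 ^+ j / 2) = 2^-1 ^+ j / 2.
    by rewrite Rintegral_cst//= ?probability_setT/= ?mulr1.
  rewrite RintegralZl//; last by case: (hv j).
  have := vj j; have := pj j; set q := 2^-1 ^+ j => q0 hq.
  have : q^-1 / 2 * (\int[P]_x (v j x ^+ 2)) <= q^-1 / 2 * q ^+ 2.
    by rewrite ler_wpM2l// divr_ge0// invr_ge0 ltW.
  have -> : q^-1 / 2 * q ^+ 2 = q / 2 by field; rewrite gt_eqF.
  lra.
pose S x : \bar R := (\sum_(0 <= j <oo) `|v j x|%:E)%E.
have mS : measurable_fun setT S.
  by apply: (@ge0_emeasurable_sum _ _ _ setT (fun j x => `|v j x|%:E) xpredT).
have S0 x : (0 <= S x)%E by apply: nneseries_ge0.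
have psum k : \sum_(0 <= j < k) (2^-1 : R) ^+ j <= 2.
  have -> : \sum_(0 <= j < k) (2^-1 : R) ^+ j = 2 - 2 * 2^-1 ^+ k.
    elim: k => [|k IH]; first by rewrite big_geq// expr0 mulr1 subrr.
    by rewrite big_nat_recr//= IH exprS; field.
  by have := pj k; lra.
have iS : P.-integrable setT S.
  apply/integrableP; split => //.
  under eq_integral => x _ do rewrite gee0_abs//.
  rewrite integral_nneseries//.
  apply: (@le_lt_trans _ _ 2%:E); last exact: ltry.
  apply: lime_le; first by apply: is_cvg_nneseries => j _ _; exact: integral_ge0.
  apply: nearW => k.
  apply: (@le_trans _ _ (\sum_(0 <= j < k) (2^-1 ^+ j)%:E)%E).
    by apply: lee_sum => j _; exact: vle.
  by rewrite sumEFin lee_fin.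
pose A := S @^-1` [set~ +oo%E].
have mA : measurable A.
  by rewrite -[A]setTI; apply: mS => //; apply: measurableC; exact: emeasurable_set1.
exists A.
  split => //.
  have [N [mN N0 sN]] := integrable_ae measurableT iS.
  apply/eqP; rewrite -measure_le0 -N0; apply: le_measure; rewrite ?inE//.
    exact: measurableC.
  move=> x nAx; apply: sN => /= h; apply: nAx => /= Sx.
  by have := h I; rewrite Sx.
move=> x Ax; apply: normed_cvg.
have fS : S x \is a fin_num.
  by rewrite fin_numElt (lt_le_trans _ (S0 x))//= ltey; apply/eqP.
apply: nondecreasing_is_cvgn.
  exact: (@nondecreasing_series R (fun j => `|v j x|) xpredT 0%N (fun j _ _ => normr_ge0 _)).
exists (fine (S x)) => _ [k _ <-].
rewrite -lee_fin fineK// /series/= -sumEFin.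
exact: nneseries_lim_ge.
Qed.

(** Riesz-Fischer: a fast subsequence converges almost everywhere, by the previous
    lemma applied to its increments, and Fatou's lemma turns the Cauchy property
    into convergence to the limit. *)
Lemma L2_complete (u : nat -> T -> R) : (forall k, L2 P (u k)) ->
  (forall e : R, 0 < e -> exists N, forall i j, (N <= i)%N -> (N <= j)%N ->
     \int[P]_x ((u i x - u j x) ^+ 2) <= e) ->
  exists2 v, L2 P v & forall e : R, 0 < e -> exists N, forall k, (N <= k)%N ->
    \int[P]_x ((u k x - v x) ^+ 2) <= e.
Proof.
move=> hu cu.
have pj j : 0 < ((2^-1 : R) ^+ j) ^+ 2 by rewrite !exprn_gt0// invr_gt0.
have /choice[N HN] j := cu _ (pj j).
pose K j := (\sum_(i < j.+1) (N i).+1)%N.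
have NK j : (N j <= K j)%N by rewrite /K big_ord_recr/= (leq_trans _ (leq_addl _ _)).
have jK j : (j <= K j)%N.
  by elim: j => // j IH; rewrite /K big_ord_recr/= addnS ltnS (leq_trans IH)// leq_addr.
have KS j : (K j <= K j.+1)%N by rewrite /K [in leqRHS]big_ord_recr/= leq_addr.
have Kmono : {homo K : i j / (i <= j)%N} by apply: homo_leq => //; exact: leq_trans.
pose v j x := u (K j.+1) x - u (K j) x.
have hv j : L2 P (v j) by exact: L2B.
have [A [mA A0] HA] : exists2 A : set T, measurable A /\ P (~` A) = 0%E &
    forall x, A x -> cvgn (series (fun j => v j x)).
  apply: ae_converging_series => // j; apply: HN => //.
  by apply: leq_trans (KS j).
have bA : bounded_measurable (\1_A : T -> R).
  split => //; exists 1 => x; rewrite indicE.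
  by case: (_ \in _); rewrite ?normr1 ?normr0.
(* Cutting off the exceptional null set makes the subsequence converge
   everywhere, so that the limit is measurable. *)
pose w j x := \1_A x * u (K j) x.
have hw j : L2 P (w j) by exact: L2M.
pose l x := limn (fun j => w j x).
have wl x : w j x @[j --> \oo] --> l x.
  suff : cvgn (fun j => w j x) by [].
  have [Ax|nAx] := pselect (A x); last first.
    by rewrite /w indicE memNset//; under eq_fun do rewrite mul0r; exact: is_cvg_cst.
  rewrite /w indicE mem_set//; under eq_fun do rewrite mul1r.
  have -> : (fun j => u (K j) x) = (fun j => u (K 0%N) x + series (fun j => v j x) j).
    apply/funext => j; rewrite /series/= /v telescope_sumr//.
    by rewrite addrC subrK.
  by apply: is_cvgD; [exact: is_cvg_cst|exact: HA].
have ml : measurable_fun setT l.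
  apply: (@measurable_fun_cvg _ _ _ _ w) => [j|x _]; last exact: wl.
  by case: (hw j).
have uw m j : \int[P]_x ((u m x - w j x) ^+ 2) = \int[P]_x ((u m x - u (K j) x) ^+ 2).
  congr fine; apply: ae_eq_integral => //.
  - by apply/measurable_EFinP; apply: measurable_funX; case: (L2B (hu m) (hw j)).
  - by apply/measurable_EFinP; apply: measurable_funX; case: (L2B (hu m) (hu (K j))).
  exists (~` A); split => //; first exact: measurableC.
  move=> x /= h Ax; apply: h => _.
  by rewrite /w indicE mem_set// mul1r.
have fat m e : 0 < e -> (forall k, (m <= k)%N -> \int[P]_x ((u m x - u k x) ^+ 2) <= e) ->
    P.-integrable setT (EFin \o (fun x => (u m x - l x) ^+ 2)) /\
    \int[P]_x ((u m x - l x) ^+ 2) <= e.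
  move=> e0 hm; apply: (@Rintegral_fatou (fun j x => (u m x - w j x) ^+ 2)).
  - by move=> j; case: (L2B (hu m) (hw j)).
  - by move=> j x; rewrite sqr_ge0.
  - move=> x; under eq_fun do rewrite expr2; rewrite expr2.
    by apply: cvgM; apply: cvgB; (exact: cvg_cst || exact: wl).
  - near=> j; rewrite uw; apply: hm; apply: leq_trans (jK j).
    by near: j; exact: nbhs_infty_ge.
exists l.
  have [M HM] := cu _ ltr01; have [i _] := fat M 1 ltr01 (fun k Mk => HM M k (leqnn M) Mk).
  have : L2 P (fun x => u M x - (u M x - l x)).
    by apply: L2B => //; split => //; apply: measurable_funB => //; case: (hu M).
  by rewrite (_ : (fun x => _) = l)//; apply/funext => x; rewrite opprB addrC subrK.
move=> e e0; have [M HM] := cu _ e0; exists M => k Mk.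
by apply: (fat k e e0 _).2 => j kj; apply: HM => //; exact: leq_trans kj.
Unshelve. all: by end_near. Qed.

End L2_complete.

(** * The Riesz representation theorem *)

Section riesz_representation.

Let first_variation (R : realType) (a m p q e : R) : m <= a + (- p - q) ->
  a <= m + e -> 0 <= q -> p <= e.
Proof. by lra. Qed.

Let parallelogram (R : realType) (a1 a2 m p q e : R) : a2 = a1 + 2 * p + q ->
  m <= a1 + p + q / 4 -> a1 <= m + e / 4 -> a2 <= m + e / 4 -> q <= e.
Proof. by lra. Qed.

Context {R : realType} (W : lmodType R).
Variables (D : W -> Prop) (b : W -> W -> R) (l : W -> R) (M : R).
Hypotheses (M0 : 0 <= M) (D0 : D 0) (DD : forall x y, D x -> D y -> D (x + y))
  (DZ : forall (a : R) x, D x -> D (a *: x)).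
Hypotheses (bC : forall x y, b x y = b y x)
  (bD : forall x y z, D x -> D y -> D z -> b (x + y) z = b x z + b y z)
  (bZ : forall (a : R) x z, D x -> D z -> b (a *: x) z = a * b x z)
  (b0 : forall x, D x -> 0 <= b x x).
Hypotheses (lD : forall x y, D x -> D y -> l (x + y) = l x + l y)
  (lZ : forall (a : R) x, D x -> l (a *: x) = a * l x)
  (lM : forall x, D x -> l x ^+ 2 <= M * b x x).
Hypothesis b_complete : forall x : nat -> W, (forall k, D (x k)) ->
  (forall e : R, 0 < e -> exists N, forall i j, (N <= i)%N -> (N <= j)%N ->
     b (x i - x j) (x i - x j) <= e) ->
  exists2 y, D y & forall e : R, 0 < e -> exists N, forall k, (N <= k)%N ->
     b (x k - y) (x k - y) <= e.

Let DB x y : D x -> D y -> D (x - y).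
Proof. by move=> hx hy; rewrite -scaleN1r; apply: DD => //; exact: DZ. Qed.

Let bDr x y z : D x -> D y -> D z -> b z (x + y) = b z x + b z y.
Proof. by move=> hx hy hz; rewrite bC bD// ![b z _]bC. Qed.

Let bZr (a : R) x z : D x -> D z -> b z (a *: x) = a * b z x.
Proof. by move=> hx hz; rewrite bC bZ// bC. Qed.

Let bsqr (t : R) x v : D x -> D v ->
  b (x + t *: v) (x + t *: v) = b x x + 2 * t * b x v + t ^+ 2 * b v v.
Proof.
move=> hx hv; have htv := DZ t hv; have hs := DD hx htv.
by rewrite bD// !bDr// !bZ// !bZr// (bC v x); ring.
Qed.

Let b_cauchy_schwarz x v : D x -> D v -> b x v ^+ 2 <= b x x * b v v.
Proof.
move=> hx hv; apply: discriminant_le0 => t; rewrite -bsqr//.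
by apply: b0; apply: DD => //; exact: DZ.
Qed.

Let J x := b x x - 2 * l x.

Let J_lower x : D x -> - M <= J x.
Proof.
move=> hx; have := lM hx; have := b0 hx; rewrite /J; set B := b x x; set L := l x => B0 LM.
have : 0 <= (M - B) ^+ 2 by exact: sqr_ge0.
have [h|h] := leP (2 * L) (B + M); first lra.
have : 0 < (2 * L - (B + M)) * (2 * L + (B + M)) by have M0' := M0; rewrite mulr_gt0// ?subr_gt0//; lra.
nra.
Qed.

Let J_move (t : R) x v : D x -> D v ->
  J (x + t *: v) = J x + 2 * t * (b x v - l v) + t ^+ 2 * b v v.
Proof. by move=> hx hv; rewrite /J bsqr// lD ?lZ//; [ring|exact: DZ]. Qed.

(** The representative minimises b x x - 2 l x over D. A minimising sequence is
    Cauchy by the parallelogram identity; a first variation of size t at an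
    almost minimiser shows that b x v - l v is small. *)
Lemma riesz_representation : exists2 x, D x & forall v, D v -> b x v = l v.
Proof.
pose E := [set J x | x in [set x | D x]].
have Einf : has_inf E.
  by split; [exists (J 0); exists 0|exists (- M) => _ [x hx <-]; exact: J_lower].
pose m := inf E.
have mJ x : D x -> m <= J x by move=> hx; apply: ge_inf; [case: Einf|exists x].
have /choice[x hx] (k : nat) : exists x, D x /\ J x <= m + k.+1%:R^-1.
  have k0 : 0 < k.+1%:R^-1 :> R by rewrite invr_gt0.
  have [_ [x Dx <-] hlt] := inf_adherent k0 Einf.
  by exists x; split => //; exact: ltW.
have small (e : R) : 0 < e -> exists N : nat, forall k, (N <= k)%N -> k.+1%:R^-1 <= e.
  move=> e0; exists (Num.truncn e^-1) => k Nk.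
  rewrite -[leRHS]invrK lef_pV2 ?posrE ?invr_gt0//.
  have /ltW := truncnS_gt e^-1; move/le_trans; apply; rewrite ler_nat.
  by rewrite ltnS.
have [y Dy xy] : exists2 y, D y & forall e : R, 0 < e -> exists N, forall k, (N <= k)%N ->
     b (x k - y) (x k - y) <= e.
  apply: (b_complete (fun k => (hx k).1)) => e e0.
  have e40 : 0 < e / 4 by rewrite divr_gt0.
  have [N HN] := small _ e40.
  exists N => i j Ni Nj.
  have [Di Ji] := hx i; have [Dj Jj] := hx j.
  have hi := HN _ Ni; have hj := HN _ Nj.
  have Dd := DB Dj Di.
  have jE : x j = x i + 1 *: (x j - x i) by rewrite scale1r addrC subrK.
  have := mJ _ (DD Di (DZ (1 / 2) Dd)); rewrite J_move//.
  have := J_move 1 Di Dd; rewrite -jE.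
  have -> : b (x i - x j) (x i - x j) = b (x j - x i) (x j - x i).
    have -> : x i - x j = (-1) *: (x j - x i) by rewrite scaleN1r opprB.
    by rewrite bZ ?bZr//; [ring|exact: DZ].
  set q := b (x j - x i) _ ; set p := b (x i) _ - _.
  have -> : 2 * (1 / 2) * p = p :> R by field.
  have -> : (1 / 2) ^+ 2 * q = q / 4 by field.
  have -> : 2 * 1 * p = 2 * p :> R by ring.
  rewrite expr1n mul1r => e1 e2.
  have e3 := le_trans Ji (lerD (lexx _) hi); have e4 := le_trans Jj (lerD (lexx _) hj).
  exact: parallelogram e1 e2 e3 e4.
exists y => // v Dv; apply/eqP; rewrite -subr_eq0.
set B := b v v; have B0 : 0 <= B by exact: b0.
have key (e : R) : 0 < e -> (b y v - l v) ^+ 2 <= e.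
  move=> e0.
  have e4 : 0 < e / (4 * (B + 1)) by rewrite divr_gt0// mulr_gt0//; lra.
  have [N1 H1] := small _ e4; have [N2 H2] := xy _ e4.
  pose k := maxn N1 N2.
  have {}H1 := H1 k (leq_maxl _ _); have {}H2 := H2 k (leq_maxr _ _).
  have [Dk Jk] := hx k.
  set c := b (x k) v - l v.
  have c2 : c ^+ 2 <= k.+1%:R^-1 * (B + 1).
    have := mJ _ (DD Dk (DZ (- c / (B + 1)) Dv)); rewrite J_move// -/c -/B => h.
    have B1 : 0 < B + 1 by lra.
    have : c ^+ 2 / (B + 1) <= k.+1%:R^-1.
      have E1 : 2 * (- c / (B + 1)) * c + (- c / (B + 1)) ^+ 2 * B =
          - (c ^+ 2 / (B + 1)) - c ^+ 2 / (B + 1) ^+ 2 by field; lra.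
      have q0 : 0 <= c ^+ 2 / (B + 1) ^+ 2 by rewrite divr_ge0 ?sqr_ge0.
      rewrite -addrA E1 in h; exact: first_variation h Jk q0.
    by rewrite ler_pdivrMr.
  have d2 : b (x k - y) v ^+ 2 <= e / (4 * (B + 1)) * (B + 1).
    apply: le_trans (b_cauchy_schwarz (DB Dk Dy) Dv) _.
    by rewrite ler_pM ?b0//; [exact: DB|rewrite -/B; lra].
  have E2 : b (x k - y) v = b (x k) v - b y v.
    by rewrite bD//; [rewrite -scaleN1r bZ// mulN1r|rewrite -scaleN1r; exact: DZ].
  have E3 : b y v - l v = c - b (x k - y) v by rewrite E2 /c; ring.
  have E4 : e / (4 * (B + 1)) * (B + 1) = e / 4 by field; lra.
  rewrite E4 in d2.
  have c3 : c ^+ 2 <= e / 4.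
    apply: le_trans c2 _; rewrite -E4 ler_wpM2r//; lra.
  rewrite E3; have := sqr_ge0 (c + b (x k - y) v); rewrite sqrrB sqrrD; lra.
rewrite -sqrf_eq0 eq_le sqr_ge0 andbT; apply/ler_addgt0Pr => e e0.
by rewrite add0r; exact: key.
Qed.

End riesz_representation.

(** * The Sobolev space of a Gibbs measure *)

Section gibbs_density.
Context {R : realType} {n : nat}.
Variables (V : 'rV[R]_n -> R) (Z : R) (mu : probability 'rV[R]_n R).
Hypotheses (sV : smooth V) (gV : gibbs_measure V Z mu).
Implicit Types (f u v : 'rV[R]_n -> R) (g h : 'rV[R]_n -> 'rV[R]_n).
Local Notation Leb := (lebesgue_rV n).

Definition gibbs_density x := Z^-1 * expR (- V x).
Local Notation p := gibbs_density.

Lemma gibbs_density_gt0 x : 0 < p x.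
Proof. by rewrite mulr_gt0 ?expR_gt0// invr_gt0; case: gV. Qed.

Lemma gibbs_density_continuous : continuous p.
Proof.
move=> x; have c : expR (- V y) @[y --> x] --> expR (- V x).
  apply: (@continuous_comp _ _ _ (fun y => - V y) expR); last exact: continuous_expR.
  by apply: continuousN; exact: smooth_continuous.
exact: (cvgMr (a := Z^-1) c).
Qed.

Lemma measurable_gibbs_density : measurable_fun setT p.
Proof. exact: (measurable_continuous_rV gibbs_density_continuous). Qed.

Lemma ge0_integral_gibbs (f : 'rV[R]_n -> \bar R) :
  measurable_fun setT f -> (forall x, (0 <= f x)%E) ->
  (\int[mu]_x f x = \int[Leb]_x (f x * (p x)%:E))%E.
Proof.
move=> mf f0; apply: ge0_integral_density => //.
- exact: measurable_gibbs_density.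
- by move=> x; exact: ltW (gibbs_density_gt0 x).
- by case: gV.
Qed.

Lemma integral_gibbs f : measurable_fun setT f ->
  (\int[mu]_x (f x)%:E = \int[Leb]_x (f x * p x)%:E)%E.
Proof.
move=> mf; have mE : measurable_fun setT (EFin \o f) by exact/measurable_EFinP.
rewrite integralE [RHS]integralE.
rewrite (ge0_integral_gibbs (measurable_funepos mE)); last by move=> x; exact: funepos_ge0.
rewrite (ge0_integral_gibbs (measurable_funeneg mE)); last by move=> x; exact: funeneg_ge0.
have p0 x : (0 <= (p x)%:E)%E by rewrite lee_fin ltW// gibbs_density_gt0.
congr (_ - _)%E; apply: eq_integral => x _.
- by rewrite !funeposE maxe_pMl// mul0e.
- by rewrite !funenegE maxe_pMl// mul0e mulNe.
Qed.

Lemma Rintegral_gibbs f : measurable_fun setT f ->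
  \int[mu]_x f x = \int[Leb]_x (f x * p x).
Proof. by move=> mf; rewrite /Rintegral integral_gibbs. Qed.

Lemma integrable_gibbs f : measurable_fun setT f ->
  mu.-integrable setT (EFin \o f) <-> Leb.-integrable setT (EFin \o (fun x => f x * p x)).
Proof.
move=> mf; have mfp : measurable_fun setT (fun x => f x * p x).
  by apply: measurable_funM => //; exact: measurable_gibbs_density.
have E : (\int[mu]_x `|(f x)%:E| = \int[Leb]_x `|(f x * p x)%:E|)%E.
  rewrite ge0_integral_gibbs//; last first.
    by apply: measurableT_comp => //; exact/measurable_EFinP.
  apply: eq_integral => x _; rewrite (EFinM (f x) (p x)) abseM; congr (_ * _)%E.
  by rewrite gee0_abs// lee_fin ltW// gibbs_density_gt0.
split=> /integrableP[_ h]; apply/integrableP; split; try exact/measurable_EFinP.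
- by rewrite -E.
- by rewrite E.
Qed.

Lemma continuous_support_bounded_measurable f r : continuous f ->
  (forall x, ~ cube r x -> f x = 0) -> bounded_measurable f.
Proof.
move=> cf f0; split; first exact: measurable_continuous_rV.
have [M M0 HM] := continuous_bounded_cube r cf; exists M => x.
by have [/HM//|/f0 ->] := pselect (cube r x); rewrite normr0.
Qed.

(** Dividing a test function by the density turns a Lebesgue pairing into an
    inner product of L^2(mu). *)
Definition density_quotient f x := f x * (Z * expR (V x)).
Local Notation Q := density_quotient.

Lemma density_quotientE f x : Q f x * p x = f x.
Proof.
rewrite /density_quotient /gibbs_density expRN; field.
by rewrite gt_eqF ?expR_gt0//= gt_eqF//; case: gV.
Qed.

Lemma bounded_density_quotient f : test_function f -> bounded_measurable (Q f).
Proof.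
move=> tf; have [r r0 fr] := test_function_support tf.
apply: (@continuous_support_bounded_measurable _ r).
  move=> x; have c : expR (V y) @[y --> x] --> expR (V x).
    apply: (@continuous_comp _ _ _ V expR); last exact: continuous_expR.
    exact: smooth_continuous.
  have cf : f y @[y --> x] --> f x by exact: (@smooth_continuous _ _ f (test_function_smooth tf) x).
  exact: (cvgM cf (cvgMr (a := Z) c)).
by move=> x /fr; rewrite /density_quotient => ->; rewrite mul0r.
Qed.

Lemma L2_density_quotient f : test_function f -> L2 mu (Q f).
Proof. by move=> /bounded_density_quotient; exact: L2_bounded. Qed.

Lemma Rintegral_test u f : measurable_fun setT u -> test_function f ->
  \int[Leb]_x (u x * f x) = ip mu u (Q f).
Proof.
move=> mfu tf; rewrite /ip Rintegral_gibbs; last first.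
  by apply: measurable_funM => //; case: (bounded_density_quotient tf).
by apply: eq_Rintegral => x _; rewrite -mulrA density_quotientE.
Qed.

Lemma H1P u g : H1 mu u g <-> [/\ L2 mu u, forall i, L2 mu (fun x => g x ord0 i) &
  forall phi i, test_function phi ->
    ip mu u (Q (partial i phi)) = - ip mu (fun x => g x ord0 i) (Q phi)].
Proof.
split=> -[h1 h2 h3].
  have {}h1 : L2 mu u by exact/Lfun2P.
  have {}h2 i : L2 mu (fun x => g x ord0 i) by exact/Lfun2P.
  split => // phi i tphi; have := h3 _ i tphi.
  rewrite !Rintegral_test//; first by case: (h2 i).
  - by case: h1.
  - exact: test_function_partial.
split; first exact/Lfun2P.
  by move=> i; apply/Lfun2P.
move=> phi i tphi; rewrite !Rintegral_test//; first exact: h3.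
- by case: (h2 i).
- by case: h1.
- exact: test_function_partial.
Qed.

Lemma H1D u g v h : H1 mu u g -> H1 mu v h ->
  H1 mu (fun x => u x + v x) (fun x => g x + h x).
Proof.
move=> /H1P[u2 g2 ug] /H1P[v2 h2 vh]; apply/H1P; split; first exact: L2D.
  by move=> i; under eq_fun do rewrite mxE; exact: L2D.
move=> phi i tphi; have q1 := L2_density_quotient tphi.
have q2 := L2_density_quotient (test_function_partial i tphi).
under [X in - ip _ X _]eq_fun do rewrite mxE.
by rewrite !ipDl// ug// vh// opprD.
Qed.

Lemma H1Z (a : R) u g : H1 mu u g -> H1 mu (fun x => a * u x) (fun x => a *: g x).
Proof.
move=> /H1P[u2 g2 ug]; apply/H1P; split; first exact: L2Z.
  by move=> i; under eq_fun do rewrite mxE; exact: L2Z.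
move=> phi i tphi; have q1 := L2_density_quotient tphi.
have q2 := L2_density_quotient (test_function_partial i tphi).
under [X in - ip _ X _]eq_fun do rewrite mxE.
by rewrite !ipZl// ug// mulrN.
Qed.

(** The weak gradient of a constant is 0 because test functions have derivatives
    of integral 0. *)
Lemma H1_cst (a : R) : H1 mu (fun=> a) (fun=> 0).
Proof.
apply/H1P; split; first exact: L2_cst.
  by move=> i; under eq_fun do rewrite mxE; exact: L2_cst.
move=> phi i tphi; under [X in - ip _ X _]eq_fun do rewrite mxE.
have -> : ip mu (fun=> 0 : R) (Q phi) = 0.
  by rewrite /ip; under eq_Rintegral do rewrite mul0r; rewrite Rintegral_cst// mul0r.
rewrite -Rintegral_test//; last exact: test_function_partial.
have [M _ HM] := test_function_bounded (test_function_partial i tphi).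
have [r r0 fr] := test_function_support tphi.
have [|||i1 i2] := @Rintegral_line_derivative _ _ phi (partial i phi) i M.
- split; first exact: test_function_measurable.
  have [N _ HN] := test_function_bounded tphi; exists N, r; split => // x j xj.
  by apply: fr => /(_ j); rewrite in_itv/= -ler_norml leNgt xj.
- by move=> x; rewrite -gradientE; exact: (C11_line_derivative x i (test_function_C11 tphi)).
- exact: HM.
by rewrite RintegralZl// i2 mulr0 oppr0.
Qed.

(** The gradient identity is a family of L^2(mu) pairings, hence stable under
    L^2(mu) limits. *)
Lemma H1_closed (u_ : nat -> 'rV[R]_n -> R) (g_ : nat -> 'rV[R]_n -> 'rV[R]_n) u g :
  (forall k, H1 mu (u_ k) (g_ k)) -> L2 mu u -> (forall i, L2 mu (fun x => g x ord0 i)) ->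
  (forall e : R, 0 < e -> exists k, \int[mu]_x ((u_ k x - u x) ^+ 2) <= e /\
     forall i, \int[mu]_x ((g_ k x ord0 i - g x ord0 i) ^+ 2) <= e) ->
  H1 mu u g.
Proof.
move=> h_ u2 g2 lim; apply/H1P; split => // phi i tphi.
have q1 := L2_density_quotient tphi.
have q2 := L2_density_quotient (test_function_partial i tphi).
set A := ip _ _ (Q phi); set B := ip _ _ _.
pose K := ip mu (Q phi) (Q phi) + ip mu (Q (partial i phi)) (Q (partial i phi)) + 1.
have K1 := ip_ge0 mu (Q phi); have K2 := ip_ge0 mu (Q (partial i phi)).
have K0 : 0 < K by rewrite /K; lra.
suff key (e : R) : 0 < e -> (B + A) ^+ 2 <= e.
  apply/eqP; rewrite -addr_eq0 -sqrf_eq0 eq_le sqr_ge0 andbT.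
  by apply/ler_addgt0Pr => e e0; rewrite add0r; exact: key.
move=> e0; have e1 : 0 < e / (4 * K) by rewrite divr_gt0// mulr_gt0.
have [k [uk gk]] := lim _ e1; have /H1P[u2k g2k ugk] := h_ k.
have du := L2B u2k u2; have dg := L2B (g2k i) (g2 i).
have C1 := cauchy_schwarz du q2; have C2 := cauchy_schwarz dg q1.
have E : B + A = - (ip mu (fun x => u_ k x - u x) (Q (partial i phi)) +
                    ip mu (fun x => g_ k x ord0 i - g x ord0 i) (Q phi)).
  by rewrite !ipBl// ugk// /A /B; ring.
rewrite E sqrrN; apply: le_trans (sqr_add_le _ _) _.
have b1 : ip mu (fun x => u_ k x - u x) (Q (partial i phi)) ^+ 2 <= e / (4 * K) * K.
  apply: le_trans C1 _; apply: ler_pM; try exact: ip_ge0.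
    by rewrite ip_sqr.
  by rewrite /K; lra.
have b2 : ip mu (fun x => g_ k x ord0 i - g x ord0 i) (Q phi) ^+ 2 <= e / (4 * K) * K.
  apply: le_trans C2 _; apply: ler_pM; try exact: ip_ge0.
    by rewrite ip_sqr; exact: gk.
  by rewrite /K; lra.
have EK : e / (4 * K) * K = e / 4 by field; rewrite gt_eqF.
by rewrite EK in b1 b2; lra.
Qed.

End gibbs_density.

(** * Mollification *)

Section mollification.
Context {R : realType} {n : nat}.
Implicit Types (b rho w phi u : 'rV[R]_n -> R).
Local Notation Leb := (lebesgue_rV n).
Local Notation L1 f := (Leb.-integrable setT (EFin \o f)).

Lemma L1_bounded_mul b w : bounded_measurable b -> L1 w -> L1 (fun x => b x * w x).
Proof.
move=> [mb [M bM]] hw; apply: (le_integrable measurableT _ _ (L1Z M hw)).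
  by apply/measurable_EFinP; apply: measurable_funM => //; exact: L1_measurable.
move=> x _ /=; rewrite lee_fin !normrM ler_wpM2r//.
by apply: le_trans (bM x) _; exact: ler_norm.
Qed.

Lemma norm_Rintegral_bounded_mul b w (M : R) : bounded_measurable b -> L1 w ->
  (forall x, `|b x| <= M) ->
  `|\int[Leb]_x (b x * w x)| <= M * \int[Leb]_x `|w x|.
Proof.
move=> bb hw bM; have hbw := L1_bounded_mul bb hw.
apply: le_trans (le_normr_Rintegral measurableT hbw) _.
rewrite -RintegralZl//; last exact: (L1_norm hw).
apply: le_Rintegral => //; [exact: (L1_norm hbw)|exact: (L1Z M (L1_norm hw))|].
by move=> x _; rewrite normrM ler_wpM2r.
Qed.

(** On the cube |w| <= w^2 + 1. *)
Lemma L1_of_sqr w r : 0 < r -> measurable_fun setT w -> L1 (fun x => w x ^+ 2) ->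
  (forall x, ~ cube r x -> w x = 0) -> L1 w.
Proof.
move=> r0 mw w2 w0.
have i : L1 (fun x => w x ^+ 2 + \1_(@cube R n r) x).
  by apply: L1D => //; exact: integrable_cube (ltW r0).
apply: (le_integrable measurableT _ _ i); first exact/measurable_EFinP.
move=> x _ /=; rewrite lee_fin indicE.
have [xr|xr] := pselect (cube r x); last by rewrite w0// normr0.
rewrite mem_set// [leRHS]ger0_norm ?addr_ge0 ?sqr_ge0//.
have := sqr_ge0 (`|w x| - 1 / 2); rewrite sqrrB real_normK ?num_real// => h.
rewrite -[true%:R]/(1 : R); lra.
Qed.

Lemma bounded_measurable_translation b (a : 'rV[R]_n) : bounded_measurable b ->
  bounded_measurable (fun x : 'rV[R]_n => b (x + a)).
Proof.
move=> [mb [M bM]]; split; last by exists M => x; exact: bM.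
by apply: measurableT_comp => //; exact: measurable_translate.
Qed.

Definition convolution rho w x := \int[Leb]_y (rho (y - x) * w y).

Lemma convolutionE rho w x : bounded_measurable rho -> L1 w ->
  convolution rho w x = \int[Leb]_z (rho z * w (x + z)).
Proof.
move=> br hw; have br' := bounded_measurable_translation (- x) br.
rewrite /convolution -(@Rintegral_translation _ _ _ x); last first.
  exact: L1_measurable (L1_bounded_mul br' hw).
by apply: eq_Rintegral => z _; rewrite addrK (addrC z).
Qed.

Lemma lipschitz_continuous (f : 'rV[R]_n -> R) (K : R) : 0 <= K ->
  (forall d x h, 0 < d -> d <= 1 -> cube d h -> `|f (x + h) - f x| <= K * d) -> continuous f.
Proof.
move=> K0 H x B /nbhs_ballP[e e0 eB]; apply/nbhs_ballP.
pose d := Num.min 1 (e / (2 * (K + 1))).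
have K1 : 0 < 2 * (K + 1) by rewrite mulr_gt0//; lra.
have d0 : 0 < d by rewrite lt_min ltr01 divr_gt0.
exists d => // y [_ xy]; apply: eB; rewrite /ball/= distrC.
have -> : y = x + (y - x) by rewrite addrC subrK.
apply: (@le_lt_trans _ _ (K * d)).
  apply: H => //; first by rewrite ge_min lexx.
  move=> i; rewrite in_itv/= -ler_norml !mxE distrC ltW//.
  by have := xy ord0 i; rewrite /ball/=.
have de : d <= e / (2 * (K + 1)) by rewrite ge_min lexx orbT.
apply: (@le_lt_trans _ _ (K * (e / (2 * (K + 1))))); first by rewrite ler_wpM2l.
rewrite mulrA ltr_pdivrMr// mulrC.
have e0' : 0 < e := e0.
by nra.
Qed.

Lemma C11_lipschitz u G : C11 u G -> exists2 K, 0 <= K &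
  forall d x h, 0 < d -> d <= 1 -> cube d h -> `|u (x + h) - u x| <= K * d.
Proof.
move=> [_ _ [C C0 H]].
pose K := C + n%:R + C * n%:R.
have n0 : 0 <= n%:R :> R by [].
have Cn : 0 <= C * n%:R by rewrite mulr_ge0.
exists (Num.sqrt C * n%:R + C * n%:R); first by rewrite addr_ge0// mulr_ge0.
move=> d x h d0 d1 hd; have [_ GC uG] := H x.
have hh : dot h h <= n%:R * d by
  apply: le_trans (cube_enorm (ltW d0) hd) _; rewrite ler_wpM2l// expr2 ler_piMr// ltW.
have -> : u (x + h) - u x = (u (x + h) - u x - dot (G x) h) + dot (G x) h by rewrite subrK.
apply: le_trans (ler_normD _ _) _; rewrite mulrDl addrC lerD//; last first.
  by apply: le_trans (uG h) _; rewrite -mulrA ler_wpM2l.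
rewrite -mulrA [n%:R * d]mulrC mulrA mulr_natr -{2}(card_ord n) -sumr_const.
apply: le_trans (ler_norm_sum _ _ _) _; apply: ler_sum => i _; rewrite normrM.
apply: ler_pM => //; first by apply: le_trans (coord_le_enorm _ _) _; rewrite ler_wsqrtr.
by have := hd i; rewrite in_itv/= -ler_norml.
Qed.

Lemma L1_row_sum (a : 'I_n -> R) (gam : 'I_n -> 'rV[R]_n -> R) : (forall i, L1 (gam i)) ->
  L1 (fun x => \sum_i a i * gam i x) /\
  \int[Leb]_x (\sum_i a i * gam i x) = \sum_i a i * \int[Leb]_x gam i x.
Proof.
move=> hg.
have [h1 h2] := @Rintegral_sum _ _ _ Leb _ (index_enum 'I_n) _ (fun i => L1Z (a i) (hg i)).
by split => //; rewrite h2; apply: eq_bigr => i _; rewrite RintegralZl.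
Qed.

Lemma convolution_continuous rho w : test_function rho -> L1 w -> continuous (convolution rho w).
Proof.
move=> tr hw; have br := test_function_bounded_measurable tr.
have [K K0 HK] := C11_lipschitz (test_function_C11 tr).
have w0 : 0 <= \int[Leb]_x `|w x| by apply: Rintegral_ge0.
apply: (@lipschitz_continuous _ (K * \int[Leb]_x `|w x|)); first by rewrite mulr_ge0.
move=> d x h d0 d1 hd; rewrite /convolution.
have b1 := bounded_measurable_translation (- (x + h)) br.
have b2 := bounded_measurable_translation (- x) br.
rewrite -RintegralB//; try exact: L1_bounded_mul.
rewrite mulrAC (_ : \int[Leb]_y _ =
   \int[Leb]_y ((rho (y - (x + h)) + (-1) * rho (y - x)) * w y)); last first.
  by apply: eq_Rintegral => y _; ring.
apply: norm_Rintegral_bounded_mul => //.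
  by apply: bounded_measurableD => //; exact: bounded_measurableZ.
move=> y; rewrite mulN1r opprD addrA; apply: HK => // i.
by move: (hd i); rewrite !in_itv/= -!ler_norml mxE normrN.
Qed.

(** Differentiating under the integral sign moves the derivative to the
    kernel, and the weak gradient identity moves it back to the function. *)
Lemma C11_convolution rho w (gam : 'I_n -> 'rV[R]_n -> R) : test_function rho -> L1 w ->
  (forall i, L1 (gam i)) ->
  (forall phi i, test_function phi ->
     \int[Leb]_x (w x * partial i phi x) = - \int[Leb]_x (gam i x * phi x)) ->
  C11 (convolution rho w) (fun x => \row_i convolution rho (gam i) x).
Proof.
move=> tr hw hg weak; have br := test_function_bounded_measurable tr.
have [mr _ [C C0 HC]] := test_function_C11 tr.
pose N := \int[Leb]_x `|w x|.
have N0 : 0 <= N by apply: Rintegral_ge0.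
pose Ni i := \int[Leb]_x `|gam i x|.
have dconv x i : convolution rho (gam i) x = - \int[Leb]_y (partial i rho (y - x) * w y).
  have := weak _ i (test_function_translation (- x) tr).
  rewrite partial_translation => E.
  rewrite /convolution; under eq_Rintegral do rewrite mulrC.
  by rewrite -[LHS]opprK -E; congr (- _); apply: eq_Rintegral => y _; rewrite mulrC.
have bd u x (hu : L1 u) : `|convolution rho u x| <= C * \int[Leb]_x `|u x|.
  apply: norm_Rintegral_bounded_mul => //; first exact: bounded_measurable_translation.
  by move=> y; case: (HC (y - x)).
have S0 : 0 <= \sum_i (C * Ni i) ^+ 2 by apply: sumr_ge0 => i _; exact: sqr_ge0.
have CN : 0 <= C * N by exact: mulr_ge0.
split.
- exact: measurable_continuous_rV (convolution_continuous tr hw).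
- move=> i; under eq_fun do rewrite mxE.
  exact: measurable_continuous_rV (convolution_continuous tr (hg i)).
exists (C * N + \sum_i (C * Ni i) ^+ 2); first exact: addr_ge0.
move=> x; split.
- by apply: le_trans (bd w x hw) _; rewrite lerDl.
- apply: (@le_trans _ _ (\sum_i (C * Ni i) ^+ 2)); last by rewrite lerDr.
  apply: ler_sum => i _; rewrite mxE -expr2 -real_normK ?num_real//.
  have := bd (gam i) x (hg i); rewrite -/(Ni i) => h.
  by rewrite lerXn2r ?nnegrE//; exact: le_trans h.
move=> h.
have b0 := bounded_measurable_translation (- x) br.
have bh := bounded_measurable_translation (- (x + h)) br.
have bi i := bounded_measurable_translation (- x)
  (test_function_bounded_measurable (test_function_partial i tr)).
have bs : bounded_measurable (fun y : 'rV[R]_n => \sum_i h ord0 i * partial i rho (y - x)).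
  by apply: bounded_measurable_sum => i; exact: bounded_measurableZ.
have [i1 i2] := L1_row_sum (fun i => h ord0 i) (fun i => L1_bounded_mul (bi i) hw).
have -> : convolution rho w (x + h) - convolution rho w x -
    dot (\row_i convolution rho (gam i) x) h =
    \int[Leb]_y ((rho (y - (x + h)) + (-1) * rho (y - x) +
       \sum_i h ord0 i * partial i rho (y - x)) * w y).
  have -> : dot (\row_i convolution rho (gam i) x) h =
      - \int[Leb]_y ((\sum_i h ord0 i * partial i rho (y - x)) * w y).
    rewrite (_ : \int[Leb]_y _ = \sum_i h ord0 i * \int[Leb]_y (partial i rho (y - x) * w y)).
      by rewrite -sumrN; apply: eq_bigr => i _; rewrite mxE dconv mulNr mulrC.
    rewrite -i2; apply: eq_Rintegral => y _; rewrite mulr_suml.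
    by apply: eq_bigr => i _; rewrite mulrA.
  rewrite opprK /convolution -RintegralB//; try exact: L1_bounded_mul.
  rewrite -RintegralD//; last 2 first.
  - by apply: L1B; exact: L1_bounded_mul.
  - exact: L1_bounded_mul.
  by apply: eq_Rintegral => y _; ring.
apply: (@le_trans _ _ (C * dot h h * N)); last first.
  by have := dot_ge0 h => h0; rewrite mulrAC ler_wpM2r// lerDl.
apply: norm_Rintegral_bounded_mul => //.
  by apply: bounded_measurableD => //; apply: bounded_measurableD => //; exact: bounded_measurableZ.
move=> y; have [_ _ /(_ (- h))] := HC (y - x).
have -> : rho (y - x - h) - rho (y - x) - dot (gradient rho (y - x)) (- h) =
  rho (y - (x + h)) + -1 * rho (y - x) + \sum_i h ord0 i * partial i rho (y - x).
  rewrite mulN1r opprD addrA; congr (_ + _).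
  by rewrite dotNr opprK /dot; apply: eq_bigr => i _; rewrite gradientE mulrC.
by rewrite dotNl dotNr opprK.
Qed.

End mollification.

Section mollification_error.
Context {R : realType} {n : nat}.
Implicit Types (b rho w phi u : 'rV[R]_n -> R).
Local Notation Leb := (lebesgue_rV n).
Local Notation L1 f := (Leb.-integrable setT (EFin \o f)).

Lemma integral_EFin u : L1 u -> (\int[Leb]_x (u x)%:E = (\int[Leb]_x u x)%:E)%E.
Proof. by move=> hu; rewrite fineK//; exact: (integrable_fin_num measurableT hu). Qed.

Lemma L1_test_function phi : test_function phi -> L1 phi.
Proof.
move=> tp; have [r r0 pr] := test_function_support tp.
apply: integrable_bounded_support; split; first exact: test_function_measurable.
have [M _ HM] := test_function_bounded tp; exists M, r; split => // x j xj.
by apply: pr => /(_ j); rewrite in_itv/= -ler_norml leNgt xj.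
Qed.

(** Jensen's inequality for the probability density rho: expand the integral of
    rho (a - m)^2, which is nonnegative, with m the mean of a. *)
Lemma sqr_mean_le rho a : (forall x, 0 <= rho x) -> L1 rho ->
  \int[Leb]_z rho z = 1 -> L1 (fun z => rho z * a z) -> L1 (fun z => rho z * a z ^+ 2) ->
  (\int[Leb]_z (rho z * a z)) ^+ 2 <= \int[Leb]_z (rho z * a z ^+ 2).
Proof.
move=> r0 ir r1 i1 i2.
set m := \int[Leb]_z (rho z * a z).
rewrite -subr_ge0.
have -> : \int[Leb]_z (rho z * a z ^+ 2) - m ^+ 2 =
    \int[Leb]_z (rho z * a z ^+ 2 + (- (2 * m)) * (rho z * a z) + m ^+ 2 * rho z).
  have i3 := L1Z (- (2 * m)) i1; have i4 := L1Z (m ^+ 2) ir.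
  rewrite RintegralD//; last exact: L1D.
  by rewrite RintegralD// !RintegralZl// r1 -/m; ring.
apply: Rintegral_ge0 => z _.
have -> : rho z * a z ^+ 2 + - (2 * m) * (rho z * a z) + m ^+ 2 * rho z =
  rho z * (a z - m) ^+ 2 by ring.
by rewrite mulr_ge0 ?sqr_ge0.
Qed.

Lemma L1_sqrD u w : measurable_fun setT u -> measurable_fun setT w ->
  L1 (fun x => u x ^+ 2) -> L1 (fun x => w x ^+ 2) -> L1 (fun x => (u x + w x) ^+ 2).
Proof.
move=> mu mw u2 w2.
apply: (le_integrable measurableT _ _ (L1D (L1Z 2 u2) (L1Z 2 w2))).
  by apply/measurable_EFinP; apply: measurable_funX; exact: measurable_funD.
move=> x _ /=; rewrite lee_fin !ger0_norm ?sqr_ge0//; first exact: sqr_add_le.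
by rewrite addr_ge0// mulr_ge0 ?sqr_ge0.
Qed.

Lemma measurable_add_rV : measurable_fun setT (fun p : 'rV[R]_n * 'rV[R]_n => p.1 + p.2).
Proof.
apply: measurable_fun_coordP => i.
rewrite (_ : (fun x => _) = fun p : 'rV[R]_n * 'rV[R]_n => p.1 ord0 i + p.2 ord0 i); last first.
  by apply/funext => x; rewrite mxE.
apply: measurable_funD.
  exact: (measurableT_comp (measurable_coord i) (@measurable_fst _ _ _ _)).
exact: (measurableT_comp (measurable_coord i) (@measurable_snd _ _ _ _)).
Qed.

(** Jensen's inequality bounds the error by an average over the small cube of
    L^2 distances between w and its translates; Tonelli's theorem exchanges the
    average with the L^2 norm. *)
Lemma mollification_error rho w r d (e : R) : test_function rho -> (forall x, 0 <= rho x) ->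
  (forall x, ~ cube d x -> rho x = 0) -> \int[Leb]_z rho z = 1 ->
  0 < r -> measurable_fun setT w -> L1 (fun x => w x ^+ 2) ->
  (forall x, ~ cube r x -> w x = 0) -> 0 <= e ->
  (forall z, cube d z -> \int[Leb]_x ((w (x + z) - w x) ^+ 2) <= e) ->
  (\int[Leb]_x ((convolution rho w x - w x) ^+ 2)%:E <= e%:E)%E.
Proof.
move=> tr r0 rd r1 rp mw w2 wr e0 we.
have br := test_function_bounded_measurable tr; have [mr _] := br.
have ir := L1_test_function tr.
have hw := L1_of_sqr rp mw w2 wr.
have mwz (z : 'rV[R]_n) : measurable_fun setT (fun x : 'rV[R]_n => w (x + z)).
  exact: (measurableT_comp mw (measurable_translate z)).
have w2z (z : 'rV[R]_n) : L1 (fun x : 'rV[R]_n => w (x + z) ^+ 2) by exact: (L1_translation z w2).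
have flip (f : 'rV[R]_n -> R) (x : 'rV[R]_n) : (fun z => f (x + z)) = (fun z => f (z + x)).
  by apply/funext => z; rewrite addrC.
have w2x (x : 'rV[R]_n) : L1 (fun z : 'rV[R]_n => w (x + z) ^+ 2).
  by rewrite (flip (fun z => w z ^+ 2)); exact: (L1_translation x w2).
have iwx (x : 'rV[R]_n) : L1 (fun z : 'rV[R]_n => w (x + z)) by rewrite flip; exact: (L1_translation x hw).
pose A (x z : 'rV[R]_n) : R := rho z * (w (x + z) - w x) ^+ 2.
have A0 x z : 0 <= A x z by rewrite mulr_ge0 ?sqr_ge0.
have mA : measurable_fun setT (fun p : 'rV[R]_n * 'rV[R]_n => (A p.1 p.2)%:E).
  apply/measurable_EFinP; apply: measurable_funM.
    exact: (measurableT_comp mr (@measurable_snd _ _ _ _)).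
  apply: measurable_funX; apply: measurable_funB.
    exact: (measurableT_comp mw measurable_add_rV).
  exact: (measurableT_comp mw (@measurable_fst _ _ _ _)).
have Ap0 (q : 'rV[R]_n * 'rV[R]_n) : (0 <= (A q.1 q.2)%:E)%E by rewrite lee_fin.
have mFA := measurable_fun_fubini_tonelli_F (m2 := Leb) _ mA Ap0.
have mGA := measurable_fun_fubini_tonelli_G (m1 := Leb) _ mA Ap0.
apply: (@le_trans _ _ (\int[Leb]_x \int[Leb]_z (A x z)%:E)%E).
  apply: ge0_le_integral => //.
  - by move=> x _; rewrite lee_fin sqr_ge0.
  - apply/measurable_EFinP; apply: measurable_funX; apply: measurable_funB => //.
    exact: measurable_continuous_rV (convolution_continuous tr hw).
  move=> x _.
  have i1 := L1_bounded_mul br (iwx x); have i2 := L1_bounded_mul br (w2x x).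
  have i3 := L1Z (- w x) ir; have i4 := L1Z (- (2 * w x)) i1; have i5 := L1Z (w x ^+ 2) ir.
  have E1 z : rho z * (w (x + z) - w x) = rho z * w (x + z) + (- w x) * rho z by ring.
  have E2 z : A x z = rho z * w (x + z) ^+ 2 + (- (2 * w x)) * (rho z * w (x + z)) + w x ^+ 2 * rho z.
    by rewrite /A; ring.
  have i6 : L1 (fun z : 'rV[R]_n => rho z * (w (x + z) - w x)) by rewrite (funext E1); exact: L1D.
  have i7 : L1 (A x) by rewrite (funext E2); apply: L1D => //; exact: L1D.
  rewrite integral_EFin// lee_fin.
  have -> : convolution rho w x - w x = \int[Leb]_z (rho z * (w (x + z) - w x)).
    rewrite (eq_Rintegral _ (fun z _ => E1 z)) RintegralD// RintegralZl// r1.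
    by rewrite convolutionE//; ring.
  exact: sqr_mean_le.
rewrite (fubini_tonelli (fun p => (A p.1 p.2)%:E))//.
rewrite -[leRHS]mule1 -r1 -integral_EFin// -ge0_integralZl//; last 2 first.
- exact/measurable_EFinP.
- by move=> z _; rewrite lee_fin.
apply: ge0_le_integral => //.
- by move=> z _; apply: integral_ge0 => x _; rewrite lee_fin.
- by apply/measurable_EFinP; apply: measurable_funM.
move=> z _ /=.
have i8 : L1 (fun x : 'rV[R]_n => (w (x + z) - w x) ^+ 2).
  apply: L1_sqrD => //; first exact: measurable_funN.
  by under eq_fun do rewrite sqrrN.
under eq_integral => x _ do rewrite /A EFinM.
rewrite ge0_integralZl//; last 3 first.
- by apply/measurable_EFinP; apply: measurable_funX; exact: measurable_funB.
- by move=> x _; rewrite lee_fin sqr_ge0.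
- by rewrite lee_fin.
rewrite integral_EFin// -!EFinM lee_fin mulrC.
have [zd|zd] := pselect (cube d z); last by rewrite rd// !mulr0.
by rewrite ler_wpM2r//; exact: we.
Qed.
End mollification_error.

Section mollify.
Context {R : realType} {n : nat}.
Implicit Types (b rho w phi u : 'rV[R]_n -> R).
Local Notation Leb := (lebesgue_rV n).
Local Notation L1 f := (Leb.-integrable setT (EFin \o f)).

Lemma test_functionZ (a : R) phi : test_function phi -> test_function (fun x => a * phi x).
Proof. by apply: test_functionM; apply/smoothP => k; exact: Ck_cst. Qed.

Lemma mollifier (d : R) : 0 < d -> exists rho, [/\ test_function rho,
  (forall x, 0 <= rho x), (forall x, ~ cube d x -> rho x = 0) & \int[Leb]_x rho x = 1].
Proof.
move=> d0; have tb := @test_function_bump R n _ d0.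
set m := \int[Leb]_x @bump R n d x.
have m0 : 0 < m.
  pose c := (expR (- 2) * expR (- 2) : R) ^+ n.
  have c0 : 0 < c by rewrite exprn_gt0// mulr_gt0 ?expR_gt0.
  have d20 : 0 <= d / 2 by rewrite divr_ge0// ltW.
  have ic : L1 (\1_(@cube R n (d / 2))) by exact: integrable_cube.
  apply: (@lt_le_trans _ _ (\int[Leb]_x (c * \1_(@cube R n (d / 2)) x))).
    rewrite RintegralZl//.
    rewrite mulr_gt0// /Rintegral integral_indic//=; last exact: measurable_cube.
    rewrite setIT lebesgue_rV_cube//= exprn_gt0//; lra.
  apply: le_Rintegral => //; [exact: (L1Z c ic)|exact: L1_test_function|].
  move=> x _; rewrite indicE; have [xd|xd] := pselect (cube (d / 2) x).
    by rewrite mem_set// mulr1; exact: bump_lower.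
  by rewrite memNset// mulr0 bump_ge0.
exists (fun x => m^-1 * bump d x); split.
- exact: test_functionZ.
- by move=> x; rewrite mulr_ge0 ?bump_ge0// invr_ge0 ltW.
- by move=> x xd; rewrite bump_support// mulr0.
- by rewrite RintegralZl//; [rewrite mulVf// gt_eqF|exact: L1_test_function].
Qed.

Lemma common_radius (I : eqType) (s : seq I) (F : I -> R -> Prop) :
  (forall i d d', d' <= d -> F i d -> F i d') -> (forall i, exists2 d, 0 < d & F i d) ->
  exists2 d, 0 < d & forall i, i \in s -> F i d.
Proof.
move=> mono ex; elim: s => [|i s [M M0 HM]]; first by exists 1.
have [N N0 HN] := ex i; exists (Num.min M N); first by rewrite lt_min M0.
move=> j; rewrite in_cons => /predU1P[->|js]; first by apply: mono HN; rewrite ge_min lexx orbT.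
by apply: mono (HM _ js); rewrite ge_min lexx.
Qed.

Lemma convolution_support rho w r d x : (forall y, ~ cube d y -> rho y = 0) ->
  (forall y, ~ cube r y -> w y = 0) -> ~ cube (r + d) x -> convolution rho w x = 0.
Proof.
move=> rd wr xrd; rewrite /convolution.
have E y : rho (y - x) * w y = 0.
  have [h1|h1] := pselect (cube d (y - x)); last by rewrite rd// mul0r.
  have [h2|h2] := pselect (cube r y); last by rewrite wr// mulr0.
  exfalso; apply: xrd => i; move: (h1 i) (h2 i); rewrite !in_itv/= -!ler_norml !mxE => a1 a2.
  have -> : x ord0 i = y ord0 i - (y ord0 i - x ord0 i) by ring.
  by apply: le_trans (ler_normB _ _) _; apply: lerD.
by rewrite (eq_Rintegral _ (fun y _ => E y)) Rintegral_cst// mul0r.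
Qed.

(** One mollifier serves the function and all its weak derivatives: take the
    smallest of the finitely many moduli of continuity of translations. *)
Lemma mollify w (gam : 'I_n -> 'rV[R]_n -> R) r (e : R) : 0 < r -> 0 < e ->
  measurable_fun setT w -> L1 (fun x => w x ^+ 2) -> (forall x, ~ cube r x -> w x = 0) ->
  (forall i, measurable_fun setT (gam i)) -> (forall i, L1 (fun x => gam i x ^+ 2)) ->
  (forall i x, ~ cube r x -> gam i x = 0) ->
  (forall phi i, test_function phi ->
     \int[Leb]_x (w x * partial i phi x) = - \int[Leb]_x (gam i x * phi x)) ->
  exists F, exists G : 'rV[R]_n -> 'rV[R]_n, [/\ C11 F G,
    (forall x, ~ cube (r + 1) x -> F x = 0 /\ G x = 0),
    (\int[Leb]_x ((F x - w x) ^+ 2)%:E <= e%:E)%E &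
    forall i, (\int[Leb]_x ((G x ord0 i - gam i x) ^+ 2)%:E <= e%:E)%E].
Proof.
move=> r0 e0 mw w2 w0 mg g2 g0 weak.
have [d1 d10 H1] := L2_translation_continuous r0 mw w2 w0 e0.
have [||d2 d20 H2] := @common_radius _ (enum 'I_n)
  (fun i d => forall z, cube d z -> \int[Leb]_x ((gam i (x + z) - gam i x) ^+ 2) <= e).
- by move=> i d d' dd' h z zd; apply: h; exact: cube_sub zd.
- by move=> i; have [d d0 h] := L2_translation_continuous r0 (mg i) (g2 i) (g0 i) e0; exists d.
pose d := Num.min 1 (Num.min d1 d2).
have d0 : 0 < d by rewrite !lt_min ltr01 d10.
have dd1 : d <= d1 by rewrite !ge_min lexx orbT.
have dd2 : d <= d2 by rewrite !ge_min lexx !orbT.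
have [rho [tr rho0 rd r1]] := mollifier d0.
exists (convolution rho w), (fun x => \row_i convolution rho (gam i) x).
have supp u : (forall x, ~ cube r x -> u x = 0) -> forall x, ~ cube (r + 1) x -> convolution rho u x = 0.
  move=> u0 x xr; apply: (convolution_support rd u0); apply: contra_not xr.
  by apply: cube_sub; rewrite lerD2l ge_min lexx.
split.
- apply: C11_convolution => //; first exact: L1_of_sqr w0.
  by move=> i; exact: (L1_of_sqr r0 (mg i) (g2 i) (g0 i)).
- move=> x xr; split; first exact: supp.
  by apply/rowP => i; rewrite !mxE; apply: supp => // y; exact: g0.
- apply: (mollification_error tr rho0 rd r1 r0 mw w2 w0 (ltW e0)) => z zd.
  by apply: H1; exact: cube_sub zd.
- move=> i; under eq_integral do rewrite mxE.
  apply: (mollification_error tr rho0 rd r1 r0 (mg i) (g2 i) (g0 i) (ltW e0)) => z zd.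
  by apply: H2; [rewrite mem_enum|exact: cube_sub zd].
Qed.

End mollify.

(** * Density of C^{1,1} functions of compact support *)

Section cutoff.
Context {R : realType} {n : nat}.

Definition cutoff (k : nat) (x : 'rV[R]_n) : R := (@bump R n 1 0)^-1 * bump k.+1%:R x.

Lemma bump_scaling (e : R) (x : 'rV[R]_n) : bump e x = bump 1 (e^-1 *: x).
Proof.
apply: eq_bigr => i _.
by have -> : (e^-1 *: x) ord0 i / 1 = x ord0 i / e by rewrite mxE divr1 mulrC.
Qed.

Lemma bump0_gt0 : 0 < @bump R n 1 0.
Proof.
apply: (@lt_le_trans _ _ ((expR (- 2) * expR (- 2) : R) ^+ n)).
  by rewrite exprn_gt0// mulr_gt0 ?expR_gt0.
by apply: bump_lower => // i; rewrite mxE in_itv/=; apply/andP; split; lra.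
Qed.

Lemma test_function_cutoff k : test_function (cutoff k).
Proof. by apply: test_functionZ; exact: test_function_bump. Qed.

Lemma norm_cutoff_le k x : `|cutoff k x| <= (@bump R n 1 0)^-1.
Proof.
rewrite /cutoff normrM !ger0_norm ?bump_ge0 ?invr_ge0 ?(ltW bump0_gt0)//.
by rewrite ler_piMr ?bump_le1// invr_ge0 ltW// bump0_gt0.
Qed.

Lemma cutoff_support k x : ~ cube k.+1%:R x -> cutoff k x = 0.
Proof. by move=> xk; rewrite /cutoff (bump_support _ xk) ?mulr0//. Qed.

Lemma cutoff_cvg x : cutoff k x @[k --> \oo] --> (1 : R).
Proof.
have b0 := bump0_gt0.
rewrite -(mulVf (lt0r_neq0 b0)) /cutoff; apply: cvgMl_tmp.
under eq_fun do rewrite bump_scaling.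
have c : (@bump R n 1) y @[y --> (0 : 'rV[R]_n)] --> bump 1 (0 : 'rV[R]_n).
  exact: (@smooth_continuous _ _ _ (smooth_bump 1) 0).
apply: (@cvg_comp _ _ _ (fun k : nat => k.+1%:R^-1 *: x) (@bump R n 1) _ (nbhs (0 : 'rV[R]_n))); last exact: c.
apply/cvg_ballP => e e0.
pose S := \sum_i `|x ord0 i| + 1.
have S0 : 0 < S by rewrite /S ltr_wpDl// sumr_ge0.
near=> k; split => // i j; rewrite (ord1 i) /ball/= !mxE sub0r normrN normrM.
have k0 : 0 < k.+1%:R :> R by [].
rewrite gtr0_norm ?invr_gt0// mulrC ltr_pdivrMr//.
apply: (@le_lt_trans _ _ S).
  by rewrite /S (bigD1 j)//= -addrA lerDl addr_ge0// sumr_ge0.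
rewrite mulrC -ltr_pdivrMr//.
near: k; apply: filterS (nbhs_infty_gtr (S / e)) => k /lt_trans; apply.
by rewrite ltr_nat.
Unshelve. all: by end_near. Qed.

Lemma partial_cutoff_le : exists2 L, 0 <= L &
  forall k i x, `|partial i (cutoff k) x| <= L / k.+1%:R.
Proof.
have tb : test_function (@bump R n 1) by exact: test_function_bump.
have [||L L0 HL] := @common_bound R _ (enum 'I_n) (fun i M => forall x, `|partial i (@bump R n 1) x| <= M).
- by move=> i M M' MM' h x; exact: le_trans MM'.
- by move=> i; have [M _ h] := test_function_bounded (test_function_partial i tb); exists M.
have b0 := bump0_gt0.
exists ((@bump R n 1 0)^-1 * L); first by rewrite mulr_ge0// invr_ge0 ltW.
move=> k i x.
have -> : partial i (cutoff k) = fun x => (@bump R n 1 0)^-1 * (k.+1%:R^-1 * partial i (@bump R n 1) (k.+1%:R^-1 *: x)).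
  have E1 : (fun x : 'rV[R]_n => bump 1 (k.+1%:R^-1 *: x)) = bump k.+1%:R.
    by apply/funext => z; rewrite -bump_scaling.
  have E2 := @partial_scaling _ _ (@bump R n 1) k.+1%:R^-1 i (smooth_differentiable (smooth_bump 1)).
  rewrite E1 in E2; apply/funext => y.
  rewrite /cutoff partialM; [|by move=> z; exact: differentiable_cst|].
    by rewrite partial_cst mulr0 addr0 E2.
  exact/smooth_differentiable/smooth_bump.
have bb : 0 <= (@bump R n 1 0)^-1 by rewrite invr_ge0 ltW.
have kk : 0 <= k.+1%:R^-1 :> R by rewrite invr_ge0.
rewrite !normrM (ger0_norm bb) (ger0_norm kk) -mulrA ler_wpM2l//.
by rewrite mulrC ler_wpM2r// HL// mem_enum.
Qed.

End cutoff.

Section density.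
Context {R : realType} {n : nat}.
Variables (V : 'rV[R]_n -> R) (Z : R) (mu : probability 'rV[R]_n R).
Hypotheses (sV : smooth V) (gV : gibbs_measure V Z mu).
Implicit Types (f u v : 'rV[R]_n -> R) (g : 'rV[R]_n -> 'rV[R]_n).
Local Notation Leb := (lebesgue_rV n).
Local Notation L1 f := (Leb.-integrable setT (EFin \o f)).

Lemma L2_dominated_cvg0 (b : nat -> 'rV[R]_n -> R) f (M : R) : L2 mu f ->
  (forall k, bounded_measurable (b k)) -> (forall k x, `|b k x| <= M) ->
  (forall x, b k x @[k --> \oo] --> (0 : R)) ->
  \int[mu]_x ((b k x * f x) ^+ 2) @[k --> \oo] --> (0 : R).
Proof.
move=> [mf f2] mb bM b0.
have [||||_] := @dominated_cvg_Rintegral _ _ _ mu (fun k x => (b k x * f x) ^+ 2) (cst 0)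
  (fun x => M ^+ 2 * f x ^+ 2).
- by move=> k; apply: measurable_funX; apply: measurable_funM => //; case: (mb k).
- move=> x; rewrite [cst 0 x](_ : _ = (0 * f x) * (0 * f x)); last by rewrite !mul0r.
  by under eq_fun do rewrite expr2; apply: cvgM; apply: cvgMr_tmp; exact: b0.
- exact: integrable_scale.
- move=> k x; rewrite ger0_norm ?sqr_ge0// exprMn ler_wpM2r ?sqr_ge0//.
  rewrite -(real_normK (num_real (b k x))) lerXn2r ?nnegrE//.
  exact: le_trans (bM k x).
by rewrite Rintegral_cst// mul0r.
Qed.

Lemma L1_mul_test u f : L2 mu u -> test_function f -> L1 (fun x => u x * f x).
Proof.
move=> u2 tf; have q2 := L2_density_quotient Z mu sV tf.
have mq : measurable_fun setT (fun x => u x * density_quotient V Z f x).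
  by apply: measurable_funM; [case: u2|case: q2].
have := (integrable_gibbs sV gV mq).1 (integrable_ip u2 q2).
rewrite (_ : (fun x => _ * gibbs_density V Z x) = fun x => u x * f x)//.
by apply/funext => x; rewrite -mulrA (density_quotientE gV).
Qed.

(** The density is bounded below on cubes. *)
Lemma L1_sqr_local f r : L2 mu f -> (forall x, ~ cube r x -> f x = 0) ->
  L1 (fun x => f x ^+ 2).
Proof.
move=> [mf f2] f0; have := (integrable_gibbs sV gV (measurable_funX 2 mf)).1 f2.
have [M M0 HM] := continuous_bounded_cube r (smooth_continuous sV).
have Z0 : 0 < Z by case: gV.
move/(L1Z (Z * expR M)); apply: (le_integrable measurableT).
  by apply/measurable_EFinP; exact: measurable_funX.
move=> x _ /=; rewrite lee_fin ger0_norm ?sqr_ge0//.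
have [xr|xr] := pselect (cube r x); last by rewrite f0// expr0n/= normr_ge0.
apply: le_trans (ler_norm _).
have -> : Z * expR M * (f x ^+ 2 * gibbs_density V Z x) = (expR (M - V x)) * f x ^+ 2.
  by rewrite /gibbs_density expRD; field; rewrite gt_eqF.
rewrite ler_peMl ?sqr_ge0// -expR0 ler_expR subr_ge0.
by apply: le_trans (HM x xr); exact: ler_norm.
Qed.

(** The density is bounded above on cubes. *)
Lemma L2_local f r (e Pm : R) : measurable_fun setT f -> (forall x, ~ cube r x -> f x = 0) ->
  0 <= e -> 0 <= Pm -> (forall x, cube r x -> gibbs_density V Z x <= Pm) ->
  (\int[Leb]_x (f x ^+ 2)%:E <= e%:E)%E ->
  L2 mu f /\ \int[mu]_x (f x ^+ 2) <= Pm * e.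
Proof.
move=> mf f0 e0 Pm0 HP he.
have p0 x := ltW (gibbs_density_gt0 gV x).
have h : (\int[mu]_x (f x ^+ 2)%:E <= (Pm * e)%:E)%E.
  rewrite (integral_gibbs sV gV); last exact: measurable_funX.
  rewrite EFinM; apply: le_trans (lee_pmul _ _ (lexx _) he); rewrite ?lee_fin//; last first.
    by apply: integral_ge0 => x _; rewrite lee_fin sqr_ge0.
  rewrite -ge0_integralZl//; last 2 first.
  - by apply/measurable_EFinP; exact: measurable_funX.
  - by move=> x _; rewrite lee_fin sqr_ge0.
  apply: ge0_le_integral => //.
  - by move=> x _; rewrite lee_fin mulr_ge0 ?sqr_ge0.
  - apply/measurable_EFinP; apply: measurable_funM; first exact: measurable_funX.
    exact: measurable_gibbs_density.
  - by apply/measurable_EFinP; apply: measurable_funM => //; exact: measurable_funX.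
  move=> x _ /=; rewrite lee_fin mulrC.
  have [xr|xr] := pselect (cube r x); first by rewrite ler_wpM2r ?sqr_ge0// HP.
  by rewrite f0// expr0n/= !mulr0.
have i : mu.-integrable setT (EFin \o (fun x => f x ^+ 2)).
  apply/integrableP; split; first by apply/measurable_EFinP; exact: measurable_funX.
  under eq_integral => x _ do rewrite /= ger0_norm ?sqr_ge0//.
  by apply: le_lt_trans h _; exact: ltry.
split; first by split.
rewrite -lee_fin; apply: le_trans h; rewrite fineK//.
exact: (integrable_fin_num measurableT i).
Qed.

Lemma Rintegral_sqrD_le u v : L2 mu u -> L2 mu v ->
  \int[mu]_x ((u x + v x) ^+ 2) <= 2 * \int[mu]_x (u x ^+ 2) + 2 * \int[mu]_x (v x ^+ 2).
Proof.
move=> hu hv; have [_ u2] := hu; have [_ v2] := hv.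
have i1 := integrable_scale 2 u2; have i2 := integrable_scale 2 v2.
rewrite -!RintegralZl// -RintegralD//.
apply: le_Rintegral => //; first by case: (L2D hu hv).
  exact: integrable_add.
by move=> x _; exact: sqr_add_le.
Qed.

(** The Leibniz rule for a weak gradient: test the identity of u against the
    product of the cutoff and the test function. *)
Lemma cutoff_weak_gradient u g k : H1 mu u g ->
  forall phi i, test_function phi ->
  \int[Leb]_x ((cutoff k x * u x) * partial i phi x) =
  - \int[Leb]_x ((cutoff k x * g x ord0 i + partial i (cutoff k) x * u x) * phi x).
Proof.
move=> ug phi i tphi; have [_ _ weak] := ug; have /(H1P sV gV)[u2 g2 _] := ug.
have tc := @test_function_cutoff R n k.
have sc := test_function_smooth tc; have sp := test_function_smooth tphi.
have t1 := test_functionM sc tphi.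
have t2 := test_functionM sc (test_function_partial i tphi).
have t3 := test_functionM sp (test_function_partial i tc).
have i1 := L1_mul_test u2 t2; have i2 := L1_mul_test u2 t3.
have i3 := L1_mul_test (g2 i) t1.
have := weak _ i t1.
rewrite partialM; [|exact: smooth_differentiable|exact: smooth_differentiable].
have -> : \int[Leb]_x (u x * (cutoff k x * partial i phi x + phi x * partial i (cutoff k) x)) =
    \int[Leb]_x (u x * (cutoff k x * partial i phi x)) +
    \int[Leb]_x (u x * (phi x * partial i (cutoff k) x)).
  by rewrite -RintegralD//; apply: eq_Rintegral => x _; rewrite mulrDr.
have -> : \int[Leb]_x ((cutoff k x * g x ord0 i + partial i (cutoff k) x * u x) * phi x) =
    \int[Leb]_x (g x ord0 i * (cutoff k x * phi x)) +
    \int[Leb]_x (u x * (phi x * partial i (cutoff k) x)).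
  by rewrite -RintegralD//; apply: eq_Rintegral => x _; ring.
have -> : \int[Leb]_x ((cutoff k x * u x) * partial i phi x) =
    \int[Leb]_x (u x * (cutoff k x * partial i phi x)).
  by apply: eq_Rintegral => x _; ring.
by move=> h; rewrite opprD -h addrK.
Qed.

(** Truncate by a smooth cutoff, then mollify; both steps converge in L^2(mu)
    because the density is bounded above and below on cubes. *)
Lemma H1_dense u g (e : R) : H1 mu u g -> 0 < e ->
  exists F, exists G : 'rV[R]_n -> 'rV[R]_n, exists r, [/\ C11 F G,
    (forall x, ~ cube r x -> F x = 0 /\ G x = 0),
    \int[mu]_x ((F x - u x) ^+ 2) <= e &
    forall i, \int[mu]_x ((G x ord0 i - g x ord0 i) ^+ 2) <= e].
Proof.
move=> ug e0; have /(H1P sV gV)[u2 g2 _] := ug.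
have e16 : 0 < e / 16 by rewrite divr_gt0.
have bc k := test_function_bounded_measurable (@test_function_cutoff R n k).
have bp k i := test_function_bounded_measurable
  (test_function_partial i (@test_function_cutoff R n k)).
have bc1 k : bounded_measurable (fun x => @cutoff R n k x + -1).
  by apply: bounded_measurableD => //; exact: bounded_measurable_cst.
have lim1 f : L2 mu f -> \forall k \near \oo, \int[mu]_x (((cutoff k x + -1) * f x) ^+ 2) <= e / 16.
  move=> f2.
  have bd k x : `|@cutoff R n k x + -1| <= (@bump R n 1 0)^-1 + 1.
    by apply: le_trans (ler_normD _ _) _; rewrite normrN1 lerD2r norm_cutoff_le.
  have lim x : @cutoff R n k x + -1 @[k --> \oo] --> (0 : R).
    by rewrite -[X in _ --> X](subrr 1); apply: cvgD; [exact: cutoff_cvg|exact: cvg_cst].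
  have /cvgrPdist_le/(_ _ e16) := L2_dominated_cvg0 f2 bc1 bd lim.
  by apply: filterS => k; rewrite sub0r normrN; exact: le_trans (ler_norm _).
have lim2 i : \forall k \near \oo, \int[mu]_x ((partial i (cutoff k) x * u x) ^+ 2) <= e / 16.
  have [L L0 HL] := @partial_cutoff_le R n.
  have k1 k : k.+1%:R^-1 <= 1 :> R by rewrite invf_le1// ler1n.
  have bd k x : `|partial i (@cutoff R n k) x| <= L.
    by apply: le_trans (HL k i x) _; rewrite ler_piMr.
  have lim0 : L / k.+1%:R @[k --> \oo] --> (0 : R).
    by rewrite -(mulr0 L); apply: cvgMl_tmp; exact: (@cvg_harmonic R).
  have lim x : partial i (@cutoff R n k) x @[k --> \oo] --> (0 : R).
    apply: (@squeeze_cvgr _ _ _ _ (fun k : nat => - (L / k.+1%:R)) (fun k : nat => L / k.+1%:R)).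
    - by apply: nearW => k; rewrite -ler_norml.
    - by rewrite -oppr0; exact: cvgN.
    - exact: lim0.
  have /cvgrPdist_le/(_ _ e16) := @L2_dominated_cvg0 (fun k => partial i (cutoff k)) u L u2 (bp ^~ i) bd lim.
  by apply: filterS => k; rewrite sub0r normrN; exact: le_trans (ler_norm _).
have [k [c1 c2 c3]] : exists k : nat, [/\
    \int[mu]_x (((cutoff k x + -1) * u x) ^+ 2) <= e / 16,
    forall i, \int[mu]_x (((cutoff k x + -1) * g x ord0 i) ^+ 2) <= e / 16 &
    forall i, \int[mu]_x ((partial i (cutoff k) x * u x) ^+ 2) <= e / 16].
  have A1 : \forall k \near \oo, forall i, \int[mu]_x (((cutoff k x + -1) * g x ord0 i) ^+ 2) <= e / 16.
    exact: (@filter_forall _ 'I_n _ _ _ (fun i => lim1 _ (g2 i))).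
  have A2 : \forall k \near \oo, forall i, \int[mu]_x ((partial i (cutoff k) x * u x) ^+ 2) <= e / 16.
    exact: (@filter_forall _ 'I_n _ _ _ lim2).
  have [k [h1 [h2 h3]]] := filter_ex (filterI (lim1 _ u2) (filterI A1 A2)).
  by exists k.
pose K : R := k.+1%:R; have K0 : 0 < K by [].
pose w x := cutoff k x * u x.
pose gam i x := cutoff k x * g x ord0 i + partial i (cutoff k) x * u x.
have w2 : L2 mu w by exact: L2M.
have gam2 i : L2 mu (gam i) by apply: L2D; exact: L2M.
have w0 x : ~ cube K x -> w x = 0 by move=> xk; rewrite /w cutoff_support// mul0r.
have gam0 i x : ~ cube K x -> gam i x = 0.
  move=> xk; rewrite /gam cutoff_support// mul0r add0r.
  by rewrite (partial_support _ _ xk) ?mul0r// => y; exact: cutoff_support.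
have [Pm Pm0 HP] := continuous_bounded_cube (K + 1) (gibbs_density_continuous (Z := Z) sV).
pose e' := e / (16 * (Pm + 1)).
have P1 : 0 < 16 * (Pm + 1) by rewrite mulr_gt0//; lra.
have e'0 : 0 < e' by rewrite divr_gt0.
have Pe : Pm * e' <= e / 16.
  have -> : e / 16 = (Pm + 1) * e' by rewrite /e'; field; lra.
  by rewrite ler_wpM2r ?(ltW e'0)// lerDl.
have mw : measurable_fun setT w by case: w2.
have mg i : measurable_fun setT (gam i) by case: (gam2 i).
have [F [G [FG supp Fw Gg]]] := mollify K0 e'0 mw (L1_sqr_local w2 w0) w0 mg
  (fun i => L1_sqr_local (gam2 i) (gam0 i)) gam0 (cutoff_weak_gradient k ug).
have [mF mG _] := FG.
have {}HP x : cube (K + 1) x -> gibbs_density V Z x <= Pm.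
  by move=> /HP; apply: le_trans; exact: ler_norm.
have cK x : ~ cube (K + 1) x -> ~ cube K x.
  by apply: contra_not; apply: cube_sub; rewrite lerDl.
have [Fw2 Fwe] : L2 mu (fun x => F x - w x) /\ \int[mu]_x ((F x - w x) ^+ 2) <= Pm * e'.
  apply: (@L2_local _ (K + 1)) => //; try exact: ltW.
    exact: measurable_funB.
  by move=> x xk; rewrite (supp _ xk).1 w0 ?subrr//; exact: cK.
have Gge i : L2 mu (fun x => G x ord0 i - gam i x) /\
    \int[mu]_x ((G x ord0 i - gam i x) ^+ 2) <= Pm * e'.
  apply: (@L2_local _ (K + 1)) => //; try exact: ltW.
    exact: measurable_funB.
  by move=> x xk; rewrite (supp _ xk).2 mxE gam0 ?subrr//; exact: cK.
exists F, G, (K + 1); split => //.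
- have E x : F x - u x = (F x - w x) + (cutoff k x + -1) * u x by rewrite /w; ring.
  under eq_Rintegral do rewrite E.
  apply: le_trans (Rintegral_sqrD_le Fw2 (L2M (bc1 k) u2)) _; lra.
move=> i; have [Gg2 Gge2] := Gge i.
have a2 : L2 mu (fun x => (cutoff k x + -1) * g x ord0 i) by exact: L2M.
have b2 : L2 mu (fun x => partial i (cutoff k) x * u x) by exact: L2M.
have E x : G x ord0 i - g x ord0 i = (G x ord0 i - gam i x) +
    ((cutoff k x + -1) * g x ord0 i + partial i (cutoff k) x * u x) by rewrite /gam; ring.
under eq_Rintegral do rewrite E.
apply: le_trans (Rintegral_sqrD_le Gg2 (L2D a2 b2)) _.
have := Rintegral_sqrD_le a2 b2; have := c2 i; have := c3 i; lra.
Qed.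

End density.

(** * The Poincare inequality on the Sobolev space *)

Section poincare_H1.
Context {R : realType} {n : nat}.
Variables (V : 'rV[R]_n -> R) (Z : R) (mu : probability 'rV[R]_n R).
Hypotheses (sV : smooth V) (gV : gibbs_measure V Z mu).
Implicit Types (f u v : 'rV[R]_n -> R) (g h : 'rV[R]_n -> 'rV[R]_n).

Lemma Rintegral_dot g h : (forall i, L2 mu (fun x => g x ord0 i)) ->
  (forall i, L2 mu (fun x => h x ord0 i)) ->
  \int[mu]_x dot (g x) (h x) =
  \sum_i ip mu (fun x => g x ord0 i) (fun x => h x ord0 i).
Proof.
move=> hg hh; have [_] := @Rintegral_sum _ _ _ mu _ (index_enum 'I_n)
  (fun i x => g x ord0 i * h x ord0 i) (fun i => integrable_ip (hg i) (hh i)).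
by [].
Qed.

Lemma C11_L2 F G : C11 F G -> L2 mu F /\ forall i, L2 mu (fun x => G x ord0 i).
Proof.
by move=> FG; split=> [|i]; apply: L2_bounded; [exact: C11_bounded_fun FG|exact: C11_bounded_coord FG].
Qed.

Lemma sqr_le_of_close (a b : R) : a ^+ 2 <= 2 * b ^+ 2 + 2 * (b - a) ^+ 2.
Proof. by have := sqr_ge0 (2 * b - a); nra. Qed.

Lemma ip_le_of_close f u : L2 mu f -> L2 mu u ->
  ip mu u u <= 2 * ip mu f f + 2 * \int[mu]_x ((f x - u x) ^+ 2).
Proof.
move=> hf hu; have hd := L2B hf hu.
have := Rintegral_sqrD_le hf (L2N hd); rewrite !ip_sqr.
under [X in X <= _]eq_Rintegral do rewrite opprB addrC subrK.
by under [X in _ <= _ + _ * X]eq_Rintegral do rewrite sqrrN.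
Qed.

(** The factor 4 comes from (a + b)^2 <= 2 a^2 + 2 b^2, used once for u and once
    for its gradient and its mean against chi; the density of compactly supported
    functions makes the errors disappear. *)
Lemma poincare_density (K A : R) (chi : 'rV[R]_n -> R) : 0 <= K -> 0 <= A ->
  bounded_measurable chi ->
  (forall F G r, C11 F G -> (forall x, ~ cube r x -> F x = 0 /\ G x = 0) ->
     ip mu F F <= K * \int[mu]_x dot (G x) (G x) + A * ip mu F chi ^+ 2) ->
  forall u g, H1 mu u g ->
  ip mu u u <= 4 * (K * \int[mu]_x dot (g x) (g x) + A * ip mu u chi ^+ 2).
Proof.
move=> K0 A0 bchi hK u g ug; have /(H1P sV gV)[u2 g2 _] := ug.
have c2 := L2_bounded mu bchi.
pose c := ip mu chi chi; have cc : 0 <= c by exact: ip_ge0.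
pose M := 2 + 4 * (K * n%:R) + 4 * (A * c).
have M0 : 0 < M by rewrite /M; have := mulr_ge0 K0 (ler0n R n); have := mulr_ge0 A0 cc; lra.
apply/ler_addgt0Pr => e e0.
have e1 : 0 < e / M by exact: divr_gt0.
have [F [G [r [FG supp Fu Gg]]]] := H1_dense sV gV ug e1.
have [F2 G2] := C11_L2 FG.
have h1 := ip_le_of_close F2 u2.
have h2 := hK F G r FG supp.
have h3 : \int[mu]_x dot (G x) (G x) <= 2 * \int[mu]_x dot (g x) (g x) + 2 * (n%:R * (e / M)).
  have -> : n%:R * (e / M) = \sum_(i < n) e / M by rewrite sumr_const card_ord mulr_natl.
  rewrite !Rintegral_dot// !mulr_sumr -big_split/=.
  apply: ler_sum => i _; apply: le_trans (ip_le_of_close (g2 i) (G2 i)) _.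
  rewrite lerD2l ler_wpM2l//; apply: le_trans (Gg i).
  by rewrite le_eqVlt; apply/orP; left; apply/eqP; apply: eq_Rintegral => x _; rewrite -sqrrN opprB.
have h4 : ip mu F chi ^+ 2 <= 2 * ip mu u chi ^+ 2 + 2 * (e / M * c).
  apply: le_trans (sqr_le_of_close _ (ip mu u chi)) _.
  rewrite lerD2l ler_wpM2l// -ipBl//.
  apply: le_trans (cauchy_schwarz (L2B u2 F2) c2) _; rewrite ler_wpM2r// ip_sqr.
  apply: le_trans Fu.
  by rewrite le_eqVlt; apply/orP; left; apply/eqP; apply: eq_Rintegral => x _; rewrite -sqrrN opprB.
have h5 := ler_wpM2l K0 h3; have h6 := ler_wpM2l A0 h4.
set X := \int[mu]_x dot (g x) (g x) in h5 *; set Y := ip mu u chi ^+ 2 in h6 *.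
set D := \int[mu]_x dot (G x) (G x) in h2 h5; set E := ip mu F chi ^+ 2 in h2 h6.
set q := e / M in h1 Fu h5 h6.
have eq : e = M * q by rewrite /q mulrC divfK// gt_eqF.
rewrite eq /M.
have -> : (2 + 4 * (K * n%:R) + 4 * (A * c)) * q = 2 * q + 4 * (K * (n%:R * q)) + 4 * (A * (q * c)) by ring.
move: h5 h6; rewrite !mulrDr => h5 h6.
have b1 : K * (2 * X) = 2 * (K * X) by ring.
have b2 : K * (2 * (n%:R * q)) = 2 * (K * (n%:R * q)) by ring.
have b3 : A * (2 * Y) = 2 * (A * Y) by ring.
have b4 : A * (2 * (q * c)) = 2 * (A * (q * c)) by ring.
rewrite b1 b2 in h5; rewrite b3 b4 in h6.
lra.
Qed.

Lemma gibbs_mass_pos (chi : 'rV[R]_n -> R) (d : R) : 0 < d -> bounded_measurable chi ->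
  (forall x, 0 <= chi x) -> (forall x, cube d x -> chi x = 1) -> 0 < \int[mu]_x chi x.
Proof.
move=> d0 bchi chi0 chi1; have mchi : measurable_fun setT chi by case: bchi.
have [M M0 HM] := continuous_bounded_cube d (smooth_continuous sV).
have Z0 : 0 < Z by case: gV.
pose c := Z^-1 * expR (- M); have c0 : 0 < c by rewrite mulr_gt0 ?invr_gt0 ?expR_gt0.
have ic : (lebesgue_rV n).-integrable setT (EFin \o (\1_(@cube R n d) : 'rV[R]_n -> R)).
  exact: integrable_cube (ltW d0).
rewrite (Rintegral_gibbs sV gV)//.
apply: (@lt_le_trans _ _ (\int[lebesgue_rV n]_x (c * \1_(@cube R n d) x))).
  rewrite RintegralZl//.
  rewrite mulr_gt0// /Rintegral integral_indic//=; last exact: measurable_cube.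
  rewrite setIT lebesgue_rV_cube//= ?(ltW d0)// exprn_gt0//; lra.
apply: le_Rintegral => //; first exact: (L1Z c ic).
  apply/(integrable_gibbs sV gV mchi).1/L2_integrable; exact: L2_bounded.
move=> x _; rewrite indicE; have [xd|xd] := pselect (cube d x); last first.
  by rewrite memNset// mulr0 mulr_ge0// ltW// (gibbs_density_gt0 gV).
rewrite mem_set// chi1// mulr1 mul1r /c /gibbs_density ler_pM2l ?invr_gt0//.
by rewrite ler_expR lerN2; apply: le_trans (HM x xd); exact: ler_norm.
Qed.

(** Subtract from u the constant that makes its mean against chi vanish; the
    variance is not larger than the distance to that constant. *)
Lemma poincare_H1 (K A d : R) (chi : 'rV[R]_n -> R) : 0 <= K -> 0 <= A -> 0 < d ->
  bounded_measurable chi -> (forall x, 0 <= chi x) -> (forall x, cube d x -> chi x = 1) ->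
  (forall F G r, C11 F G -> (forall x, ~ cube r x -> F x = 0 /\ G x = 0) ->
     ip mu F F <= K * \int[mu]_x dot (G x) (G x) + A * ip mu F chi ^+ 2) ->
  forall u g, H1 mu u g ->
  ip mu u u - (\int[mu]_x u x) ^+ 2 <= 4 * K * \int[mu]_x dot (g x) (g x).
Proof.
move=> K0 A0 d0 bchi chi0 chi1 hK u g ug; have /(H1P sV gV)[u2 g2 _] := ug.
have c2 := L2_bounded mu bchi.
have m0 := gibbs_mass_pos d0 bchi chi0 chi1; set C := \int[mu]_x chi x in m0.
pose m := ip mu u chi / C.
have ug' := H1D sV gV ug (H1_cst sV gV (- m)).
have one := L2_cst mu 1.
have E1 : ip mu (fun x => u x + - m) chi = 0.
  rewrite ipDl//; last exact: L2_cst.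
  have -> : ip mu (fun=> - m) chi = - m * C.
    by rewrite /ip /C -RintegralZl//; exact: L2_integrable.
  by rewrite /m; field; rewrite gt_eqF.
have := poincare_density K0 A0 bchi hK ug'.
rewrite E1 expr0n/= mulr0 addr0 mulrA.
under [X in _ <= _ * X -> _]eq_Rintegral do rewrite addr0.
apply: le_trans.
have mc := L2_cst mu (- m).
rewrite ipDl//; last exact: L2D.
rewrite !ipDr//.
have mE (f : 'rV[R]_n -> R) : L2 mu f -> ip mu (fun=> - m) f = - m * \int[mu]_x f x.
  by move=> hf; rewrite /ip -RintegralZl//; exact: L2_integrable.
rewrite (ipC _ u (fun=> - m)) !mE//.
have -> : \int[mu]_x (- m) = - m.
  by rewrite Rintegral_cst//= ?probability_setT/= ?mulr1.
by have := sqr_ge0 (\int[mu]_x u x - m); nra.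
Qed.

End poincare_H1.

(** * Coercive forms and resolvents *)

Section resolvent.
Context {R : realType} {n : nat}.
Variables (V : 'rV[R]_n -> R) (Z : R) (mu : probability 'rV[R]_n R).
Hypotheses (sV : smooth V) (gV : gibbs_measure V Z mu).
Implicit Types (f u v w : 'rV[R]_n -> R) (g h : 'rV[R]_n -> 'rV[R]_n).

Definition L2field g := forall i, L2 mu (fun x => g x ord0 i).
Definition energy g h := \int[mu]_x dot (g x) (h x).
Definition mean u := \int[mu]_x u x.

Lemma energyC g h : energy g h = energy h g.
Proof. by apply: eq_Rintegral => x _; rewrite dotC. Qed.

Lemma energy_ge0 g : 0 <= energy g g.
Proof. by apply: Rintegral_ge0 => x _; exact: dot_ge0. Qed.

Lemma energyDl g h k : L2field g -> L2field h -> L2field k ->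
  energy (fun x => g x + h x) k = energy g k + energy h k.
Proof.
move=> hg hh hk; have hs : L2field (fun x => g x + h x).
  by move=> i; under eq_fun do rewrite mxE; exact: L2D.
rewrite /energy !Rintegral_dot// -big_split/=; apply: eq_bigr => i _.
by under [X in ip _ X _]eq_fun do rewrite mxE; rewrite ipDl.
Qed.

Lemma energyZl (a : R) g k : L2field g -> L2field k ->
  energy (fun x => a *: g x) k = a * energy g k.
Proof.
move=> hg hk; have hs : L2field (fun x => a *: g x).
  by move=> i; under eq_fun do rewrite mxE; exact: L2Z.
rewrite /energy !Rintegral_dot// mulr_sumr; apply: eq_bigr => i _.
by under [X in ip _ X _]eq_fun do rewrite mxE; rewrite ipZl.
Qed.

Lemma energy0r g : energy g (fun=> 0) = 0.
Proof.
by rewrite /energy; under eq_Rintegral do rewrite dot0r; rewrite Rintegral_cst// mul0r.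
Qed.

Lemma meanE u : mean u = ip mu u (fun=> 1). Proof. by rewrite ip1. Qed.

Lemma meanD u v : L2 mu u -> L2 mu v -> mean (fun x => u x + v x) = mean u + mean v.
Proof. by move=> hu hv; rewrite !meanE ipDl//; exact: L2_cst. Qed.

Lemma meanZ (a : R) u : L2 mu u -> mean (fun x => a * u x) = a * mean u.
Proof. by move=> hu; rewrite !meanE ipZl//; exact: L2_cst. Qed.

Lemma mean_cst (a : R) : mean (fun=> a) = a.
Proof. by rewrite /mean Rintegral_cst//= ?probability_setT/= ?mulr1. Qed.

Lemma sqr_mean_le_ip u : L2 mu u -> mean u ^+ 2 <= ip mu u u.
Proof.
move=> hu; rewrite meanE; apply: le_trans (cauchy_schwarz hu (L2_cst mu 1)) _.
by rewrite ip1 -/(mean _) mean_cst mulr1.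
Qed.

Variables (lam c0 kap : R).
Hypotheses (lam0 : lam != 0) (c0lam : c0 != lam) (kap0 : 0 < kap).
Hypothesis coercive : forall u g, H1 mu u g ->
  kap * (ip mu u u + energy g g) <= energy g g - lam * ip mu u u + c0 * mean u ^+ 2.

Local Notation W := (('rV[R]_n -> R^o) * ('rV[R]_n -> 'rV[R]_n))%type.
Let D (p : W) := H1 mu p.1 p.2.
Let b (p q : W) : R := energy p.2 q.2 - lam * ip mu p.1 q.1 + c0 * (mean p.1 * mean q.1).

Let D_L2 p : D p -> L2 mu p.1 /\ L2field p.2.
Proof. by move=> /(H1P sV gV)[]. Qed.

Let b_upper p : D p -> b p p <= (1 + `|lam| + `|c0|) * (ip mu p.1 p.1 + energy p.2 p.2).
Proof.
move=> Dp; have [p1 p2] := D_L2 Dp; rewrite /b -expr2.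
have m0 := sqr_mean_le_ip p1; have e0 := energy_ge0 p.2; have i0 := ip_ge0 mu p.1.
set I := ip mu _ _ in m0 i0 *; set E := energy _ _ in e0 *; set m := mean _ ^+ 2 in m0 *.
have m00 : 0 <= m by exact: sqr_ge0.
have h1 : - lam * I <= `|lam| * I by rewrite ler_wpM2r// -normrN ler_norm.
have h2 : c0 * m <= `|c0| * I.
  by apply: (@le_trans _ _ (`|c0| * m)); [rewrite ler_wpM2r// ler_norm|rewrite ler_wpM2l].
have h3 : 0 <= `|lam| * E by rewrite mulr_ge0.
have h4 : 0 <= `|c0| * E by rewrite mulr_ge0.
rewrite mulNr in h1; rewrite !mulrDl !mulrDr !mul1r; lra.
Qed.

Let b_lower p : D p -> ip mu p.1 p.1 + energy p.2 p.2 <= kap^-1 * b p p.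
Proof. by move=> Dp; rewrite ler_pdivlMl// /b -expr2; exact: coercive. Qed.

Let energy_coord g i : L2field g -> ip mu (fun x => g x ord0 i) (fun x => g x ord0 i) <= energy g g.
Proof.
move=> hg; rewrite /energy Rintegral_dot// (bigD1 i)//= lerDl.
by apply: sumr_ge0 => j _; exact: ip_ge0.
Qed.

Let DD p q : D p -> D q -> D (p + q). Proof. by move=> hp hq; exact: (H1D sV gV hp hq). Qed.
Let DZ (a : R) p : D p -> D (a *: p). Proof. by move=> hp; exact: (H1Z sV gV a hp). Qed.
Let DB p q : D p -> D q -> D (p - q).
Proof. by move=> hp hq; rewrite -scaleN1r; apply: DD => //; exact: DZ. Qed.

(** The form controls the norm of H^1(mu), which is complete because L^2(mu) is
    and the weak gradient is a closed operator. *)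
Let b_complete (p : nat -> W) : (forall k, D (p k)) ->
  (forall e : R, 0 < e -> exists N, forall i j, (N <= i)%N -> (N <= j)%N ->
     b (p i - p j) (p i - p j) <= e) ->
  exists2 q, D q & forall e : R, 0 < e -> exists N, forall k, (N <= k)%N ->
     b (p k - q) (p k - q) <= e.
Proof.
move=> Dp cp.
have p1 k := (D_L2 (Dp k)).1; have p2 k := (D_L2 (Dp k)).2.
have cau (e : R) : 0 < e -> exists N, forall i j, (N <= i)%N -> (N <= j)%N ->
    ip mu (p i - p j).1 (p i - p j).1 + energy (p i - p j).2 (p i - p j).2 <= e.
  move=> e0; have [N HN] := cp _ (mulr_gt0 kap0 e0); exists N => i j Ni Nj.
  apply: le_trans (b_lower (DB (Dp i) (Dp j))) _.
  by rewrite ler_pdivrMl//; exact: HN.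
have [u u2 hu] : exists2 u, L2 mu u & forall e : R, 0 < e -> exists N, forall k, (N <= k)%N ->
    \int[mu]_x (((p k).1 x - u x) ^+ 2) <= e.
  apply: L2_complete => // e e0; have [N HN] := cau _ e0; exists N => i j Ni Nj.
  rewrite -(ip_sqr mu (fun x => (p i).1 x - (p j).1 x)).
  by apply: le_trans (HN i j Ni Nj); rewrite lerDl energy_ge0.
have /choice[G HG] (l : 'I_n) : exists G, L2 mu G /\ forall e : R, 0 < e -> exists N, forall k, (N <= k)%N ->
    \int[mu]_x (((p k).2 x ord0 l - G x) ^+ 2) <= e.
  have [|e e0|G G2 HG] := @L2_complete _ _ _ mu (fun k x => (p k).2 x ord0 l).
  - by move=> k; exact: p2.
  - have [N HN] := cau _ e0; exists N => i j Ni Nj.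
    have Dij := DB (Dp i) (Dp j).
    have := energy_coord l (D_L2 Dij).2; rewrite ip_sqr.
    under eq_Rintegral do rewrite !mxE.
    move=> h; apply: le_trans h (le_trans _ (HN i j Ni Nj)).
    by rewrite lerDr ip_ge0.
  - by exists G.
pose g x := \row_i G i x.
have g2 : L2field g by move=> i; under eq_fun do rewrite mxE; case: (HG i).
have conv (e : R) : 0 < e -> exists N, forall k, (N <= k)%N ->
    \int[mu]_x (((p k).1 x - u x) ^+ 2) <= e /\
    forall i, \int[mu]_x (((p k).2 x ord0 i - g x ord0 i) ^+ 2) <= e.
  move=> e0; have [N1 H1] := hu _ e0.
  have /choice[N HN] i := (HG i).2 _ e0.
  exists (N1 + \sum_i N i)%N => k Nk; split.
    by apply: H1; apply: leq_trans Nk; exact: leq_addr.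
  move=> i; under eq_Rintegral do rewrite mxE.
  apply: HN; apply: leq_trans Nk; apply: leq_trans (leq_addl _ _).
  by rewrite (bigD1 i)//= leq_addr.
have Dq : D (u, g).
  apply: (@H1_closed _ _ V Z mu sV gV (fun k => (p k).1) (fun k => (p k).2)) => // e e0.
  by have [N HN] := conv _ e0; exists N; exact: HN.
exists (u, g) => // e e0.
pose C := 1 + `|lam| + `|c0|; have C0 : 0 < C by rewrite /C; have := normr_ge0 lam; have := normr_ge0 c0; lra.
have n1 : 0 < n%:R + 1 :> R by rewrite ltr_wpDl.
have e1 : 0 < e / (C * (n%:R + 1)) by rewrite divr_gt0// mulr_gt0.
have [N HN] := conv _ e1; exists N => k Nk; have [h1 h2] := HN _ Nk.
apply: le_trans (b_upper (DB (Dp k) Dq)) _.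
have Dk := D_L2 (DB (Dp k) Dq).
have -> : e = C * ((n%:R + 1) * (e / (C * (n%:R + 1)))).
  by field; rewrite !gt_eqF.
rewrite -/C ler_pM2l// mulrDl mul1r addrC; apply: lerD; last by rewrite ip_sqr.
rewrite /energy Rintegral_dot; [|exact: Dk.2|exact: Dk.2].
rewrite (_ : n%:R * _ = \sum_(i < n) e / (C * (n%:R + 1))); last by rewrite sumr_const card_ord mulr_natl.
apply: ler_sum => i _.
rewrite ip_sqr; apply: le_trans (h2 i); rewrite le_eqVlt; apply/orP; left; apply/eqP.
by apply: eq_Rintegral => x _; rewrite !mxE.
Qed.

(** Adding c0 times the square of the mean to the Dirichlet form minus lam makes
    the form positive definite. This changes the equation only by a multiple of
    the mean of the solution, which testing against constants identifies, so that the right-hand side can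
    be corrected beforehand. *)
Let solve f : L2 mu f -> exists u w, Delta mu u w /\ forall x, w x - lam * u x = f x.
Proof.
move=> f2; pose s := - (c0 / lam) * mean f; pose f' x := f x + s.
have cs := L2_cst mu s; have f'2 : L2 mu f' by exact: L2D.
have one : D ((fun=> 1), (fun=> 0)) by exact: (H1_cst sV gV 1).
have ff0 : 0 <= ip mu f' f' by exact: ip_ge0.
have bD (p q r : W) : D p -> D q -> D r -> b (p + q) r = b p r + b q r.
  move=> /D_L2[p1 p2] /D_L2[q1 q2] /D_L2[r1 r2].
  rewrite /b (energyDl p2 q2 r2) (ipDl p1 q1 r1) (meanD p1 q1); ring.
have bZ (a : R) (p r : W) : D p -> D r -> b (a *: p) r = a * b p r.
  move=> /D_L2[p1 p2] /D_L2[r1 r2].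
  rewrite /b (energyZl a p2 r2) (ipZl a p1 r1) (meanZ a p1); ring.
have bC (p q : W) : b p q = b q p.
  by rewrite /b energyC ipC (mulrC (mean p.1)).
have b0 p : D p -> 0 <= b p p.
  move=> Dp; have := b_lower Dp; rewrite ler_pdivlMl//; apply: le_trans.
  by rewrite mulr_ge0 ?(ltW kap0)// addr_ge0 ?ip_ge0 ?energy_ge0.
have D0 : D 0 by have := DZ 0 one; rewrite scale0r.
have M0 : 0 <= ip mu f' f' * kap^-1 by rewrite mulr_ge0// invr_ge0 ltW.
have lD (p q : W) : D p -> D q -> ip mu f' (p + q).1 = ip mu f' p.1 + ip mu f' q.1.
  by move=> /D_L2[p1 _] /D_L2[q1 _]; exact: (ipDr p1 q1 f'2).
have lZ (a : R) (p : W) : D p -> ip mu f' (a *: p).1 = a * ip mu f' p.1.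
  by move=> /D_L2[p1 _]; exact: (ipZr a p1 f'2).
have lM (p : W) : D p -> ip mu f' p.1 ^+ 2 <= ip mu f' f' * kap^-1 * b p p.
  move=> Dp; have [p1 _] := D_L2 Dp.
  apply: le_trans (cauchy_schwarz f'2 p1) _; rewrite -mulrA ler_wpM2l//.
  by apply: le_trans (b_lower Dp); rewrite lerDl energy_ge0.
have [[u g] Dug sol] := riesz_representation M0 D0 DD DZ bC bD bZ b0 lD lZ lM b_complete.
have [u2 g2] := D_L2 Dug; rewrite /= in u2 g2.
have mu0 : c0 * mean u = s.
  have := sol _ one; rewrite /b/= energy0r -!meanE mean_cst meanD// mean_cst sub0r mulr1 => E.
  have c0lam' : c0 - lam != 0 by rewrite subr_eq0.
  have : mean u = - mean f / lam.
    apply: (mulfI c0lam'); rewrite (_ : (c0 - lam) * mean u = - (lam * mean u) + c0 * mean u); last by ring.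
    by rewrite E /s; field.
  by move=> ->; rewrite /s; ring.
exists u, (fun x => f x + lam * u x); split; last by move=> x; rewrite addrK.
have lu2 := L2Z lam u2.
split; first by apply/Lfun2P; exact: L2D.
exists g; first exact: Dug.
move=> v h Dvh; have [v2 h2] := @D_L2 (v, h) Dvh; rewrite /= in v2 h2.
have := sol (v, h) Dvh; rewrite /b/= -/(energy g h) -/(ip mu (fun x => f x + lam * u x) v).
rewrite mulrA mu0 ipDl// ipDl// ipZl//.
have -> : ip mu (fun=> s) v = s * mean v.
  by rewrite /ip /mean -RintegralZl//; exact: L2_integrable.
by move=> /eqP; rewrite -subr_eq0 => /eqP E; apply/eqP; rewrite -subr_eq0 -E; apply/eqP; ring.
Qed.

(** Test the equation with u, where the form is coercive, and with 1, which
    expresses the mean of u by that of the right-hand side. *)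
Let bounded_inverse : exists M : R, forall u w, Delta mu u w ->
  ('N[mu]_2%:E[EFin \o u] <= M%:E * 'N[mu]_2%:E[EFin \o (fun x => w x - lam * u x)%R])%E.
Proof.
pose M2 := ((2 * kap)^-1 + `|c0| / lam ^+ 2) * (2 / kap).
have M20 : 0 <= M2.
  by apply: mulr_ge0; [apply: addr_ge0; [rewrite invr_ge0 mulr_ge0// ltW|rewrite divr_ge0 ?sqr_ge0]|rewrite divr_ge0// ltW].
exists (Num.sqrt M2) => u w [/Lfun2P w2 [g ug hug]].
have [u2 g2] := @D_L2 (u, g) ug; rewrite /= in u2 g2.
pose f x := w x - lam * u x.
have f2 : L2 mu f by apply: L2B => //; exact: L2Z.
have one := H1_cst sV gV 1.
have wE x : w x = f x + lam * u x by rewrite /f subrK.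
have mf : mean f = - (lam * mean u).
  have := hug _ _ one; rewrite -/(energy g (fun=> 0)) energy0r -/(ip mu w (fun=> 1)) -meanE.
  rewrite (_ : mean f = mean w + mean (fun x => - (lam * u x))); last first.
    by rewrite -meanD//; exact: L2N (L2Z lam u2).
  move=> <-; rewrite add0r (_ : (fun x => - (lam * u x)) = fun x => (- lam) * u x).
    by rewrite meanZ// mulNr.
  by apply/funext => x; rewrite mulNr.
have uf : energy g g = ip mu f u + lam * ip mu u u.
  have := hug _ _ ug; rewrite -/(energy g g) -/(ip mu w u) => ->.
  rewrite (_ : ip mu w u = ip mu (fun x => f x + lam * u x) u).
    by rewrite (ipDl f2 (L2Z lam u2) u2) (ipZl lam u2 u2).
  by apply: eq_Rintegral => x _; rewrite wE.
have co := coercive ug.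
rewrite !Lnorm2E// -EFinM lee_fin -sqrtrM//; apply: ler_wsqrtr.
rewrite -!ip_sqr.
have m2 := sqr_mean_le_ip f2.
have e0 := energy_ge0 g.
have quad : 2 * kap * ip mu f u <= kap ^+ 2 * ip mu u u + ip mu f f.
  have ku := L2Z kap u2.
  have := ip_ge0 mu (fun x => f x - kap * u x).
  have d2 := L2B f2 ku.
  rewrite (ipBl f2 ku d2) (ipBr f2 ku f2) (ipBr f2 ku ku) (ipZl kap u2 f2) (ipZl kap u2 ku).
  rewrite (ipZr kap u2 f2) (ipZr kap u2 u2) (ipC mu u f); lra.
have mm : c0 * mean u ^+ 2 <= `|c0| / lam ^+ 2 * ip mu f f.
  apply: (@le_trans _ _ (`|c0| * mean u ^+ 2)); first by rewrite ler_wpM2r ?sqr_ge0// ler_norm.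
  rewrite -mulrA ler_wpM2l// ler_pdivlMl ?exprn_even_gt0//.
  by rewrite -exprMn -sqrrN -mf.
have k1 : kap * ip mu u u <= ip mu f u + c0 * mean u ^+ 2.
  have : 0 <= kap * energy g g by rewrite mulr_ge0// ltW.
  by move: co; rewrite uf mulrDr; lra.
have k2 : kap ^+ 2 / 2 * ip mu u u <= ip mu f f / 2 + kap * (`|c0| / lam ^+ 2 * ip mu f f).
  have := ler_wpM2l (ltW kap0) (le_trans k1 (lerD (lexx _) mm)); rewrite mulrDr; lra.
rewrite -(ler_pM2l (_ : 0 < kap ^+ 2 / 2)); last by rewrite divr_gt0// exprn_gt0.
apply: le_trans k2 _; rewrite le_eqVlt; apply/orP; left; apply/eqP.
by rewrite /M2; field; rewrite lam0 gt_eqF.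
Qed.

Lemma coercive_resolvent : resolvent_set mu lam.
Proof. by split; [move=> f /Lfun2P; exact: solve|exact: bounded_inverse]. Qed.

End resolvent.

(** * Lower bounds for the spectral gap *)

Section spectral_gap.
Context {R : realType} {n : nat}.
Variables (V : 'rV[R]_n -> R) (Z : R) (mu : probability 'rV[R]_n R).
Hypotheses (sV : smooth V) (gV : gibbs_measure V Z mu).

Lemma lambda1_ge (B : R) : (forall lam, lam < B -> lam != 0 -> resolvent_set mu lam) ->
  (B%:E <= lambda1 mu)%E.
Proof.
move=> h; apply: le_ereal_inf_tmp => _ [lam [slam lam0] <-].
rewrite lee_fin leNgt; apply/negP => lamB; apply: slam; apply: h => //.
exact/eqP.
Qed.

Lemma negative_resolvent (lam : R) : lam < 0 -> resolvent_set mu lam.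
Proof.
move=> lam0; apply: (@coercive_resolvent _ _ V Z mu sV gV lam 0 (Num.min 1 (- lam))).
- by rewrite lt_eqF.
- by rewrite eq_sym lt_eqF.
- by rewrite lt_min ltr01 oppr_gt0.
move=> u g ug; rewrite mul0r addr0 mulrDr addrC -mulNr.
have e0 := energy_ge0 mu g; have i0 := ip_ge0 mu u.
apply: lerD; last by rewrite ler_wpM2r// ge_min lexx orbT.
by rewrite -[leRHS]mul1r ler_wpM2r// ge_min lexx.
Qed.

Lemma lambda1_ge0 : (0 <= lambda1 mu)%E.
Proof. by apply: lambda1_ge => lam lam0 _; exact: negative_resolvent. Qed.

(** If 0 < lam < 1 / K the form minus lam is coercive on functions of mean 0, by
    the Poincare inequality; adding 2 lam times the square of the mean makes it
    coercive on constants too. *)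
Lemma poincare_lambda1 (K : R) : 0 < K ->
  (forall u g, H1 mu u g ->
     ip mu u u - (\int[mu]_x u x) ^+ 2 <= K * \int[mu]_x dot (g x) (g x)) ->
  ((K^-1)%:E <= lambda1 mu)%E.
Proof.
move=> K0 poinc; apply: lambda1_ge => lam lamK lam0.
have [lamn|lamp|lamE] := ltgtP lam 0; last by rewrite lamE eqxx in lam0.
  exact: negative_resolvent.
pose d := 1 - lam * K.
have d0 : 0 < d by rewrite subr_gt0 -ltr_pdivlMr// div1r.
have K1 : 0 < K + 1 by lra.
apply: (@coercive_resolvent _ _ V Z mu sV gV lam (2 * lam) (Num.min (d / (K + 1)) lam)) => //.
- by rewrite -subr_eq0 mulrDl mul1r addrK.
- by rewrite lt_min lamp divr_gt0.
move=> u g ug; have := poinc _ _ ug; rewrite -/(energy mu g g) -/(mean mu u).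
have e0 := energy_ge0 mu g; have m0 := sqr_ge0 (mean mu u).
set I := ip mu u u; set E := energy mu g g in e0 *; set m := mean mu u ^+ 2 in m0 *.
set kap := Num.min _ _ => var.
have k1 : kap * (K + 1) <= d.
  by rewrite -ler_pdivlMr// /kap ge_min lexx.
have k2 : kap <= lam by rewrite /kap ge_min lexx orbT.
have k0 : 0 <= kap by rewrite /kap le_min (ltW lamp) divr_ge0// ltW.
have h1 := ler_wpM2l k0 var.
have h2 := ler_wpM2r e0 k1.
have h3 := ler_wpM2r m0 k2.
have h4 := ler_wpM2l (ltW lamp) var.
have hd : d * E = E - lam * (K * E) by rewrite /d; ring.
rewrite hd in h2; rewrite mulrBr in h1; rewrite mulrBr in h4.
have h5 : kap * (K + 1) * E = kap * (K * E) + kap * E by ring.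
rewrite h5 in h2; rewrite mulrDr.
have -> : 2 * lam * m = 2 * (lam * m) by ring.
lra.
Qed.

End spectral_gap.

(** * The gap in terms of the dimension *)

Section gap_estimate.
Context {R : realType}.

Lemma powR_le0_anti (x y r : R) : 0 < x -> x <= y -> r <= 0 -> y `^ r <= x `^ r.
Proof.
move=> x0 xy r0; have y0 := lt_le_trans x0 xy.
rewrite -[r]opprK !(powRN _ (- r)) lef_pV2 ?posrE ?powR_gt0//.
by apply: ge0_ler_powR; rewrite ?nnegrE ?oppr_ge0// ltW.
Qed.

Variables (alpha a c Kc : R).
Hypotheses (alpha1 : 1 < alpha) (alpha2 : alpha <= 2) (a0 : 0 < a) (c0 : 0 < c).
Hypotheses (Kc1 : 1 < Kc) (Kca : 200 <= Kc * a)
  (Kcc : 128 <= (alpha - 1) * (Kc * Num.min c (1 / 2)) * a).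

(** The convexity of V on the ball of radius 2 Kc Ra, relative to the factor
    (alpha - 1) (a n)^(1 - 2 / alpha). *)
Definition convexity_ratio := Num.min c ((2 * Kc) `^ (alpha - 2)).
Local Notation m := convexity_ratio.

Definition poincare_factor := 6 / ((alpha - 1) * m) + 512 / a.

Lemma convexity_ratio_gt0 : 0 < m.
Proof. by have := Kc1 => K1; rewrite lt_min c0 powR_gt0// mulr_gt0//; lra. Qed.

Lemma poincare_factor_gt0 : 0 < poincare_factor.
Proof.
have m0 := convexity_ratio_gt0; have al1 := alpha1; rewrite /poincare_factor.
apply: addr_gt0; apply: divr_gt0.
- by rewrite ltr0n.
- by rewrite mulr_gt0//; lra.
- by rewrite ltr0n.
- exact: a0.
Qed.

Lemma convexity_ratio_lower : Kc * Num.min c (1 / 2) <= m * Kc ^+ 2.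
Proof.
have K1 := Kc1; have al1 := alpha1; have K0 : 0 < Kc by lra.
have h : 1 / 2 <= Kc * (2 * Kc) `^ (alpha - 2).
  apply: (@le_trans _ _ (Kc * (2 * Kc) `^ (-1))).
    rewrite powR_inv1; last by rewrite mulr_ge0// ltW.
    by rewrite le_eqVlt; apply/orP; left; apply/eqP; field; rewrite gt_eqF.
  by rewrite ler_pM2l//; apply: ler_powR; lra.
rewrite expr2 mulrA [leRHS]mulrC ler_pM2l//.
have h1 : Num.min c (1 / 2) <= c by rewrite ge_min lexx.
have h2 : Num.min c (1 / 2) <= 1 / 2 by rewrite ge_min lexx orbT.
rewrite /convexity_ratio; case: (leP c ((2 * Kc) `^ (alpha - 2))) => _.
  by apply: le_trans h1 _; rewrite ler_peMr// ltW.
by apply: le_trans h2 _; rewrite [leRHS]mulrC.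
Qed.

Variables (n : nat) (V : 'rV[R]_n -> R) (Z : R) (mu : probability 'rV[R]_n R).
Hypothesis n1 : (1 <= n)%N.
Local Notation N := (a * n%:R).
Local Notation Ra := (N `^ (1 / alpha)).
Local Notation T := (N `^ (1 - 2 / alpha)).
Hypotheses (sV : smooth V)
  (hessV : forall x, enorm x <= Ra -> hess_ge V x (c * (alpha - 1) * T))
  (VE : forall x, Ra <= enorm x -> V x = enorm x `^ alpha / alpha)
  (gV : gibbs_measure V Z mu).

Let n0 : 1 <= n%:R :> R. Proof. by rewrite ler1n. Qed.
Let N0 : 0 < N. Proof. by rewrite mulr_gt0// ltr0n. Qed.
Let Ra0 : 0 < Ra. Proof. exact: powR_gt0. Qed.
Let T0 : 0 < T. Proof. exact: powR_gt0. Qed.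
Let al0 : alpha != 0. Proof. by rewrite gt_eqF//; exact: lt_trans alpha1. Qed.

(** The two scaling identities through which the dimension enters. *)
Let RaT : Ra `^ (alpha - 2) = T.
Proof. by rewrite -powRrM; congr (_ `^ _); field. Qed.

Let RaN : Ra ^+ 2 * T = N.
Proof.
rewrite -RaT -powR_mulrn ?(ltW Ra0)// -powRD; last by apply/implyP => _; rewrite gt_eqF.
by rewrite addrC subrK -powRrM div1r mulVf// powRr1// ltW.
Qed.

Let r1 := Kc * Ra.
Let P := r1 ^+ 2.
Let S := r1 `^ (alpha - 1).
Let k := (alpha - 1) * (T * m).

Let Kc0 : 0 < Kc. Proof. exact: lt_trans Kc1. Qed.
Let r10 : 0 < r1. Proof. exact: mulr_gt0. Qed.
Let P0 : 0 < P. Proof. exact: exprn_gt0. Qed.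
Let S0 : 0 < S. Proof. exact: powR_gt0. Qed.
Let k0 : 0 < k.
Proof. by rewrite mulr_gt0 ?subr_gt0// mulr_gt0// convexity_ratio_gt0. Qed.

Let Sr1 : S * r1 = r1 `^ alpha.
Proof. by rewrite mulrC mulr_powRB1//; [exact: ltW|exact: lt_trans alpha1]. Qed.

Let r1_lower : Kc * N <= r1 `^ alpha.
Proof.
rewrite /r1 powRM ?(ltW Kc0) ?(ltW Ra0)//.
have -> : Ra `^ alpha = N by rewrite -powRrM div1r mulVf// powRr1// ltW.
by rewrite ler_pM2r//; apply: le1r_powR; exact: ltW.
Qed.

Let enorm_lower (x : 'rV[R]_n) : P <= dot x x -> r1 <= enorm x.
Proof.
by rewrite -sqr_enorm /P ler_pXn2r// nnegrE; [exact: ltW|exact: enorm_ge0].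
Qed.

Let Pn (x : 'rV[R]_n) : P <= dot x x -> 2 * n%:R <= enorm x `^ alpha.
Proof.
move=> /enorm_lower h.
apply: (@le_trans _ _ (r1 `^ alpha)); last first.
  by apply: ge0_ler_powR => //; rewrite ?nnegrE ?enorm_ge0 ?(ltW r10)// ltW//; exact: lt_trans alpha1.
apply: le_trans r1_lower; rewrite mulrA ler_wpM2r//.
by apply: le_trans Kca; rewrite ler_nat.
Qed.

Let PS (x : 'rV[R]_n) : P <= dot x x -> S <= enorm x `^ (alpha - 1).
Proof.
move=> /enorm_lower h; apply: ge0_ler_powR => //; rewrite ?nnegrE ?enorm_ge0 ?(ltW r10)//.
by rewrite subr_ge0 ltW.
Qed.

Let hessP (x : 'rV[R]_n) : dot x x <= 4 * P -> hess_ge V x k.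
Proof.
move=> xP v; have v0 := dot_ge0 v.
have m1 : m <= c by rewrite ge_min lexx.
have m2 : m <= (2 * Kc) `^ (alpha - 2) by rewrite ge_min lexx orbT.
have am : 0 < alpha - 1 by rewrite subr_gt0.
have [xR|xR] := leP (enorm x) Ra.
  apply: le_trans (hessV xR v); rewrite ler_wpM2r//.
  by rewrite /k (_ : c * _ * _ = (alpha - 1) * (T * c)) ?ler_pM2l//; ring.
apply: le_trans (hess_ge_radial alpha1 alpha2 (ltW Ra0) sV VE xR v); rewrite ler_wpM2r//.
rewrite /k ler_pM2l//.
have x0 : 0 < enorm x by exact: lt_trans xR.
have xr : enorm x <= 2 * Kc * Ra.
  rewrite -(@ler_pXn2r _ 2)// ?nnegrE ?enorm_ge0//; last by rewrite ltW// !mulr_gt0.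
  by rewrite sqr_enorm; apply: le_trans xP _; rewrite /P /r1 -mulrA [in leRHS]exprMn -natrX.
apply: le_trans (powR_le0_anti x0 xr _); last by rewrite subr_le0.
by rewrite (@powRM _ (2 * Kc) Ra) ?(ltW Ra0) ?mulr_ge0 ?(ltW Kc0)// RaT mulrC ler_pM2r.
Qed.

Let kP : 128 <= k * P.
Proof.
rewrite /k /P /r1 (_ : _ * _ = (alpha - 1) * (m * Kc ^+ 2) * (Ra ^+ 2 * T)); last by ring.
rewrite RaN mulrA.
have am : 0 < alpha - 1 by rewrite subr_gt0.
have h : 128 <= (alpha - 1) * (m * Kc ^+ 2) * a.
  by apply: le_trans Kcc _; rewrite ler_pM2r// ler_pM2l// convexity_ratio_lower.
by apply: (le_trans h); rewrite ler_peMr// (le_trans _ h).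
Qed.

Let SP : 64 * 512 <= S ^+ 2 * P.
Proof.
rewrite /P -exprMn Sr1.
apply: (@le_trans _ _ ((200 : R) ^+ 2)); first by rewrite expr2; lra.
have h : 200 <= r1 `^ alpha.
  apply: le_trans r1_lower; apply: le_trans Kca _; rewrite mulrA ler_peMr//.
  by rewrite mulr_ge0// ltW.
by rewrite lerXn2r ?nnegrE// powR_ge0.
Qed.

Let S2_lower : a * T <= S ^+ 2.
Proof.
rewrite -(ler_pM2r P0) /P -exprMn Sr1.
apply: (@le_trans _ _ ((Kc * N) ^+ 2)); last first.
  by rewrite lerXn2r ?nnegrE ?powR_ge0 ?r1_lower// mulr_ge0 ?(ltW Kc0) ?(ltW N0).
rewrite /r1 exprMn mulrC -mulrA [_ ^+ 2 * (a * T)]mulrCA RaN exprMn expr2 ler_pM2l ?mulr_gt0//.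
by rewrite expr2 ler_pM2r// ler_peMr// ltW.
Qed.

Let factor_bound : 6 / k + 512 / S ^+ 2 <= poincare_factor / T.
Proof.
have am : 0 < alpha - 1 by rewrite subr_gt0.
have m0 := convexity_ratio_gt0.
rewrite /poincare_factor [leRHS]mulrDl; apply: lerD.
  by rewrite le_eqVlt; apply/orP; left; apply/eqP; rewrite /k; field; rewrite !gt_eqF.
rewrite -mulrA; apply: ler_wpM2l; first by rewrite ler0n.
by rewrite -invfM lef_pV2 ?posrE ?exprn_gt0 ?mulr_gt0 ?S2_lower.
Qed.

(** The compactly supported inequality holds with P = (Kc Ra)^2: beyond radius
    Kc Ra the potential is radial and steep, and up to radius 2 Kc Ra it is
    convex with constant k. Both constants are multiples of T = Ra^(alpha - 2)
    with factors that do not involve n. *)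
Lemma lambda1_lower : ((T / (4 * poincare_factor))%:E <= lambda1 mu)%E.
Proof.
have Q0 := poincare_factor_gt0.
pose K := 6 / k + 512 / S ^+ 2.
have K0 : 0 < K.
  apply: addr_gt0; apply: divr_gt0; [by rewrite ltr0n|exact: k0|by rewrite ltr0n|].
  exact: exprn_gt0.
apply: (@le_trans _ _ ((4 * K)^-1)%:E).
  rewrite lee_fin -[leLHS]invrK lef_pV2 ?posrE ?invr_gt0 ?divr_gt0 ?mulr_gt0//.
  by rewrite invfM invrK mulrCA ler_pM2l// mulrC; exact: factor_bound.
have RaP : Ra ^+ 2 < P by rewrite /P ltr_pXn2r ?nnegrE ?(ltW Ra0) ?(ltW r10)// ltr_pMl.
have P20 : 0 < 2 * P by exact: mulr_gt0.
have Z0 : 0 < Z by case: gV.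
pose chi : 'rV[R]_n -> R := radial_cutoff (2 * P).
have Cchi := @C11_radial_cutoff _ n _ P20.
have bchi : bounded_measurable chi by exact: C11_bounded_fun Cchi.
have n1' := n0; have n2 : 0 < n%:R + 1 :> R by lra.
pose d := Num.min 1 (P / (n%:R + 1)).
have d0 : 0 < d by rewrite lt_min ltr01 divr_gt0.
have d1 : d <= 1 by rewrite ge_min lexx.
have d2 : d <= P / (n%:R + 1) by rewrite ge_min lexx orbT.
pose I0 := \int[lebesgue_rV n]_x (1 * restricted_gibbs V (centered_ball (4 * P)) x).
have I00 : 0 <= I0.
  by apply: Rintegral_ge0 => x _; rewrite mul1r; exact: restricted_gibbs_ge0.
apply: (@poincare_lambda1 _ _ V Z mu sV gV); first by rewrite mulr_gt0.
apply: (@poincare_H1 _ _ V Z mu sV gV K (3 * Z / I0) d chi) => //.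
- exact: ltW.
- by rewrite divr_ge0// mulr_ge0// ltW.
- by move=> x; exact: radial_cutoff_ge0.
- move=> x xd; apply: radial_cutoff_inside => //.
  apply: le_trans (cube_enorm (ltW d0) xd) _.
  have : d * (n%:R + 1) <= P by rewrite -ler_pdivlMr.
  have : d ^+ 2 <= d by rewrite expr2 ler_piMr// ltW.
  move=> /(ler_wpM2l (le_trans ler01 n0)) h1 h2; have := P0; have := d0; lra.
move=> F G r FG supp.
have := compactly_supported_poincare alpha1 (ltW Ra0) sV VE P0 RaP S0 k0 Pn PS hessP kP SP
  FG (fun x xr => (supp x xr).1) (fun x xr => (supp x xr).2).
rewrite -/K -/I0 -/chi.
have zE (f : 'rV[R]_n -> R) : bounded_measurable f ->
    \int[lebesgue_rV n]_x (f x * expR (- V x)) = Z * \int[mu]_x f x.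
  move=> bf; have mf : measurable_fun setT f by case: bf.
  rewrite (Rintegral_gibbs sV gV mf) -RintegralZl//.
    by apply: eq_Rintegral => x _; rewrite /gibbs_density; field; rewrite gt_eqF.
  by apply/(integrable_gibbs sV gV mf).1/L2_integrable; exact: L2_bounded.
have bF := C11_bounded_fun FG.
rewrite (zE (fun x => F x ^+ 2)); last exact: bounded_measurableX.
rewrite (zE (fun x => dot (G x) (G x))); last exact: (C11_bounded_dot FG).
rewrite (zE (fun x => F x * chi x)); last exact: bounded_measurableM.
rewrite -(ip_sqr mu F) -/(ip mu F chi) => h.
rewrite -(ler_pM2l Z0); apply: le_trans h _; rewrite le_eqVlt; apply/orP; left; apply/eqP.
by have [->|I0n] := eqVneq I0 0; [rewrite invr0; ring|field].
Qed.

End gap_estimate.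

Theorem proposition7p2 (R : realType) (alpha a c : R) :
  1 < alpha -> alpha <= 2 -> 0 < a -> c <= 1 ->
  exists2 C : R, 0 < C &
  forall (n : nat) (V : 'rV[R]_n -> R) (Z : R) (mu : probability 'rV[R]_n R),
    (1 <= n)%N ->
    let Ra := (a * n%:R) `^ (1 / alpha) in
    smooth V ->
    (forall x, enorm x <= Ra ->
       hess_ge V x (c * (alpha - 1) * (a * n%:R) `^ (1 - 2 / alpha))) ->
    (forall x, Ra <= enorm x -> V x = enorm x `^ alpha / alpha) ->
    gibbs_measure V Z mu ->
    (1 <= a ->
       ((C * Num.min (Num.min (1 / (4 * a)) ((alpha - 1) / 2))
                     (c * (alpha - 1))
           * (a * n%:R) `^ (1 - 2 / alpha))%:E <= lambda1 mu)%E) /\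
    (a < 1 ->
       ((C * Num.min (Num.min (1 / 4) ((alpha - 1) / 2))
                     (c * a `^ (1 - 2 / alpha) * (alpha - 1))
           * n%:R `^ (1 - 2 / alpha))%:E <= lambda1 mu)%E).
Proof.
move=> alpha1 alpha2 a0 _.
have am : 0 < alpha - 1 by rewrite subr_gt0.
have al0 : 0 < alpha by exact: lt_trans alpha1.
have [c0|c0] := leP c 0.
  (* If c <= 0 the minimum is nonpositive, and the spectrum is nonnegative. *)
  exists 1 => // n V Z mu n1 Ra sV _ _ gV.
  have gap0 := lambda1_ge0 sV gV.
  split=> _; apply: le_trans gap0; rewrite lee_fin mul1r mulr_le0_ge0 ?powR_ge0//.
  - by rewrite ge_min mulr_le0_ge0 ?(ltW am)// orbT.
  - by rewrite ge_min -mulrA mulr_le0_ge0 ?orbT// mulr_ge0 ?powR_ge0 ?(ltW am).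
pose q := Num.min c (1 / 2).
have q0 : 0 < q by rewrite lt_min c0 divr_gt0.
have aq : 0 < (alpha - 1) * q * a by rewrite !mulr_gt0.
(* The radius Kc Ra is large enough for the tail inequality (Kc a >= 200) and for
   the convexity to dominate the gradient of the cutoffs. *)
pose Kc := 1 + 200 / a + 128 / ((alpha - 1) * q * a).
have k1 : 0 < 200 / a by rewrite divr_gt0.
have k2 : 0 < 128 / ((alpha - 1) * q * a) by rewrite divr_gt0.
have Kc1 : 1 < Kc by rewrite /Kc; lra.
have Kca : 200 <= Kc * a by rewrite -ler_pdivrMr// /Kc; lra.
have Kcc : 128 <= (alpha - 1) * (Kc * q) * a.
  have -> : (alpha - 1) * (Kc * q) * a = Kc * ((alpha - 1) * q * a) by ring.
  by rewrite -ler_pdivrMr// /Kc; lra.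
pose Q := poincare_factor alpha a c Kc.
have Q0 : 0 < Q by exact: poincare_factor_gt0.
pose C := (4 * Q)^-1.
have C0 : 0 < C by rewrite invr_gt0 mulr_gt0.
exists C => // n V Z mu n1 Ra sV hV VE gV.
have := lambda1_lower alpha1 alpha2 a0 c0 Kc1 Kca Kcc n1 sV hV VE gV.
rewrite -/Q mulrC -/C => gap.
(* The minimum is at most 1, so that it suffices to bound the gap below by a
   multiple of the power of a n. *)
have le1 (x y : R) : Num.min (Num.min x ((alpha - 1) / 2)) y <= 1.
  by rewrite !ge_min; apply/orP; left; apply/orP; right; lra.
have n0 : 0 <= n%:R :> R by [].
have bound (m : R) : m <= 1 -> C * m <= C by move=> m1; rewrite ler_piMr// ltW.
split=> ha; apply: le_trans gap; rewrite lee_fin.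
  by rewrite ler_wpM2r ?powR_ge0// bound.
have b0 : 1 - 2 / alpha <= 0 by rewrite subr_le0 ler_pdivlMr// mul1r.
have aN : n%:R `^ (1 - 2 / alpha) <= (a * n%:R) `^ (1 - 2 / alpha).
  by apply: powR_le0_anti => //; rewrite ?mulr_gt0 ?ltr0n// ler_piMl// ltW.
apply: (@le_trans _ _ (C * n%:R `^ (1 - 2 / alpha))); first by rewrite ler_wpM2r ?powR_ge0// bound.
by rewrite ler_pM2l.
Qed.
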